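(* Assume that there exist a real number $\beta$ with $0<\beta<\frac12$, a constant $C_0$ and two continuous functions $h_1,h_2:[0,\infty)^4\to[0,\infty)$ such that, for all $i=1,\dots,I$ and all $U_1,U_2,V_1,V_2\in\mathcal V$, $$\begin{aligned}\|F_i(U_1,V_1)-F_i(U_2,V_2)\|_{\mathcal H}\le{}& C_0\|U_1-U_2\|_{\mathcal H}\\&+h_1(\|U_1\|_{\mathcal V},\|U_2\|_{\mathcal V},\|V_1\|_{\mathcal V},\|V_2\|_{\mathcal V})\,\|U_1-U_2\|_{\mathcal V}\\&+h_2(\|U_1\|_{\mathcal V},\|U_2\|_{\mathcal V},\|V_1\|_{\mathcal V},\|V_2\|_{\mathcal V})\,\|V_1-V_2\|_{D((-\mathcal A)^\beta)} .\end{aligned}$$ Let $\theta=\min\{\beta,\frac12-\beta\}$. Then for any initial datum $U_0\in C([0,\tau];\mathcal V)\cap C^{0,\theta}([0,\tau],D((-\mathcal A)^\beta))$ there exist a time $T_\infty\in(0,+\infty]$ and a unique solution $U\in C([0,T_\infty),\mathcal V)\cap C^1((0,T_\infty),\mathcal H)$ of the problem $$U_t(t)=\mathcal AU(t)+\sum_{i=1}^IF_i(U(t),U(t-\tau_i)),\ t>0,\qquad U(t-\tau)=U_0(t)\ \ \forall t\in(0,\tau],$$ on $(0,T_\infty)$.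
   Context: $\mathcal H$ is a Hilbert space with inner product $(\cdot,\cdot)_{\mathcal H}$ and norm $\|\cdot\|_{\mathcal H}$. $\mathcal A$ is a negative selfadjoint operator in $\mathcal H$; $\lambda_1>0$ denotes the smallest eigenvalue of $-\mathcal A$. $\mathcal V=D((-\mathcal A)^{1/2})$ is the Hilbert space with norm $\|U\|_{\mathcal V}^2=((-\mathcal A)^{1/2}U,(-\mathcal A)^{1/2}U)_{\mathcal H}$, so that $\lambda_1\|U\|_{\mathcal H}^2\le\|U\|_{\mathcal V}^2$ for $U\in\mathcal V$. $D((-\mathcal A)^\beta)$ is the domain of the fractional power, with norm $\|(-\mathcal A)^\beta\cdot\|_{\mathcal H}$. $I$ is a positive integer, $\tau_1,\dots,\tau_I>0$ are pairwise distinct delays with $\tau_i<\tau:=\tau_1$ for $i=2,\dots,I$, and the functions $F_i$ are defined (at least) on $\mathcal V\times\mathcal V$ with values in $\mathcal H$. The initial condition means $U(s)=U_0(s+\tau)$ for $s\in(-\tau,0]$; in particular $U(0)=U_0(\tau)$. $C^{0,\theta}$ denotes Hölder continuous functions with exponent $\theta$. *)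

(* Defs.v *)
From Stdlib Require Import Reals.
From Coquelicot Require Import Coquelicot.

Open Scope R_scope.

(* Real Hilbert spaces.  A complex Hilbert space is covered through its
   underlying real space with the inner product Re (x, y): selfadjointness,
   real eigenvalues and fractional powers are unchanged. *)
Record HilbertSpace := {
  hilb_space :> CompleteNormedModule R_AbsRing;
  ip : hilb_space -> hilb_space -> R;
  ip_sym : forall x y, ip x y = ip y x;
  ip_plus_l : forall x y z, ip (plus x y) z = ip x z + ip y z;
  ip_scal_l : forall (a : R) x y, ip (scal a x) y = a * ip x y;
  ip_norm : forall x, ip x x = norm x ^ 2
}.

Arguments ip {h} _ _.

(* A possibly unbounded linear operator; [op_app] is total, but its values
   outside [dom] are irrelevant. *)
Record LinearOperator (H : HilbertSpace) := {
  dom : H -> Prop;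
  op_app :> H -> H;
  dom_zero : dom zero;
  dom_plus : forall x y, dom x -> dom y -> dom (plus x y);
  dom_scal : forall (a : R) x, dom x -> dom (scal a x);
  op_plus : forall x y, dom x -> dom y ->
    op_app (plus x y) = plus (op_app x) (op_app y);
  op_scal : forall (a : R) x, dom x -> op_app (scal a x) = scal a (op_app x)
}.

Arguments dom {H} _ _.
Arguments op_app {H} _ _.

Section Operators.

Context {H : HilbertSpace} (A : LinearOperator H).

Definition densely_defined : Prop :=
  forall (x : H) (eps : R), 0 < eps ->
    exists y : H, dom A y /\ norm (minus y x) < eps.

Definition adjoint_graph (y z : H) : Prop :=
  forall x : H, dom A x -> ip (A x) y = ip x z.

Definition selfadjoint : Prop :=
  densely_defined /\
  forall y z : H, adjoint_graph y z <-> (dom A y /\ A y = z).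

Definition negative : Prop :=
  forall u : H, dom A u -> ip (A u) u <= 0.

Definition eigenvalue_opp (mu : R) : Prop :=
  exists u : H, u <> zero /\ dom A u /\ opp (A u) = scal mu u.

(* [l] is the smallest eigenvalue and the bottom of the spectrum of [-A].  The
   last clause is needed since the resolvent of [A] is not assumed compact; as
   (-A u, u) = ||(-A)^(1/2) u||^2 on [dom A], it is the inequality
   l ||u||_H^2 <= ||u||_V^2 on the dense subset [dom A] of V. *)
Definition smallest_eigenvalue_opp (l : R) : Prop :=
  eigenvalue_opp l /\
  (forall mu : R, eigenvalue_opp mu -> l <= mu) /\
  (forall u : H, dom A u -> l * norm u ^ 2 <= ip (opp (A u)) u).

(* Graph of (-A)^alpha = ((-A)^(-alpha))^(-1) for 0 < alpha < 1, where
   (-A)^(-alpha) w =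
     sin (PI alpha) / PI * int_0^oo t^(-alpha) (t - A)^(-1) w dt
   and [r t] stands for (t - A)^(-1) w. *)
Definition frac_graph (alpha : R) (u w : H) : Prop :=
  exists (r : R -> H) (J : H),
    (forall t : R, 0 < t -> dom A (r t) /\ minus (scal t (r t)) (A (r t)) = w) /\
    is_RInt_gen (fun t : R => scal (Rpower t (- alpha)) (r t))
      (at_right 0) (Rbar_locally p_infty) J /\
    u = scal (sin (PI * alpha) / PI) J.

Definition frac_dom (alpha : R) (u : H) : Prop :=
  exists w : H, frac_graph alpha u w.

Definition frac_pow (alpha : R) (u : H) : H := iota (frac_graph alpha u).

Definition frac_norm (alpha : R) (u : H) : R := norm (frac_pow alpha u).

Definition in_V (u : H) : Prop := frac_dom (1 / 2) u.
Definition norm_V (u : H) : R := frac_norm (1 / 2) u.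

Definition continuous_into_V (S : R -> Prop) (U : R -> H) : Prop :=
  (forall t, S t -> in_V (U t)) /\
  (forall t, S t ->
     filterlim (fun s => norm_V (minus (U s) (U t)))
       (within S (locally t)) (locally 0)).

(* [s <> t] is required because [Rpower 0 theta = 1]. *)
Definition holder_into_frac (alpha theta : R) (S : R -> Prop) (U : R -> H) : Prop :=
  (forall t, S t -> frac_dom alpha (U t)) /\
  exists L : R, forall s t, S s -> S t -> s <> t ->
    frac_norm alpha (minus (U s) (U t)) <= L * Rpower (Rabs (s - t)) theta.

(* The delays are tau 1, ..., tau N, the largest one being tau 1.  Only the
   values of [U] on (- tau 1, T) matter. *)
Definition is_solution (N : nat) (tau : nat -> R) (F : nat -> H -> H -> H)
    (U0 : R -> H) (T : Rbar) (U : R -> H) : Prop :=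
  continuous_into_V (fun t => 0 <= t /\ Rbar_lt t T) U /\
  (exists dU : R -> H,
     forall t, 0 < t -> Rbar_lt t T ->
       is_derive U t (dU t) /\ continuous dU t /\
       dom A (U t) /\
       dU t = plus (A (U t)) (sum_n_m (fun i => F i (U t) (U (t - tau i))) 1 N)) /\
  (forall t, 0 < t <= tau 1%nat -> U (t - tau 1%nat) = U0 t).

End Operators.

Definition orthant4 (p : R * R * R * R) : Prop :=
  let '(a, b, c, d) := p in 0 <= a /\ 0 <= b /\ 0 <= c /\ 0 <= d.

(* Main.v *)
(* In the variable w = (-A)^(1/2) u the V-norm of u is the H-norm of w, and on an
   interval shorter than every delay the delayed arguments are known data.  The
   problem becomes the fixed point equation
     w(t) = S(t) w(0) + (-A)^(1/2) int_0^t S(t - s) f(s, w(s)) ds,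
   S(t) = exp(t A), with f Lipschitz in w and Hoelder in s; the bound
   ||(-A)^(1/2) S(t)|| <= t^(-1/2) makes it a contraction for small times.

   Resolvents come from minimising the quadratic energy on the domain of A, S(t)
   from the implicit Euler scheme with 2^k steps, and its smoothing bounds from
   discrete energy estimates.  Singular convolutions are replaced by sums over
   geometric subdivisions of [0, t] accumulating at t: they show that the Duhamel
   integral is Hoelder continuous in time with values in V, hence f(s, w(s)) is
   Hoelder continuous in H, hence A u is continuous for t > 0.

   The square of the Balakrishnan integral is identified with (-A)^(-1) by letting
   the shift s in (s - A)^(-1/2) run from 0 to infinity.  Uniqueness is a Gronwall
   argument for the H-norm of the difference of two solutions. *)

(* The bound on [F] involves V-norms, so the fixed point must live in V although [F] only takes
   values in H. The norm of D((-A)^beta) acts as a modulus of continuity in time: up to the smallest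
   delay the [h2] term compares two values of the history and becomes [K |t - t'|^theta]. The
   obstacle is regularity in time. A merely continuous right-hand side need not bring the Duhamel
   integral into the domain of A, and the orbit S(t) w(0) of an element of H is Hoelder continuous
   only away from t = 0. The equation is therefore restarted at time t / 2 before its regularity is
   studied. Domain questions are avoided by working with the bounded operator G = (-A)^(-1): a
   vector of the domain is written G z, commuting with A means commuting with G, and estimates are
   first proved on the range of G or of G G, then extended by density. *)
Require Import Defs.
From Stdlib Require Import Reals Lra Lia Classical IndefiniteDescription ssreflect.
From Coquelicot Require Import Coquelicot.
Open Scope R_scope.
Unset SsrRewrite.

(** * Inner products and limits *)

Section HilbertFacts.

Context {H : HilbertSpace}.
Implicit Types x y z : H.

Lemma ip_scal_r (a : R) x y : ip x (scal a y) = a * ip x y.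
Proof. rewrite ip_sym, ip_scal_l, (ip_sym _ y); reflexivity. Qed.

Lemma ip_plus_r x y z : ip x (plus y z) = ip x y + ip x z.
Proof. rewrite ip_sym, ip_plus_l, (ip_sym _ y), (ip_sym _ z); reflexivity. Qed.

Lemma ip_zero_l x : ip zero x = 0.
Proof.
  assert (E : (zero : H) = scal 0 x) by (symmetry; apply (scal_zero_l x)).
  rewrite E, ip_scal_l; apply Rmult_0_l.
Qed.

Lemma ip_zero_r x : ip x zero = 0.
Proof. rewrite ip_sym; apply ip_zero_l. Qed.

Lemma ip_opp_l x y : ip (opp x) y = - ip x y.
Proof.
  assert (E : opp x = scal (-1) x) by (symmetry; apply (scal_opp_one x)).
  rewrite E, ip_scal_l; ring.
Qed.

Lemma ip_opp_r x y : ip x (opp y) = - ip x y.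
Proof. rewrite ip_sym, ip_opp_l, ip_sym; reflexivity. Qed.

Lemma ip_minus_l x y z : ip (minus x y) z = ip x z - ip y z.
Proof. unfold minus; rewrite ip_plus_l, ip_opp_l; ring. Qed.

Lemma ip_minus_r x y z : ip x (minus y z) = ip x y - ip x z.
Proof. unfold minus; rewrite ip_plus_r, ip_opp_r; ring. Qed.

Lemma ip_self_nonneg x : 0 <= ip x x.
Proof. rewrite ip_norm; apply pow2_ge_0. Qed.

Lemma ip_self_eq_zero x : ip x x = 0 -> x = zero.
Proof.
  intros E; apply: norm_eq_zero; rewrite ip_norm in E.
  pose proof (norm_ge_0 x); nra.
Qed.

Lemma ip_ext x y : (forall z, ip x z = ip y z) -> x = y.
Proof.
  intros E.
  assert (E0 : minus x y = zero).
  { apply ip_self_eq_zero; rewrite ip_minus_l, E; ring. }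
  apply: (plus_reg_r (opp y)); transitivity (zero : H); [exact E0|].
  symmetry; apply: plus_opp_r.
Qed.

End HilbertFacts.

(* The canonical structures through which an operation was inferred may differ
   from those of the rewriting lemmas, so terms are matched up to conversion. *)
Ltac ip_step :=
  match goal with
  | |- context [@ip ?h (@plus ?G ?a ?b) ?c] =>
      replace (@ip h (@plus G a b) c) with (@ip h a c + @ip h b c)
        by (symmetry; exact (ip_plus_l h a b c))
  | |- context [@ip ?h ?a (@plus ?G ?b ?c)] =>
      replace (@ip h a (@plus G b c)) with (@ip h a b + @ip h a c)
        by (symmetry; exact (@ip_plus_r h a b c))
  | |- context [@ip ?h (@minus ?G ?a ?b) ?c] =>
      replace (@ip h (@minus G a b) c) with (@ip h a c - @ip h b c)
        by (symmetry; exact (@ip_minus_l h a b c))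
  | |- context [@ip ?h ?a (@minus ?G ?b ?c)] =>
      replace (@ip h a (@minus G b c)) with (@ip h a b - @ip h a c)
        by (symmetry; exact (@ip_minus_r h a b c))
  | |- context [@ip ?h (@opp ?G ?a) ?c] =>
      replace (@ip h (@opp G a) c) with (- @ip h a c)
        by (symmetry; exact (@ip_opp_l h a c))
  | |- context [@ip ?h ?a (@opp ?G ?c)] =>
      replace (@ip h a (@opp G c)) with (- @ip h a c)
        by (symmetry; exact (@ip_opp_r h a c))
  | |- context [@ip ?h (@scal ?K ?G ?r ?a) ?c] =>
      replace (@ip h (@scal K G r a) c) with (r * @ip h a c)
        by (symmetry; exact (ip_scal_l h r a c))
  | |- context [@ip ?h ?a (@scal ?K ?G ?r ?c)] =>
      replace (@ip h a (@scal K G r c)) with (r * @ip h a c)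
        by (symmetry; exact (@ip_scal_r h r a c))
  | |- context [@ip ?h (@zero ?G) ?c] =>
      replace (@ip h (@zero G) c) with 0
        by (symmetry; exact (@ip_zero_l h c))
  | |- context [@ip ?h ?a (@zero ?G)] =>
      replace (@ip h a (@zero G)) with 0
        by (symmetry; exact (@ip_zero_r h a))
  end.

Ltac ip_simpl :=
  repeat (rewrite ?ip_plus_l, ?ip_plus_r, ?ip_minus_l, ?ip_minus_r, ?ip_opp_l,
    ?ip_opp_r, ?ip_scal_l, ?ip_scal_r, ?ip_zero_l, ?ip_zero_r);
  repeat ip_step.

(* Linear identities between vectors are reduced to real ones by testing
   against an arbitrary vector. *)
Ltac vec := apply ip_ext; let z := fresh "z" in intro z; ip_simpl; try ring.

Section HilbertNorm.

Context {H : HilbertSpace}.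
Implicit Types x y z : H.

Lemma norm_zero_eq x : norm x = 0 -> x = zero.
Proof. intros E; apply: norm_eq_zero; exact E. Qed.

Lemma norm_zero_H : norm (zero : H) = 0.
Proof. apply: norm_zero. Qed.

Lemma norm_plus_le x y : norm (plus x y) <= norm x + norm y.
Proof. apply: norm_triangle. Qed.

Lemma norm_opp_H x : norm (opp x) = norm x.
Proof. apply: norm_opp. Qed.

Lemma norm_scal_eq (a : R) x : norm (scal a x) = Rabs a * norm x.
Proof.
  assert (E : norm (scal a x) ^ 2 = (Rabs a * norm x) ^ 2).
  { rewrite <- ip_norm; ip_simpl; rewrite ip_norm, Rpow_mult_distr, pow2_abs; ring. }
  pose proof (norm_ge_0 (scal a x)); pose proof (norm_ge_0 x);
    pose proof (Rabs_pos a).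
  assert (0 <= Rabs a * norm x) by nra. nra.
Qed.

Lemma cauchy_schwarz x y : Rabs (ip x y) <= norm x * norm y.
Proof.
  pose proof (norm_ge_0 x); pose proof (norm_ge_0 y).
  assert (Q : forall s, 0 <= norm x ^ 2 + 2 * s * ip x y + s ^ 2 * norm y ^ 2).
  { intro s; rewrite <- !ip_norm.
    replace (_ + _ + _) with (ip (plus x (scal s y)) (plus x (scal s y)))
      by (ip_simpl; rewrite (ip_sym _ y x); ring).
    apply ip_self_nonneg. }
  destruct (Req_dec (norm y) 0) as [Z|Z].
  - apply norm_zero_eq in Z; subst y; rewrite ip_zero_r, Rabs_R0; nra.
  - specialize (Q (- ip x y / norm y ^ 2)).
    replace (_ + _ + _) with (norm x ^ 2 - ip x y ^ 2 / norm y ^ 2) in Q by (field; auto).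
    assert (E : ip x y ^ 2 <= (norm x * norm y) ^ 2).
    { replace (ip x y ^ 2) with (ip x y ^ 2 / norm y ^ 2 * norm y ^ 2) by (field; auto).
      rewrite Rpow_mult_distr; apply Rmult_le_compat_r; [apply pow2_ge_0|lra]. }
    apply Rsqr_incr_0_var; [rewrite <- Rsqr_abs; unfold Rsqr; lra|apply Rmult_le_pos; assumption].
Qed.

Lemma ip_le_norm x y : ip x y <= norm x * norm y.
Proof. eapply Rle_trans; [apply Rle_abs|apply cauchy_schwarz]. Qed.

Lemma norm_minus_sym x y : norm (minus x y) = norm (minus y x).
Proof. transitivity (norm (opp (minus y x))); [f_equal; vec|apply norm_opp_H]. Qed.

Lemma norm_minus_le x y : norm (minus x y) <= norm x + norm y.
Proof. rewrite <- (norm_opp_H y); apply norm_plus_le. Qed.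

Lemma norm_minus_trans y x z :
  norm (minus x z) <= norm (minus x y) + norm (minus y z).
Proof.
  replace (minus x z) with (plus (minus x y) (minus y z)) by vec.
  apply norm_plus_le.
Qed.

Lemma norm_minus_diag x : norm (minus x x) = 0.
Proof. replace (minus x x) with (zero : H) by vec; apply norm_zero_H. Qed.

Lemma norm_le_minus x y : norm x <= norm (minus x y) + norm y.
Proof.
  replace x with (plus (minus x y) y) at 1 by vec. apply norm_plus_le.
Qed.

Lemma minus_zero_eq x y : norm (minus x y) <= 0 -> x = y.
Proof.
  intros E; assert (E0 : minus x y = zero).
  { apply norm_zero_eq; pose proof (norm_ge_0 (minus x y)); lra. }
  replace x with (plus (minus x y) y) by vec. rewrite E0; vec.
Qed.

Lemma eq_of_norm_small x y : (forall eps, 0 < eps -> norm (minus x y) <= eps) -> x = y.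
Proof.
  intros E; apply minus_zero_eq.
  apply Rle_plus_epsilon; intros e He; rewrite Rplus_0_l; auto.
Qed.

End HilbertNorm.

Section Limits.

Context {H : HilbertSpace}.

Lemma filterlim_norm_lt {T : Type} (F : (T -> Prop) -> Prop) {FF : Filter F}
    (f : T -> H) (l : H) :
  filterlim f F (locally l) <->
  forall eps, 0 < eps -> F (fun x => norm (minus (f x) l) < eps).
Proof.
  eapply iff_trans; [exact (filterlim_locally_ball_norm f l)|unfold ball_norm; split].
  - intros E e He; apply (E (mkposreal e He)).
  - intros E [e He]; apply (E e He).
Qed.

Lemma seq_lim_norm (u : nat -> H) (l : H) :
  filterlim u eventually (locally l) <->
  forall eps, 0 < eps -> exists n0, forall n, (n0 <= n)%nat -> norm (minus (u n) l) < eps.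
Proof. apply filterlim_norm_lt, eventually_filter. Qed.

Lemma continuous_norm (f : R -> H) (t : R) :
  continuous f t <->
  forall eps, 0 < eps -> exists del, 0 < del /\
    forall s, Rabs (s - t) < del -> norm (minus (f s) (f t)) < eps.
Proof.
  eapply iff_trans; [exact (filterlim_norm_lt (locally t) f (f t))|split].
  - intros E e He; destruct (E e He) as [[d Hd] D]; exists d; split; [exact Hd|].
    intros s Hs; apply D; exact Hs.
  - intros E e He; destruct (E e He) as [d [Hd D]]; exists (mkposreal d Hd).
    intros s Hs; apply D; exact Hs.
Qed.

Lemma is_derive_norm (f : R -> H) (t : R) (l : H) :
  (forall eps, 0 < eps -> exists del, 0 < del /\
    forall s, Rabs (s - t) < del ->
      norm (minus (minus (f s) (f t)) (scal (s - t) l)) <= eps * Rabs (s - t)) <->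
  is_derive f t l.
Proof.
  split.
  - intros E; split; [apply is_linear_scal_l|].
    intros t' Ht; assert (E0 : t = t') by exact (is_filter_lim_locally_unique (V := R_NormedModule) t t' Ht); subst t'.
    intros [e He]; destruct (E e He) as [d [Hd D]]; exists (mkposreal d Hd).
    intros s Hs; apply D; exact Hs.
  - intros [_ E] e He; destruct (E t (fun P X => X) (mkposreal e He)) as [[d Hd] D].
    exists d; split; [exact Hd|]; intros s Hs; apply D; exact Hs.
Qed.

Lemma seq_lim_unique (u : nat -> H) (l l' : H) :
  filterlim u eventually (locally l) -> filterlim u eventually (locally l') -> l = l'.
Proof. exact (filterlim_locally_unique (V := H) (F := eventually) u l l'). Qed.

Lemma seq_lim_norm_le (u : nat -> H) (l c : H) (M : R) :
  filterlim u eventually (locally l) ->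
  (exists n0, forall n, (n0 <= n)%nat -> norm (minus (u n) c) <= M) ->
  norm (minus l c) <= M.
Proof.
  intros L [n0 B]; pose proof (proj1 (seq_lim_norm u l) L) as L'; clear L; rename L' into L; apply Rle_plus_epsilon; intros e He.
  destruct (L e He) as [n1 L1].
  specialize (L1 (Nat.max n0 n1) (Nat.le_max_r _ _)).
  specialize (B (Nat.max n0 n1) (Nat.le_max_l _ _)).
  pose proof (norm_minus_trans (u (Nat.max n0 n1)) l c).
  rewrite (norm_minus_sym l (u _)) in H0; lra.
Qed.

Lemma cauchy_seq_lim (u : nat -> H) :
  (forall eps, 0 < eps -> exists n0, forall n m, (n0 <= n)%nat -> (n0 <= m)%nat ->
     norm (minus (u n) (u m)) < eps) ->
  exists l, filterlim u eventually (locally l).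
Proof.
  intros C.
  apply (proj1 (filterlim_locally_cauchy (U := CompleteNormedModule.CompleteSpace _ H) (F := eventually) u)); intros [e He].
  destruct (C e He) as [n0 N0].
  exists (fun n => (n0 <= n)%nat); split; [exists n0; auto|].
  intros n m Hn Hm; apply: (norm_compat1 (V := H)); apply N0; assumption.
Qed.

Lemma linear_seq_lim (T : H -> H) (u : nat -> H) (l : H) :
  is_linear T -> filterlim u eventually (locally l) ->
  filterlim (fun n => T (u n)) eventually (locally (T l)).
Proof.
  intros LT Lu; eapply filterlim_comp; [exact Lu|exact (linear_cont T l LT)].
Qed.

Lemma pow_small (q C eps : R) : 0 <= q < 1 -> 0 < eps ->
  exists n0, forall n, (n0 <= n)%nat -> C * q ^ n < eps.
Proof.
  intros Hq He.
  assert (L : is_lim_seq (fun n => C * q ^ n) (C * 0)).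
  { apply (is_lim_seq_scal_l _ C 0), is_lim_seq_geom; rewrite Rabs_pos_eq; lra. }
  rewrite Rmult_0_r in L; apply is_lim_seq_spec in L.
  destruct (L (mkposreal eps He)) as [n0 N0]; exists n0; intros n Hn.
  specialize (N0 n Hn); simpl in N0; apply Rabs_def2 in N0; lra.
Qed.

Lemma geometric_tail (q C : R) (u : nat -> H) : 0 <= q < 1 -> 0 <= C ->
  (forall k, norm (minus (u (S k)) (u k)) <= C * q ^ k) ->
  forall n m, norm (minus (u (n + m)%nat) (u n)) <= C / (1 - q) * q ^ n.
Proof.
  intros Hq HC D n m.
  assert (HP : forall k, 0 <= q ^ k) by (intro; apply pow_le; lra).
  assert (E : norm (minus (u (n + m)%nat) (u n)) <= C / (1 - q) * (q ^ n * (1 - q ^ m))).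
  { induction m as [|m IH].
    - rewrite Nat.add_0_r; replace (minus (u n) (u n)) with (@zero H) by vec.
      rewrite norm_zero_H; simpl; lra.
    - rewrite Nat.add_succ_r; eapply Rle_trans; [apply (norm_minus_trans (u (n + m)%nat))|].
      eapply Rle_trans; [apply Rplus_le_compat; [apply D|apply IH]|].
      rewrite pow_add; simpl; apply Req_le; field; lra. }
  eapply Rle_trans; [exact E|]; apply Rmult_le_compat_l.
  - apply Rdiv_le_0_compat; lra.
  - specialize (HP n) as Hn; specialize (HP m); nra.
Qed.

(** Common source of the limits of the Euler scheme, of the Duhamel sums, of the approximations of A
    u and of the Picard iterates. The explicit error is kept because later estimates quote it, often
    at n = 0. *)
Lemma geometric_lim (q C : R) (u : nat -> H) : 0 <= q < 1 -> 0 <= C ->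
  (forall k, norm (minus (u (S k)) (u k)) <= C * q ^ k) ->
  exists l, filterlim u eventually (locally l) /\
    forall n, norm (minus l (u n)) <= C / (1 - q) * q ^ n.
Proof.
  intros Hq HC D; pose proof (geometric_tail q C u Hq HC D) as Tl.
  destruct (cauchy_seq_lim u) as [l Hl].
  - intros e He; destruct (pow_small q (C / (1 - q)) (e / 2) Hq) as [n0 N0]; [lra|].
    exists n0; intros n m Hn Hm; specialize (N0 n0 (le_n _)).
    pose proof (Tl n0 (n - n0)%nat) as T1; pose proof (Tl n0 (m - n0)%nat) as T2.
    replace (n0 + (n - n0))%nat with n in T1 by lia.
    replace (n0 + (m - n0))%nat with m in T2 by lia.
    pose proof (norm_minus_trans (u n0) (u n) (u m)).
    rewrite (norm_minus_sym (u n0) (u m)) in H0; lra.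
  - exists l; split; [exact Hl|]; intro n.
    apply (seq_lim_norm_le u); [exact Hl|exists n; intros k Hk].
    replace k with (n + (k - n))%nat by lia; apply Tl.
Qed.

End Limits.

(** * Calculus and solvability of (a - b A) u = f *)

(** Riemann sums commute with [T], and boundedness of [T] passes to the limit. Besides operators on
    H, [T] will be the pairing with a fixed vector or [r |-> scal r f]. *)
Lemma is_RInt_linear {U V : NormedModule R_AbsRing} (T : U -> V) (f : R -> U)
    (a b : R) (I : U) :
  is_linear T -> is_RInt f a b I -> is_RInt (fun t => T (f t)) a b (T I).
Proof.
  intros LT HI; unfold is_RInt in *.
  apply (filterlim_ext (fun ptd => T (scal (sign (b - a)) (Riemann_sum f ptd)))).
  - intros ptd; rewrite (linear_scal T LT); f_equal.
    apply (SF_cons_ind (fun s => T (Riemann_sum f s) = Riemann_sum (fun t => T (f t)) s)).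
    + intros x; unfold Riemann_sum; simpl; apply: (linear_zero T LT).
    + intros h s IH; rewrite !Riemann_sum_cons, (linear_plus T LT), (linear_scal T LT), IH.
      reflexivity.
  - eapply filterlim_comp; [exact HI|exact (linear_cont T I LT)].
Qed.

Section Calculus.

Context {H : HilbertSpace}.

Lemma is_linear_ip_l (z : H) : is_linear (U := H) (V := R_NormedModule) (fun x => ip x z).
Proof.
  split.
  - intros x y; apply ip_plus_l.
  - intros a x; apply ip_scal_l.
  - exists (norm z + 1); pose proof (norm_ge_0 z); split; [lra|].
    intros x; pose proof (norm_ge_0 x); pose proof (cauchy_schwarz x z).
    unfold norm at 1; simpl; unfold abs; simpl; nra.
Qed.

Lemma continuous_H_norm_bound (f : R -> H) (t : R) :
  continuous f t -> exists del, 0 < del /\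
    forall s, Rabs (s - t) < del -> norm (f s) <= norm (f t) + 1.
Proof.
  intros Cf; destruct (proj1 (continuous_norm f t) Cf 1 Rlt_0_1) as [d [Hd D]].
  exists d; split; [exact Hd|]; intros s Hs; specialize (D s Hs).
  pose proof (norm_le_minus (f s) (f t)); lra.
Qed.

Lemma is_derive_continuous_H (f : R -> H) (t : R) (l : H) :
  is_derive f t l -> continuous f t.
Proof. intros D; apply: ex_derive_continuous; exists l; exact D. Qed.

Lemma is_derive_ip (p q : R -> H) (t : R) (p' q' : H) :
  is_derive p t p' -> is_derive q t q' ->
  is_derive (fun s => ip (p s) (q s)) t (ip p' (q t) + ip (p t) q').
Proof.
  intros Dp Dq.
  pose proof (is_derive_continuous_H q t q' Dq) as Cq.
  destruct (continuous_H_norm_bound q t Cq) as [d0 [Hd0 B0]].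
  split; [apply is_linear_scal_l|].
  intros t' Ht; assert (E0 : t = t')
    by exact (is_filter_lim_locally_unique (V := R_NormedModule) t t' Ht); subst t'.
  intros [e He].
  pose proof (norm_ge_0 (q t)); pose proof (norm_ge_0 (p t)); pose proof (norm_ge_0 p').
  set (M := norm (q t) + norm (p t) + norm p' + 1).
  assert (HM : 0 < M) by (unfold M; lra).
  assert (He' : 0 < e / (3 * M)) by (apply Rdiv_lt_0_compat; lra).
  destruct (proj2 (is_derive_norm p t p') Dp _ He') as [d1 [Hd1 D1]].
  destruct (proj2 (is_derive_norm q t q') Dq _ He') as [d2 [Hd2 D2]].
  destruct (proj1 (continuous_norm q t) Cq _ He') as [d3 [Hd3 D3]].
  assert (Hd : 0 < Rmin (Rmin d0 d1) (Rmin d2 d3)) by (repeat apply Rmin_glb_lt; assumption).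
  exists (mkposreal _ Hd); intros s Hs.
  assert (Hs' : Rabs (s - t) < Rmin (Rmin d0 d1) (Rmin d2 d3)) by exact Hs.
  pose proof (Rmin_l (Rmin d0 d1) (Rmin d2 d3)); pose proof (Rmin_r (Rmin d0 d1) (Rmin d2 d3)).
  pose proof (Rmin_l d0 d1); pose proof (Rmin_r d0 d1).
  pose proof (Rmin_l d2 d3); pose proof (Rmin_r d2 d3).
  specialize (B0 s ltac:(lra)); specialize (D1 s ltac:(lra)).
  specialize (D2 s ltac:(lra)); specialize (D3 s ltac:(lra)).
  set (e1 := minus (minus (p s) (p t)) (scal (s - t) p')) in *.
  set (e2 := minus (minus (q s) (q t)) (scal (s - t) q')) in *.
  change (Rabs (ip (p s) (q s) - ip (p t) (q t) - (s - t) * (ip p' (q t) + ip (p t) q'))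
    <= e * Rabs (s - t)).
  (* Three errors, each at most a third of the target: [M] dominates the norms of [p t], of [p']
     and, near [t], of [q s]. *)
  replace (ip (p s) (q s) - ip (p t) (q t) - (s - t) * (ip p' (q t) + ip (p t) q'))
    with (ip e1 (q s) + (s - t) * ip p' (minus (q s) (q t)) + ip (p t) e2)
    by (unfold e1, e2; ip_simpl; ring).
  assert (HA : Rabs (ip e1 (q s)) <= e / (3 * M) * Rabs (s - t) * M).
  { eapply Rle_trans; [apply cauchy_schwarz|].
    apply Rmult_le_compat; [apply norm_ge_0|apply norm_ge_0|exact D1|unfold M; lra]. }
  assert (HB : Rabs ((s - t) * ip p' (minus (q s) (q t))) <= e / (3 * M) * Rabs (s - t) * M).
  { rewrite Rabs_mult.
    replace (e / (3 * M) * Rabs (s - t) * M) with (Rabs (s - t) * (M * (e / (3 * M)))) by ring.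
    apply Rmult_le_compat_l; [apply Rabs_pos|].
    eapply Rle_trans; [apply cauchy_schwarz|].
    apply Rmult_le_compat; [apply norm_ge_0|apply norm_ge_0|unfold M; lra|lra]. }
  assert (HC : Rabs (ip (p t) e2) <= e / (3 * M) * Rabs (s - t) * M).
  { eapply Rle_trans; [apply cauchy_schwarz|].
    replace (e / (3 * M) * Rabs (s - t) * M) with (M * (e / (3 * M) * Rabs (s - t))) by ring.
    apply Rmult_le_compat; [apply norm_ge_0|apply norm_ge_0|unfold M; lra|exact D2]. }
  eapply Rle_trans; [apply Rabs_triang|].
  eapply Rle_trans; [apply Rplus_le_compat; [apply Rabs_triang|exact HC]|].
  replace (e * Rabs (s - t)) with (3 * (e / (3 * M) * Rabs (s - t) * M)) by (field; lra).
  lra.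
Qed.

End Calculus.

(** Gathers the properties of [A] on which the functional calculus below rests. As a class it lets
    [lam] be found by resolution in lemmas whose statement does not mention it. *)
Class coercive_selfadjoint {H : HilbertSpace} (A : LinearOperator H) (lam : R) : Prop := {
  coercive_sa : selfadjoint A;
  coercive_pos : 0 < lam;
  coercive_le : forall u : H, dom A u -> lam * norm u ^ 2 <= ip (opp (A u)) u
}.

Section Resolvent.

Context {H : HilbertSpace} {A : LinearOperator H} {lam : R}
  {CA : coercive_selfadjoint A lam}.

Let A_sa : selfadjoint A := coercive_sa.
Let A_coercive : forall u : H, dom A u -> lam * norm u ^ 2 <= ip (opp (A u)) u := coercive_le.

Lemma dom_minus (u v : H) : dom A u -> dom A v -> dom A (minus u v).
Proof.
  intros Du Dv; replace (minus u v) with (plus u (scal (-1) v)) by vec.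
  apply dom_plus, dom_scal; assumption.
Qed.

Lemma op_minus (u v : H) : dom A u -> dom A v -> A (minus u v) = minus (A u) (A v).
Proof.
  intros Du Dv; replace (minus u v) with (plus u (scal (-1) v)) by vec.
  rewrite op_plus, op_scal by (try apply dom_scal; assumption); vec.
Qed.

Lemma op_sym (u v : H) : dom A u -> dom A v -> ip (A u) v = ip u (A v).
Proof. intros Du Dv; exact (proj2 (proj2 A_sa v (A v)) (conj Dv eq_refl) u Du). Qed.

Lemma shifted_coercive (a b : R) (u : H) : 0 <= b -> dom A u ->
  (a + b * lam) * norm u ^ 2 <= ip (minus (scal a u) (scal b (A u))) u.
Proof.
  intros Hb Du; pose proof (A_coercive u Du) as C; revert C.
  ip_simpl; rewrite ip_norm; nra.
Qed.

(* A minimising sequence of the energy q(u) - 2 (f, u) on [dom A] converges in H,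
   and its limit solves the equation tested against [dom A]; selfadjointness then
   puts the limit in [dom A]. *)
Lemma shifted_surjective (a b : R) (f : H) : 0 < b -> 0 < a + b * lam ->
  exists u, dom A u /\ minus (scal a u) (scal b (A u)) = f.
Proof.
  intros Hb Hc; set (c := a + b * lam) in *.
  set (L := fun u : H => minus (scal a u) (scal b (A u))).
  set (J := fun u => ip (L u) u - 2 * ip f u).
  assert (LB : forall u, dom A u -> - (norm f ^ 2 / c) <= J u).
  { intros u Du; pose proof (shifted_coercive a b u (Rlt_le _ _ Hb) Du) as C.
    fold c in C; fold (L u) in C; unfold J.
    pose proof (ip_le_norm f u) as CS.
    assert (0 <= (c * norm u - norm f) ^ 2 / c) by (apply Rdiv_le_0_compat; [apply pow2_ge_0|lra]).
    replace ((c * norm u - norm f) ^ 2 / c)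
      with (c * norm u ^ 2 - 2 * (norm f * norm u) + norm f ^ 2 / c) in H0 by (field; lra).
    lra. }
  destruct (completeness (fun m => exists u, dom A u /\ m = - J u)) as [m [Um Lm]].
  { exists (norm f ^ 2 / c); intros x [u [Du ->]]; specialize (LB u Du); lra. }
  { exists (- J zero), zero; split; [apply dom_zero|reflexivity]. }
  assert (Jm : forall u, dom A u -> - m <= J u).
  { intros u Du; specialize (Um (- J u) (ex_intro _ u (conj Du eq_refl))); lra. }
  assert (Ex : forall n : nat, exists u, dom A u /\ J u <= - m + / (INR n + 1)).
  { intros n; apply NNPP; intros N.
    assert (P : 0 < / (INR n + 1)) by (apply Rinv_0_lt_compat; pose proof (pos_INR n); lra).
    assert (m <= m - / (INR n + 1)); [|lra].
    apply Lm; intros x [u [Du ->]]; apply Rnot_lt_le; intros Lt; apply N.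
    exists u; split; [exact Du|lra]. }
  (* Parallelogram identity for the quadratic part of [J]; the midpoint is admissible, so [J] is at
     least [- m] there. *)
  assert (Dis : forall n u v, dom A u -> dom A v -> J u <= - m + / (INR n + 1) ->
    J v <= - m + / (INR n + 1) -> c * norm (minus u v) ^ 2 <= 4 * / (INR n + 1)).
  { intros n u v Du Dv Ju Jv.
    pose proof (shifted_coercive a b (minus u v) (Rlt_le _ _ Hb) (dom_minus u v Du Dv)) as C.
    fold c in C; eapply Rle_trans; [exact C|].
    assert (Dw : dom A (scal (/2) (plus u v))) by (apply dom_scal, dom_plus; assumption).
    pose proof (Jm _ Dw) as Jw.
    assert (E : ip (minus (scal a (minus u v)) (scal b (A (minus u v)))) (minus u v)
      = 2 * J u + 2 * J v - 4 * J (scal (/2) (plus u v))).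
    { unfold J, L; rewrite op_minus, op_scal, op_plus by (try apply dom_plus; assumption).
      ip_simpl; field. }
    rewrite E; lra. }
  (* A near-minimiser nearly solves the Euler-Lagrange equation: [J (u + s v)] exceeds [- m] for all
     [s], which bounds the discriminant of a quadratic polynomial in [s]. *)
  assert (EL : forall n u v, dom A u -> dom A v -> J u <= - m + / (INR n + 1) ->
    (ip (L u) v - ip f v) ^ 2 <= / (INR n + 1) * ip (L v) v).
  { intros n u v Du Dv Ju.
    assert (Q : forall s, 0 <= / (INR n + 1) + 2 * s * (ip (L u) v - ip f v) + s ^ 2 * ip (L v) v).
    { intros s.
      assert (Dw : dom A (plus u (scal s v))) by (apply dom_plus, dom_scal; assumption).
      pose proof (Jm _ Dw) as Jw.
      assert (E : J (plus u (scal s v)) = J u + 2 * s * (ip (L u) v - ip f v) + s ^ 2 * ip (L v) v).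
      { unfold J, L; rewrite op_plus, op_scal by (try apply dom_scal; assumption).
        ip_simpl; rewrite (ip_sym _ v u), (op_sym v u Dv Du), (ip_sym _ v (A u)); ring. }
      lra. }
    set (k := ip (L u) v - ip f v) in *; set (q := ip (L v) v) in *; set (e := / (INR n + 1)) in *.
    assert (0 < e) by (apply Rinv_0_lt_compat; pose proof (pos_INR n); lra).
    assert (0 <= q).
    { pose proof (shifted_coercive a b v (Rlt_le _ _ Hb) Dv) as C; fold c in C; fold (L v) in C.
      unfold q; pose proof (pow2_ge_0 (norm v)); nra. }
    destruct (Req_dec q 0) as [Zq|Zq].
    - rewrite Zq in Q |- *.
      destruct (Req_dec k 0) as [Zk|Zk]; [rewrite Zk; lra|].
      specialize (Q (- e / k)); replace (_ + _ + _) with (- e) in Q by (field; auto); lra.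
    - specialize (Q (- k / q)); replace (_ + _ + _) with ((e * q - k ^ 2) / q) in Q by (field; auto).
      assert (0 < q) by lra.
      apply (Rmult_le_compat_r q) in Q; [|lra].
      unfold Rdiv in Q; rewrite Rmult_assoc, Rinv_l in Q by auto; lra. }
  assert (Small : forall eps, 0 < eps -> exists n0, forall n, (n0 <= n)%nat -> / (INR n + 1) < eps).
  { intros e He; destruct (archimed_cor1 e He) as [n0 [N0 P0]]; exists n0; intros n Hn.
    eapply Rle_lt_trans; [|exact N0]; apply Rinv_le_contravar; [apply lt_0_INR; lia|].
    apply le_INR in Hn; lra. }
  destruct (functional_choice _ Ex) as [u Hu].
  assert (Mono : forall n k, (n <= k)%nat -> J (u k) <= - m + / (INR n + 1)).
  { intros n k Hk; destruct (Hu k) as [_ Jk]; eapply Rle_trans; [exact Jk|].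
    apply Rplus_le_compat_l, Rinv_le_contravar; [pose proof (pos_INR n); lra|].
    apply le_INR in Hk; lra. }
  destruct (cauchy_seq_lim u) as [x Hx].
  { intros e He; destruct (Small (c * e ^ 2 / 4)) as [n0 N0].
    { apply Rdiv_lt_0_compat; [|lra]; apply Rmult_lt_0_compat; [lra|nra]. }
    exists n0; intros n k Hn Hk.
    pose proof (Dis n0 (u n) (u k) (proj1 (Hu n)) (proj1 (Hu k)) (Mono _ _ Hn) (Mono _ _ Hk)) as D.
    specialize (N0 n0 (le_n _)).
    assert (norm (minus (u n) (u k)) ^ 2 < e ^ 2) by (apply (Rmult_lt_reg_l c); lra).
    pose proof (norm_ge_0 (minus (u n) (u k))); nra. }
  (* The limit [x] is not yet known to lie in the domain, so [L] is moved by symmetry onto [v]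
     before the limit is taken. *)
  assert (Weak : forall v, dom A v -> ip (L v) x = ip f v).
  { intros v Dv; apply Rminus_diag_uniq; apply NNPP; intros N.
    set (d := ip (L v) x - ip f v) in *.
    assert (Pd : 0 < Rabs d) by (apply Rabs_pos_lt; exact N).
    pose proof (norm_ge_0 (L v)) as PL.
    destruct (proj1 (seq_lim_norm u x) Hx (Rabs d / (2 * (norm (L v) + 1)))) as [n1 N1].
    { apply Rdiv_lt_0_compat; lra. }
    assert (PqLv : 0 <= ip (L v) v).
    { pose proof (shifted_coercive a b v (Rlt_le _ _ Hb) Dv) as C; fold c in C; fold (L v) in C.
      pose proof (pow2_ge_0 (norm v)); nra. }
    destruct (Small ((Rabs d / 2) ^ 2 / (ip (L v) v + 1))) as [n2 N2].
    { apply Rdiv_lt_0_compat; [nra|lra]. }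
    set (n := Nat.max n1 n2).
    specialize (N1 n (Nat.le_max_l _ _)); specialize (N2 n (Nat.le_max_r _ _)).
    pose proof (EL n (u n) v (proj1 (Hu n)) Dv (Mono n n (le_n _))) as E.
    assert (Sy : ip (L (u n)) v = ip (L v) (u n)).
    { unfold L; ip_simpl; rewrite (op_sym (u n) v (proj1 (Hu n)) Dv), (ip_sym _ (u n) v),
        (ip_sym _ (u n) (A v)); ring. }
    rewrite Sy in E.
    assert (K1 : Rabs (ip (L v) (minus (u n) x)) < Rabs d / 2).
    { eapply Rle_lt_trans; [apply cauchy_schwarz|].
      apply Rle_lt_trans with ((norm (L v) + 1) * norm (minus (u n) x)).
      - apply Rmult_le_compat_r; [apply norm_ge_0|lra].
      - apply (Rmult_lt_compat_l (norm (L v) + 1)) in N1; [|lra].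
        replace ((norm (L v) + 1) * (Rabs d / (2 * (norm (L v) + 1)))) with (Rabs d / 2) in N1
          by (field; lra). exact N1. }
    assert (K2 : (ip (L v) (u n) - ip f v) ^ 2 < (Rabs d / 2) ^ 2).
    { eapply Rle_lt_trans; [exact E|].
      apply Rle_lt_trans with (/ (INR n + 1) * (ip (L v) v + 1)).
      - apply Rmult_le_compat_l; [|lra].
        left; apply Rinv_0_lt_compat; pose proof (pos_INR n); lra.
      - apply (Rmult_lt_compat_r (ip (L v) v + 1)) in N2; [|lra].
        replace ((Rabs d / 2) ^ 2 / (ip (L v) v + 1) * (ip (L v) v + 1)) with ((Rabs d / 2) ^ 2) in N2
          by (field; lra). exact N2. }
    rewrite ip_minus_r in K1.
    rewrite <- (pow2_abs (_ - _)) in K2.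
    assert (K3 : Rabs (ip (L v) (u n) - ip f v) < Rabs d / 2).
    { pose proof (Rabs_pos (ip (L v) (u n) - ip f v)); nra. }
    assert (Rabs d <= Rabs (ip (L v) (u n) - ip f v) + Rabs (ip (L v) (u n) - ip (L v) x)).
    { replace d with ((ip (L v) (u n) - ip f v) - (ip (L v) (u n) - ip (L v) x))
        by (unfold d; ring).
      unfold Rminus at 1; rewrite <- (Rabs_Ropp (ip (L v) (u n) - ip (L v) x)); apply Rabs_triang. }
    lra. }
  destruct (proj1 (proj2 A_sa x (scal (/ b) (minus (scal a x) f)))) as [Dx Ax].
  { intros v Dv; specialize (Weak v Dv); revert Weak; unfold L; ip_simpl; intros Weak.
    rewrite (ip_sym _ f v) in Weak.
    replace (ip v f) with (a * ip v x - b * ip (A v) x) by lra. field; lra. }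
  exists x; split; [exact Dx|]; rewrite Ax; vec; field; lra.
Qed.

End Resolvent.

(** * Resolvents and Euler steps *)

(** The operator (a - b A)^(-1). Two parameters let one set of lemmas cover the resolvents (b = 1),
    the inverse of -A (a = 0, b = 1) and the Euler steps (a = 1). *)
Definition shifted_inverse {H : HilbertSpace} (A : LinearOperator H) (a b : R) (f : H) : H :=
  iota (fun u => dom A u /\ minus (scal a u) (scal b (A u)) = f).

Definition inverse_opp {H : HilbertSpace} (A : LinearOperator H) : H -> H :=
  shifted_inverse A 0 1.

(* (I - h A)^(-1); equal to the identity for [h <= 0]. *)
Definition euler_step {H : HilbertSpace} (A : LinearOperator H) (h : R) (f : H) : H :=
  match Rle_dec h 0 with left _ => f | right _ => shifted_inverse A 1 h f end.

(** With a dyadic number of steps, passing from [k] to [k + 1] splits each step in two, so that only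
    one step and its two halves have to be compared. *)
Definition euler {H : HilbertSpace} (A : LinearOperator H) (k : nat) (t : R) (x : H) : H :=
  Nat.iter (2 ^ k) (euler_step A (t / 2 ^ k)) x.

(* exp (t A) for [t >= 0], and the identity for [t <= 0]. *)
Definition semigroup {H : HilbertSpace} (A : LinearOperator H) (t : R) (x : H) : H :=
  iota (fun y => filterlim (fun k => euler A k t x) eventually (locally y)).

(** Commutation is required with the bounded inverse of -A, which raises no domain question and
    still implies commutation with all the operators (a - b A)^(-1) and with their limits. *)
Definition commuting {H : HilbertSpace} (A : LinearOperator H) (C : H -> H) : Prop :=
  is_linear C /\ forall y, C (inverse_opp A y) = inverse_opp A (C y).

Section IterFacts.

Context {X : Type}.

Lemma iter_comm (P Q : X -> X) (n : nat) (x : X) :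
  (forall y, P (Q y) = Q (P y)) -> P (Nat.iter n Q x) = Nat.iter n Q (P x).
Proof. intros C; induction n as [|n IH]; simpl; [reflexivity|rewrite C, IH; reflexivity]. Qed.

Lemma iter_comp (P Q : X -> X) (n : nat) (x : X) :
  (forall y, P (Q y) = Q (P y)) ->
  Nat.iter n P (Nat.iter n Q x) = Nat.iter n (fun y => P (Q y)) x.
Proof.
  intros C; induction n as [|n IH]; simpl; [reflexivity|].
  rewrite <- IH, <- (iter_comm Q P n) by (intro; symmetry; apply C); reflexivity.
Qed.

Lemma iter_double (P : X -> X) (n : nat) (x : X) :
  Nat.iter (2 * n) P x = Nat.iter n (fun y => P (P y)) x.
Proof.
  rewrite <- (iter_comp P P n x) by reflexivity.
  replace (2 * n)%nat with (n + n)%nat by lia; apply Nat.iter_add.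
Qed.

End IterFacts.

Definition contraction {H : HilbertSpace} (P : H -> H) : Prop :=
  (forall x y, P (minus x y) = minus (P x) (P y)) /\ forall x, norm (P x) <= norm x.

Lemma contraction_iter {H : HilbertSpace} (P : H -> H) (n : nat) :
  contraction P -> contraction (Nat.iter n P).
Proof.
  intros [LP CP]; induction n as [|n [IL IC]]; split; simpl; intros.
  - reflexivity.
  - lra.
  - rewrite IL, LP; reflexivity.
  - eapply Rle_trans; [apply CP|apply IC].
Qed.

(** Telescoping: the [n] factors [P] are replaced by [Q] one at a time. By commutation all remaining
    contractions act on [P x - Q x], so each replacement costs at most its norm. *)
Lemma contraction_iter_diff {H : HilbertSpace} (P Q : H -> H) (n : nat) (x : H) :
  contraction P -> contraction Q -> (forall y, P (Q y) = Q (P y)) ->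
  norm (minus (Nat.iter n P x) (Nat.iter n Q x)) <= INR n * norm (minus (P x) (Q x)).
Proof.
  intros CP CQ C; revert x; induction n as [|n IH]; intros x.
  - simpl; replace (minus x x) with (zero : H) by vec; rewrite norm_zero_H; lra.
  - rewrite !Nat.iter_succ_r, S_INR.
    eapply Rle_trans; [apply (norm_minus_trans (Nat.iter n P (Q x)))|].
    destruct (contraction_iter P n CP) as [IL IC]; rewrite <- IL.
    specialize (IC (minus (P x) (Q x))); specialize (IH (Q x)).
    rewrite C, <- (proj1 CQ) in IH.
    pose proof (proj2 CQ (minus (P x) (Q x))); pose proof (pos_INR n); nra.
Qed.

Section Semigroup.

Context {H : HilbertSpace} {A : LinearOperator H} {lam : R}
  {CA : coercive_selfadjoint A lam}.

Let lam_pos : 0 < lam := coercive_pos.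

Local Notation G := (inverse_opp A).
Local Notation T := (shifted_inverse A).
Local Notation E := (euler_step A).
Local Notation S := (semigroup A).

Lemma shifted_injective (a b : R) (u v : H) : 0 < b -> 0 < a + b * lam ->
  dom A u -> dom A v ->
  minus (scal a u) (scal b (A u)) = minus (scal a v) (scal b (A v)) -> u = v.
Proof.
  intros Hb Hc Du Dv Eq; apply minus_zero_eq.
  pose proof (shifted_coercive a b (minus u v) (Rlt_le _ _ Hb)
    (dom_minus u v Du Dv)) as C.
  replace (minus (scal a (minus u v)) (scal b (A (minus u v)))) with (zero : H) in C.
  - rewrite ip_zero_l in C; pose proof (norm_ge_0 (minus u v)).
    assert (norm (minus u v) ^ 2 <= 0) by (apply (Rmult_le_reg_l (a + b * lam)); lra); nra.
  - rewrite op_minus by assumption; transitivity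
      (minus (minus (scal a u) (scal b (A u))) (minus (scal a v) (scal b (A v)))).
    + rewrite Eq; vec.
    + vec.
Qed.

Lemma shifted_inverse_spec (a b : R) (f : H) : 0 < b -> 0 < a + b * lam ->
  dom A (T a b f) /\ minus (scal a (T a b f)) (scal b (A (T a b f))) = f.
Proof.
  intros Hb Hc.
  refine (iota_correct (V := H) (fun u => dom A u /\ minus (scal a u) (scal b (A u)) = f) _).
  destruct (shifted_surjective a b f Hb Hc) as [u [Du Eu]].
  exists u; split; [split; assumption|].
  intros v [Dv Ev]; apply (shifted_injective a b); try assumption; congruence.
Qed.

Lemma shifted_inverse_unique (a b : R) (f u : H) : 0 < b -> 0 < a + b * lam ->
  dom A u -> minus (scal a u) (scal b (A u)) = f -> T a b f = u.
Proof.
  intros Hb Hc Du Eu; destruct (shifted_inverse_spec a b f Hb Hc) as [Dt Et].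
  apply (shifted_injective a b); try assumption; congruence.
Qed.

Lemma inverse_opp_dom (z : H) : dom A (G z).
Proof. apply shifted_inverse_spec; lra. Qed.

Lemma op_inverse_opp (z : H) : A (G z) = opp z.
Proof.
  pose proof (proj2 (shifted_inverse_spec 0 1 z ltac:(lra) ltac:(lra))) as E.
  fold (G z) in E; rewrite <- E at 2; vec.
Qed.

Lemma inverse_opp_op (u : H) : dom A u -> G (opp (A u)) = u.
Proof. intros Du; apply shifted_inverse_unique; try lra; [exact Du|vec]. Qed.

Lemma inverse_opp_injective (y z : H) : G y = G z -> y = z.
Proof.
  intros Eq; transitivity (opp (A (G y))); [rewrite op_inverse_opp; vec|].
  rewrite Eq, op_inverse_opp; vec.
Qed.

(** The equation (a - b A) u = f for u = G z, from which A has disappeared because -A G z = z. *)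
Lemma shifted_inverse_eq (a b : R) (f z : H) : 0 < b -> 0 < a + b * lam ->
  plus (scal a (G z)) (scal b z) = f -> T a b f = G z.
Proof.
  intros Hb Hc Eq; apply shifted_inverse_unique; try assumption; [apply inverse_opp_dom|].
  rewrite op_inverse_opp, <- Eq; vec.
Qed.

Lemma shifted_inverse_ex (a b : R) (f : H) : 0 < b -> 0 < a + b * lam ->
  exists z, T a b f = G z /\ plus (scal a (G z)) (scal b z) = f.
Proof.
  intros Hb Hc; destruct (shifted_inverse_spec a b f Hb Hc) as [D Eq].
  exists (opp (A (T a b f))); rewrite inverse_opp_op by exact D; split; [reflexivity|].
  rewrite <- Eq at 3; vec.
Qed.

Lemma shifted_inverse_bound (a b : R) (f : H) : 0 < b -> 0 < a + b * lam ->
  (a + b * lam) * norm (T a b f) <= norm f.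
Proof.
  intros Hb Hc; destruct (shifted_inverse_spec a b f Hb Hc) as [D Eq].
  pose proof (shifted_coercive a b _ (Rlt_le _ _ Hb) D) as C.
  rewrite Eq in C; pose proof (ip_le_norm f (T a b f)).
  pose proof (norm_ge_0 (T a b f)); pose proof (norm_ge_0 f).
  destruct (Req_dec (norm (T a b f)) 0) as [Z|Z]; [rewrite Z; lra|].
  apply (Rmult_le_reg_r (norm (T a b f))); lra.
Qed.

Lemma shifted_inverse_linear (a b : R) : 0 < b -> 0 < a + b * lam -> is_linear (T a b).
Proof.
  intros Hb Hc; split.
  - intros x y; destruct (shifted_inverse_spec a b x Hb Hc) as [Dx Ex];
      destruct (shifted_inverse_spec a b y Hb Hc) as [Dy Ey].
    apply shifted_inverse_unique; try assumption; [apply dom_plus; assumption|].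
    rewrite op_plus by assumption; rewrite <- Ex at 3; rewrite <- Ey at 3; vec.
  - intros k x; destruct (shifted_inverse_spec a b x Hb Hc) as [Dx Ex].
    apply shifted_inverse_unique; try assumption; [apply dom_scal; assumption|].
    rewrite op_scal by assumption; rewrite <- Ex at 3; vec.
  - exists (/ (a + b * lam)); split; [apply Rinv_0_lt_compat; exact Hc|].
    intros x; apply (Rmult_le_reg_l (a + b * lam)); [exact Hc|].
    rewrite <- Rmult_assoc, Rinv_r, Rmult_1_l by lra; apply shifted_inverse_bound; assumption.
Qed.

Lemma shifted_inverse_sym (a b : R) (f g : H) : 0 < b -> 0 < a + b * lam ->
  ip (T a b f) g = ip f (T a b g).
Proof.
  intros Hb Hc; destruct (shifted_inverse_spec a b f Hb Hc) as [Df Ef];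
    destruct (shifted_inverse_spec a b g Hb Hc) as [Dg Eg].
  rewrite <- Eg at 1; rewrite <- Ef at 2; ip_simpl.
  rewrite (op_sym _ _ Df Dg); ring.
Qed.

Lemma inverse_opp_linear : is_linear G.
Proof. apply shifted_inverse_linear; lra. Qed.

Lemma inverse_opp_sym (f g : H) : ip (G f) g = ip f (G g).
Proof. apply shifted_inverse_sym; lra. Qed.

Lemma inverse_opp_pos (f : H) : 0 <= ip (G f) f.
Proof.
  pose proof (coercive_le (G f) (inverse_opp_dom f)) as C.
  rewrite op_inverse_opp in C; revert C; ip_simpl; rewrite (ip_sym _ (G f)).
  pose proof (pow2_ge_0 (norm (G f))); nra.
Qed.

Lemma inverse_opp_bound (f : H) : lam * norm (G f) <= norm f.
Proof. pose proof (shifted_inverse_bound 0 1 f) as B; fold (G f) in B; lra. Qed.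

Lemma linear_minus (C : H -> H) (x y : H) :
  is_linear C -> C (minus x y) = minus (C x) (C y).
Proof.
  intros LC; replace (minus x y) with (plus x (scal (-1) y)) by vec.
  rewrite (linear_plus C LC), (linear_scal C LC); vec.
Qed.

Lemma inverse_opp_dense (x : H) (eps : R) : 0 < eps -> exists z, norm (minus (G z) x) < eps.
Proof.
  intros He; destruct (proj1 coercive_sa x eps He) as [u [Du Bu]].
  exists (opp (A u)); rewrite inverse_opp_op; assumption.
Qed.

(** The range of G G is the domain of A^2, on which the Euler scheme has an explicit rate of
    convergence; boundedness of G allows the approximation to be made twice. *)
Lemma inverse_opp2_dense (x : H) (eps : R) : 0 < eps ->
  exists z, norm (minus (G (G z)) x) < eps.
Proof.
  intros He; destruct (inverse_opp_dense x (eps / 2)) as [y By]; [lra|].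
  destruct (inverse_opp_dense y (eps / 2 * lam)) as [z Bz]; [apply Rmult_lt_0_compat; lra|].
  exists z; eapply Rle_lt_trans; [apply (norm_minus_trans (G y))|].
  rewrite <- (linear_minus G _ _ inverse_opp_linear).
  pose proof (inverse_opp_bound (minus (G z) y)).
  assert (norm (G (minus (G z) y)) < eps / 2); [|lra].
  apply (Rmult_lt_reg_l lam); lra.
Qed.

Lemma commuting_shifted_inverse_comm (C : H -> H) (a b : R) (f : H) :
  commuting A C -> 0 < b -> 0 < a + b * lam -> C (T a b f) = T a b (C f).
Proof.
  intros [LC CG] Hb Hc; destruct (shifted_inverse_ex a b f Hb Hc) as [z [Ez Ef]].
  rewrite Ez, CG; symmetry; apply shifted_inverse_eq; try assumption.
  rewrite <- Ef, (linear_plus C LC), !(linear_scal C LC), CG; reflexivity.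
Qed.

Lemma shifted_inverse_commuting (a b : R) : 0 < b -> 0 < a + b * lam -> commuting A (T a b).
Proof.
  intros Hb Hc; split; [apply shifted_inverse_linear; assumption|intros y].
  symmetry; apply (commuting_shifted_inverse_comm G); try assumption.
  split; [apply inverse_opp_linear|reflexivity].
Qed.

Lemma euler_step_linear (h : R) : is_linear (E h).
Proof.
  split.
  - intros x y; unfold euler_step; destruct (Rle_dec h 0); [reflexivity|].
    apply (linear_plus _ (shifted_inverse_linear 1 h ltac:(lra) ltac:(nra))).
  - intros k x; unfold euler_step; destruct (Rle_dec h 0); [reflexivity|].
    apply (linear_scal _ (shifted_inverse_linear 1 h ltac:(lra) ltac:(nra))).
  - exists 1; split; [lra|intros x; unfold euler_step; destruct (Rle_dec h 0); [lra|]].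
    pose proof (shifted_inverse_bound 1 h x ltac:(lra) ltac:(nra)).
    pose proof (norm_ge_0 (T 1 h x)); assert (0 < h * lam) by nra; nra.
Qed.

Lemma euler_step_contraction (h : R) : contraction (E h).
Proof.
  split; [intros; apply linear_minus, euler_step_linear|].
  intros x; unfold euler_step; destruct (Rle_dec h 0); [lra|].
  pose proof (shifted_inverse_bound 1 h x ltac:(lra) ltac:(nra)).
  pose proof (norm_ge_0 (T 1 h x)); assert (0 < h * lam) by nra; nra.
Qed.

Lemma commuting_euler_step_comm (C : H -> H) (h : R) (x : H) :
  commuting A C -> C (E h x) = E h (C x).
Proof.
  intros CC; unfold euler_step; destruct (Rle_dec h 0); [reflexivity|].
  apply commuting_shifted_inverse_comm; [exact CC|lra|nra].
Qed.

Lemma euler_step_commuting (h : R) : commuting A (E h).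
Proof.
  split; [apply euler_step_linear|intros y; unfold euler_step; destruct (Rle_dec h 0);
    [reflexivity|apply shifted_inverse_commuting; [lra|nra]]].
Qed.

(** This is E_h - 1 = h A E_h on the range of G. The case h = 0 is included, since E_0 is the
    identity by convention. *)
Lemma euler_step_inverse_opp (h : R) (y : H) : 0 <= h ->
  E h (G y) = minus (G y) (scal h (E h y)).
Proof.
  intros Hh; unfold euler_step; destruct (Rle_dec h 0) as [L|L].
  - replace h with 0 by lra; vec.
  - destruct (shifted_inverse_spec 1 h y ltac:(lra) ltac:(nra)) as [D Eq].
    rewrite (proj2 (shifted_inverse_commuting 1 h ltac:(lra) ltac:(nra))).
    transitivity (minus (G (minus (scal 1 (T 1 h y)) (scal h (A (T 1 h y))))) (scal h (T 1 h y)));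
      [|rewrite Eq; reflexivity].
    assert (LG := inverse_opp_linear).
    rewrite (linear_minus G _ _ LG), !(linear_scal G LG).
    replace (A (T 1 h y)) with (scal (-1) (opp (A (T 1 h y)))) by vec.
    rewrite (linear_scal G LG), inverse_opp_op by exact D; vec.
Qed.

Lemma euler_step_eq (h : R) (f z : H) : 0 <= h -> plus (G z) (scal h z) = f -> E h f = G z.
Proof.
  intros Hh Eq; unfold euler_step; destruct (Rle_dec h 0) as [L|L].
  - rewrite <- Eq; replace h with 0 by lra; vec.
  - apply shifted_inverse_eq; [lra|nra|rewrite <- Eq; vec].
Qed.

(** Since (1 - a A)(1 - b A) = 1 - (a + b) A + a b A^2, the difference E_a E_b - E_(a+b) equals - a
    b A^2 E_a E_b E_(a+b); the two factors G cancel A^2. *)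
Lemma euler_step_add (a b : R) (y : H) : 0 <= a -> 0 <= b ->
  norm (minus (E a (E b (G (G y)))) (E (a + b) (G (G y)))) <= a * b * norm y.
Proof.
  intros Ha Hb.
  assert (CE : forall u v x, E u (E v x) = E v (E u x))
    by (intros; apply commuting_euler_step_comm, euler_step_commuting).
  assert (CG : forall u x, E u (G x) = G (E u x)) by (intros u; apply euler_step_commuting).
  assert (SE : forall u k x, E u (scal k x) = scal k (E u x))
    by (intros u k x; apply (linear_scal _ (euler_step_linear u))).
  assert (ME : forall u x x', E u (minus x x') = minus (E u x) (E u x'))
    by (intros; apply linear_minus, euler_step_linear).
  assert (Step : forall h x, 0 <= h -> scal h (E h x) = minus (G x) (E h (G x)))
    by (intros h x Hh; rewrite euler_step_inverse_opp by exact Hh; vec).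
  set (x := G (G y)).
  assert (Eab : scal (a * b) (E a (E b y))
    = minus (minus x (E a x)) (E b (minus x (E a x)))).
  { transitivity (scal a (E a (scal b (E b y)))); [rewrite SE; vec|].
    rewrite (Step b y Hb), ME, (CE a b).
    transitivity (minus (scal a (E a (G y))) (E b (scal a (E a (G y)))));
      [rewrite SE; vec|].
    rewrite (Step a (G y) Ha); reflexivity. }
  (* The argument of [E (a + b)] is (1 - (a + b) A) E_a E_b x in disguise. *)
  assert (Ec : E (a + b) (minus (plus (E a x) (E b x)) (E a (E b x))) = E a (E b x)).
  { unfold x at 4; rewrite !CG; apply euler_step_eq; [lra|].
    rewrite <- !CG; fold x.
    transitivity (plus (E a (E b x)) (plus (E b (scal a (E a (G y)))) (E a (scal b (E b (G y)))))).
    { rewrite !SE, (CE b a); vec. }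
    rewrite (Step a (G y) Ha), (Step b (G y) Hb), !ME; fold x; rewrite (CE b a); vec. }
  assert (Eq : minus (E a (E b x)) (E (a + b) x) = scal (- (a * b)) (E (a + b) (E a (E b y)))).
  { transitivity (scal (-1) (E (a + b) (scal (a * b) (E a (E b y))))); [|rewrite SE; vec].
    rewrite Eab; transitivity (minus (E (a + b) (minus (plus (E a x) (E b x)) (E a (E b x))))
      (E (a + b) x)); [rewrite Ec; reflexivity|].
    rewrite (ME b), (CE b a), <- SE, <- (ME (a + b)); f_equal; vec. }
  rewrite Eq, norm_scal_eq, Rabs_Ropp, Rabs_pos_eq by (apply Rmult_le_pos; assumption).
  apply Rmult_le_compat_l; [apply Rmult_le_pos; assumption|].
  do 2 (eapply Rle_trans; [apply euler_step_contraction|]); apply euler_step_contraction.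
Qed.

End Semigroup.

(** * The semigroup *)

Lemma seq_lim_plus {H : HilbertSpace} (u v : nat -> H) (l m : H) :
  filterlim u eventually (locally l) -> filterlim v eventually (locally m) ->
  filterlim (fun n => plus (u n) (v n)) eventually (locally (plus l m)).
Proof. intros; eapply filterlim_comp_2; [eassumption..|exact (filterlim_plus (V := H) l m)]. Qed.

Lemma seq_lim_scal {H : HilbertSpace} (k : R) (u : nat -> H) (l : H) :
  filterlim u eventually (locally l) ->
  filterlim (fun n => scal k (u n)) eventually (locally (scal k l)).
Proof. intros; eapply filterlim_comp; [eassumption|exact (filterlim_scal_r (V := H) k l)]. Qed.

Lemma seq_lim_const {H : HilbertSpace} (l : H) :
  filterlim (fun _ : nat => l) eventually (locally l).
Proof. apply filterlim_const. Qed.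

Lemma seq_lim_norm_bound {H : HilbertSpace} (u : nat -> H) (l : H) (M : R) :
  filterlim u eventually (locally l) -> (forall n, norm (u n) <= M) -> norm l <= M.
Proof.
  intros L B; replace l with (minus l zero) by vec.
  apply (seq_lim_norm_le u); [exact L|exists 0%nat; intros n _].
  replace (minus (u n) zero) with (u n) by vec; apply B.
Qed.

Lemma seq_lim_ext {H : HilbertSpace} (u v : nat -> H) (l : H) :
  (forall n, u n = v n) ->
  filterlim u eventually (locally l) -> filterlim v eventually (locally l).
Proof. intros E; apply filterlim_ext; exact E. Qed.

Lemma seq_lim_of_norm {H : HilbertSpace} (u : nat -> H) (l : H) (b : nat -> R) :
  is_lim_seq b 0 -> (forall n, norm (minus (u n) l) <= b n) ->
  filterlim u eventually (locally l).
Proof.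
  intros Lb B; apply seq_lim_norm; intros e He; apply is_lim_seq_spec in Lb.
  destruct (Lb (mkposreal e He)) as [n0 N0]; exists n0; intros n Hn; specialize (N0 n Hn).
  simpl in N0; apply Rabs_def2 in N0; specialize (B n); lra.
Qed.

Lemma contractions_converge {H : HilbertSpace} (P : nat -> H -> H) (D : H -> H) (x : H) :
  (forall k, contraction (P k)) ->
  (forall eps, 0 < eps -> exists y, norm (minus (D y) x) < eps) ->
  (forall y, exists l, filterlim (fun k => P k (D y)) eventually (locally l)) ->
  exists l, filterlim (fun k => P k x) eventually (locally l).
Proof.
  intros CP Dn Cv; apply cauchy_seq_lim; intros e He.
  destruct (Dn (e / 4) ltac:(lra)) as [y By]; destruct (Cv y) as [l Hl].
  destruct (proj1 (seq_lim_norm _ _) Hl (e / 4) ltac:(lra)) as [n0 N0].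
  exists n0; intros n m Hn Hm.
  pose proof (N0 n Hn) as Bn; pose proof (N0 m Hm) as Bm.
  assert (C : forall k, norm (minus (P k x) (P k (D y))) < e / 4).
  { intros k; rewrite <- (proj1 (CP k)); eapply Rle_lt_trans; [apply CP|].
    rewrite norm_minus_sym; exact By. }
  pose proof (C n) as Cn; pose proof (C m) as Cm; cbv beta in *.
  pose proof (norm_minus_trans (P n (D y)) (P n x) (P m x)).
  pose proof (norm_minus_trans l (P n (D y)) (P m x)).
  pose proof (norm_minus_trans (P m (D y)) l (P m x)).
  rewrite (norm_minus_sym l (P m (D y))) in H2; rewrite (norm_minus_sym (P m x)) in Cm; lra.
Qed.

Lemma contraction_eq_dense {H : HilbertSpace} (P Q : H -> H) (D : H -> H) (x : H) :
  contraction P -> contraction Q ->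
  (forall eps, 0 < eps -> exists y, norm (minus (D y) x) < eps) ->
  (forall y, P (D y) = Q (D y)) -> P x = Q x.
Proof.
  intros CP CQ Dn Eq; apply eq_of_norm_small; intros e He.
  destruct (Dn (e / 2) ltac:(lra)) as [y By].
  eapply Rle_trans; [apply (norm_minus_trans (P (D y)))|].
  rewrite (Eq y) at 2; rewrite <- (proj1 CP), <- (proj1 CQ).
  pose proof (proj2 CP (minus x (D y))); pose proof (proj2 CQ (minus (D y) x)).
  rewrite (norm_minus_sym x) in H0; lra.
Qed.

Section Semigroup.

Context {H : HilbertSpace} {A : LinearOperator H} {lam : R}
  {CA : coercive_selfadjoint A lam}.

Let lam_pos : 0 < lam := coercive_pos.

Local Notation G := (inverse_opp A).
Local Notation E := (euler_step A).
Local Notation S := (semigroup A).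

Lemma euler_contraction (k : nat) (t : R) : contraction (euler A k t).
Proof. apply contraction_iter, euler_step_contraction. Qed.

Lemma commuting_euler_comm (C : H -> H) (k : nat) (t : R) (x : H) :
  commuting A C -> C (euler A k t x) = euler A k t (C x).
Proof. intros CC; apply iter_comm; intros y; apply commuting_euler_step_comm, CC. Qed.

Lemma euler_nonpos (k : nat) (t : R) (x : H) : t <= 0 -> euler A k t x = x.
Proof.
  intros Ht; unfold euler; induction (2 ^ k)%nat as [|n IH]; [reflexivity|simpl].
  rewrite IH; unfold euler_step; destruct (Rle_dec (t / 2 ^ k) 0) as [|N]; [reflexivity|].
  exfalso; apply N; assert (0 < / 2 ^ k) by (apply Rinv_0_lt_compat, pow_lt; lra).
  unfold Rdiv; nra.
Qed.

Lemma INR_pow2 (k : nat) : INR (2 ^ k) = 2 ^ k.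
Proof. rewrite pow_INR; reflexivity. Qed.

(** Each of the 2^k steps is split into two of length h = t / 2^(k+1), at a cost h^2 |y|; the sum of
    these costs is t^2 / 4 times 2^(-k). *)
Lemma euler_refine (k : nat) (t : R) (y : H) : 0 <= t ->
  norm (minus (euler A (1 + k) t (G (G y))) (euler A k t (G (G y))))
    <= t ^ 2 / 4 * norm y * (1 / 2) ^ k.
Proof.
  intros Ht; unfold euler.
  assert (P2 : 0 < 2 ^ k) by (apply pow_lt; lra).
  replace (2 ^ (1 + k))%nat with (2 * 2 ^ k)%nat by (simpl; lia); rewrite iter_double.
  set (h := t / 2 ^ (1 + k)).
  assert (Hh : 0 <= h) by (apply Rdiv_le_0_compat; [exact Ht|apply pow_lt; lra]).
  replace (t / 2 ^ k) with (h + h) by (unfold h; simpl; field; lra).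
  assert (CE : forall u v x, E u (E v x) = E v (E u x))
    by (intros; apply commuting_euler_step_comm, euler_step_commuting).
  eapply Rle_trans; [apply contraction_iter_diff|].
  - split; intros.
    + rewrite !(proj1 (euler_step_contraction h)); reflexivity.
    + eapply Rle_trans; apply euler_step_contraction.
  - apply euler_step_contraction.
  - intros z; rewrite !(CE h (h + h)); reflexivity.
  - rewrite INR_pow2; eapply Rle_trans;
      [apply Rmult_le_compat_l; [lra|apply euler_step_add; exact Hh]|].
    unfold h; simpl.
    apply Req_le; unfold Rdiv; rewrite Rpow_mult_distr, pow1, pow_inv; field; lra.
Qed.

(** [euler A 0 t] is one implicit step of length t. The comparison with it is the origin of the
    Taylor expansion of the semigroup at time 0. *)
Lemma euler_lim_dense (t : R) (y : H) : 0 <= t ->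
  exists l, filterlim (fun k => euler A k t (G (G y))) eventually (locally l) /\
    norm (minus l (euler A 0 t (G (G y)))) <= t ^ 2 / 2 * norm y.
Proof.
  intros Ht; pose proof (norm_ge_0 y).
  destruct (geometric_lim (1 / 2) (t ^ 2 / 4 * norm y) (fun k => euler A k t (G (G y))))
    as [l [Ll Bl]].
  - lra.
  - pose proof (pow2_ge_0 t); apply Rmult_le_pos; lra.
  - intros k; apply euler_refine, Ht.
  - exists l; split; [exact Ll|]; specialize (Bl 0%nat); simpl in Bl |- *; lra.
Qed.

Lemma semigroup_lim (t : R) (x : H) :
  filterlim (fun k => euler A k t x) eventually (locally (S t x)).
Proof.
  assert (Ex : exists l, filterlim (fun k => euler A k t x) eventually (locally l)).
  { destruct (Rle_dec t 0) as [Ht|Ht].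
    - exists x; apply (seq_lim_ext (fun _ => x)); [|apply seq_lim_const].
      intros k; rewrite euler_nonpos; auto.
    - apply (contractions_converge (fun k => euler A k t) (fun y => G (G y))).
      + intros k; apply euler_contraction.
      + intros e He; apply inverse_opp2_dense, He.
      + intros y; destruct (euler_lim_dense t y) as [l [Ll _]]; [lra|exists l; exact Ll]. }
  destruct Ex as [l Ll].
  refine (iota_correct (V := H)
    (fun y => filterlim (fun k => euler A k t x) eventually (locally y)) _).
  exists l; split; [exact Ll|intros l' Ll'; apply (seq_lim_unique _ _ _ Ll Ll')].
Qed.

Lemma semigroup_unique (t : R) (x l : H) :
  filterlim (fun k => euler A k t x) eventually (locally l) -> S t x = l.
Proof. intros L; apply (seq_lim_unique _ _ _ (semigroup_lim t x) L). Qed.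

Lemma semigroup_nonpos (t : R) (x : H) : t <= 0 -> S t x = x.
Proof.
  intros Ht; apply semigroup_unique, (seq_lim_ext (fun _ => x)); [|apply seq_lim_const].
  intros k; rewrite euler_nonpos; auto.
Qed.

Lemma semigroup_norm (t : R) (x : H) : norm (S t x) <= norm x.
Proof.
  apply (seq_lim_norm_bound _ _ _ (semigroup_lim t x)); intros k; apply euler_contraction.
Qed.

Lemma euler_linear (k : nat) (t : R) : is_linear (euler A k t).
Proof.
  unfold euler; induction (2 ^ k)%nat as [|n IH]; [apply (is_linear_id (V := H))|].
  apply (is_linear_comp (U := H) (V := H) (W := H) (Nat.iter n (E (t / 2 ^ k))));
    [exact IH|apply euler_step_linear].
Qed.

Lemma semigroup_linear (t : R) : is_linear (S t).
Proof.
  split.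
  - intros x y; apply semigroup_unique.
    apply (seq_lim_ext (fun k => plus (euler A k t x) (euler A k t y))).
    + intros k; symmetry; apply (linear_plus _ (euler_linear k t)).
    + apply seq_lim_plus; apply semigroup_lim.
  - intros c x; apply semigroup_unique.
    apply (seq_lim_ext (fun k => scal c (euler A k t x))).
    + intros k; symmetry; apply (linear_scal _ (euler_linear k t)).
    + apply seq_lim_scal, semigroup_lim.
  - exists 1; split; [lra|intros x; rewrite Rmult_1_l; apply semigroup_norm].
Qed.

Lemma semigroup_contraction (t : R) : contraction (S t).
Proof.
  split; [intros; apply (linear_minus (S t)), semigroup_linear|apply semigroup_norm].
Qed.

Lemma commuting_semigroup_comm (C : H -> H) (t : R) (x : H) :
  commuting A C -> C (S t x) = S t (C x).
Proof.
  intros CC; symmetry; apply semigroup_unique.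
  apply (seq_lim_ext (fun k => C (euler A k t x)));
    [intros k; apply commuting_euler_comm, CC|].
  apply linear_seq_lim; [apply CC|apply semigroup_lim].
Qed.

Lemma inverse_opp_commuting : commuting A G.
Proof. split; [apply inverse_opp_linear|reflexivity]. Qed.

Lemma semigroup_inverse_opp (t : R) (x : H) : S t (G x) = G (S t x).
Proof. symmetry; apply commuting_semigroup_comm, inverse_opp_commuting. Qed.

Lemma semigroup_commuting (t : R) : commuting A (S t).
Proof. split; [apply semigroup_linear|apply semigroup_inverse_opp]. Qed.

(** Euler schemes with the same number 2^k of steps are compared on the range of G G: a step of
    length t / 2^k times one of length s / 2^k differs from one of length (t + s) / 2^k by
    O(4^(-k)), and there are 2^k of them. *)
Lemma semigroup_add (t s : R) (x : H) : 0 <= t -> 0 <= s -> S t (S s x) = S (t + s) x.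
Proof.
  intros Ht Hs.
  apply (contraction_eq_dense (fun x => S t (S s x)) (S (t + s)) (fun y => G (G y))).
  - split; intros.
    + rewrite !(proj1 (semigroup_contraction _)); reflexivity.
    + eapply Rle_trans; apply semigroup_norm.
  - apply semigroup_contraction.
  - intros e He; apply inverse_opp2_dense, He.
  - clear x; intros y; symmetry; apply semigroup_unique; set (x := G (G y)).
    apply (seq_lim_of_norm _ _ (fun k => norm (minus (euler A k s x) (S s x))
      + norm (minus (euler A k t (S s x)) (S t (S s x))) + t * s * norm y * (1 / 2) ^ k)).
    + replace (Finite 0) with (Finite (0 + 0 + t * s * norm y * 0)) by (f_equal; ring).
      apply (is_lim_seq_plus' _ _ (0 + 0)); [apply (is_lim_seq_plus' _ _ 0 0)|].
      * apply is_lim_seq_spec; intros [e He]; destruct (proj1 (seq_lim_norm _ _)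
          (semigroup_lim s x) e He) as [n0 N0]; exists n0; intros n Hn; simpl.
        rewrite Rminus_0_r, Rabs_pos_eq by apply norm_ge_0; apply N0, Hn.
      * apply is_lim_seq_spec; intros [e He]; destruct (proj1 (seq_lim_norm _ _)
          (semigroup_lim t (S s x)) e He) as [n0 N0]; exists n0; intros n Hn; simpl.
        rewrite Rminus_0_r, Rabs_pos_eq by apply norm_ge_0; apply N0, Hn.
      * apply (is_lim_seq_scal_l _ _ 0), is_lim_seq_geom; rewrite Rabs_pos_eq; lra.
    + intros k.
      assert (P2 : 0 < 2 ^ k) by (apply pow_lt; lra).
      assert (CE : forall u v x, E u (E v x) = E v (E u x))
        by (intros; apply commuting_euler_step_comm, euler_step_commuting).
      assert (B : norm (minus (euler A k t (euler A k s x)) (euler A k (t + s) x))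
        <= t * s * norm y * (1 / 2) ^ k).
      { unfold euler; rewrite iter_comp by (intros; apply CE).
        eapply Rle_trans; [apply contraction_iter_diff|].
        - split; intros.
          + rewrite !(proj1 (euler_step_contraction _)); reflexivity.
          + eapply Rle_trans; apply euler_step_contraction.
        - apply euler_step_contraction.
        - intros z; rewrite !(CE _ ((t + s) / 2 ^ k)); reflexivity.
        - rewrite INR_pow2.
          replace ((t + s) / 2 ^ k) with (t / 2 ^ k + s / 2 ^ k) by (field; lra).
          eapply Rle_trans; [apply Rmult_le_compat_l; [lra|apply euler_step_add;
            apply Rdiv_le_0_compat; lra]|].
          apply Req_le; unfold Rdiv; rewrite Rpow_mult_distr, pow1, pow_inv; field; lra. }
      eapply Rle_trans; [apply (norm_minus_trans (euler A k t (euler A k s x)))|].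
      rewrite (norm_minus_sym (euler A k (t + s) x)).
      pose proof (norm_minus_trans (euler A k t (S s x)) (euler A k t (euler A k s x)) (S t (S s x))).
      rewrite <- (proj1 (euler_contraction k t)) in H0.
      pose proof (proj2 (euler_contraction k t) (minus (euler A k s x) (S s x))).
      fold x in B; lra.
Qed.

Lemma semigroup_inverse_opp_diff (h : R) (z : H) : 0 <= h ->
  norm (minus (S h (G z)) (G z)) <= h * norm z.
Proof.
  intros Hh; apply (seq_lim_norm_le _ _ _ _ (semigroup_lim h (G z))).
  exists 0%nat; intros k _; unfold euler.
  assert (P2 : 0 < 2 ^ k) by (apply pow_lt; lra).
  assert (I : forall n (x : H), Nat.iter n (fun y => y) x = x)
    by (induction n; simpl; auto).
  (* [G z] is written as an iterate of the identity, so that [contraction_iter_diff] compares the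
     Euler step with the identity. *)
  rewrite <- (I (2 ^ k)%nat (G z)) at 2.
  eapply Rle_trans; [apply contraction_iter_diff|].
  - apply euler_step_contraction.
  - split; intros; [reflexivity|lra].
  - reflexivity.
  - assert (Hk : 0 <= h / 2 ^ k) by (apply Rdiv_le_0_compat; lra).
    rewrite INR_pow2, euler_step_inverse_opp by exact Hk.
    replace (minus (minus (G z) (scal (h / 2 ^ k) (E (h / 2 ^ k) z))) (G z))
      with (scal (- (h / 2 ^ k)) (E (h / 2 ^ k) z)) by vec.
    rewrite norm_scal_eq, Rabs_Ropp, Rabs_pos_eq by exact Hk.
    pose proof (proj2 (euler_step_contraction (h / 2 ^ k)) z).
    rewrite <- Rmult_assoc; replace (2 ^ k * (h / 2 ^ k)) with h by (field; lra).
    apply Rmult_le_compat_l; assumption.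
Qed.

(** Expanding the single Euler step twice leaves the remainder h^2 E_h y; together with h^2 / 2 from
    [euler_lim_dense] this gives the constant 3 / 2. *)
Lemma semigroup_second_order (h : R) (y : H) : 0 <= h ->
  norm (plus (minus (S h (G (G y))) (G (G y))) (scal h (G y))) <= 3 / 2 * h ^ 2 * norm y.
Proof.
  intros Hh; destruct (euler_lim_dense h y Hh) as [l [Ll Bl]].
  rewrite (semigroup_unique _ _ _ Ll).
  replace (plus (minus l (G (G y))) (scal h (G y)))
    with (plus (minus l (euler A 0 h (G (G y)))) (scal (h * h) (E h y))).
  - eapply Rle_trans; [apply norm_plus_le|].
    rewrite norm_scal_eq, Rabs_pos_eq by nra.
    pose proof (proj2 (euler_step_contraction h) y); nra.
  - change (euler A 0 h (G (G y))) with (E (h / 1) (G (G y))); replace (h / 1) with h by field.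
    rewrite euler_step_inverse_opp by exact Hh.
    rewrite (euler_step_inverse_opp h y) by exact Hh; vec.
Qed.

(** The right derivative at 0 on the domain of A. The expansion is known for z = G y, and the rest z
    - G y contributes at most 2 h |z - G y| by the Lipschitz bound. *)
Lemma semigroup_first_order (z : H) (eps : R) : 0 < eps ->
  exists del, 0 < del /\ forall h, 0 <= h < del ->
    norm (plus (minus (S h (G z)) (G z)) (scal h z)) <= eps * h.
Proof.
  intros He; destruct (inverse_opp_dense z (eps / 4)) as [y By]; [lra|].
  pose proof (norm_ge_0 y).
  exists (eps / (4 * (norm y + 1))); split; [apply Rdiv_lt_0_compat; lra|].
  intros h [Hh Hd].
  assert (Hd' : 4 * h * norm y <= eps).
  { apply (Rmult_lt_compat_r (4 * (norm y + 1))) in Hd; [|lra].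
    replace (eps / (4 * (norm y + 1)) * (4 * (norm y + 1))) with eps in Hd by (field; lra).
    nra. }
  pose proof (semigroup_second_order h y Hh) as B2.
  pose proof (semigroup_inverse_opp_diff h (minus z (G y)) Hh) as B1.
  replace (plus (minus (S h (G z)) (G z)) (scal h z)) with
    (plus (plus (minus (S h (G (G y))) (G (G y))) (scal h (G y)))
      (plus (minus (S h (G (minus z (G y)))) (G (minus z (G y)))) (scal h (minus z (G y))))).
  - eapply Rle_trans; [apply norm_plus_le|].
    eapply Rle_trans; [apply Rplus_le_compat_l, norm_plus_le|].
    rewrite norm_scal_eq, (Rabs_pos_eq h) by exact Hh.
    rewrite norm_minus_sym in By.
    assert (h * norm (minus z (G y)) <= h * (eps / 4)) by (apply Rmult_le_compat_l; lra).
    nra.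
  - rewrite (linear_minus G _ _ inverse_opp_linear).
    rewrite (linear_minus (S h) _ _ (semigroup_linear h)); vec.
Qed.

Lemma semigroup_continuous_0 (x : H) (eps : R) : 0 < eps ->
  exists del, 0 < del /\ forall h, h < del -> norm (minus (S h x) x) < eps.
Proof.
  intros He; destruct (inverse_opp_dense x (eps / 4)) as [z Bz]; [lra|].
  pose proof (norm_ge_0 z).
  exists (eps / (4 * (norm z + 1))); split; [apply Rdiv_lt_0_compat; lra|].
  intros h Hd; destruct (Rle_dec h 0) as [Hh|Hh].
  { rewrite semigroup_nonpos by exact Hh; replace (minus x x) with (zero : H) by vec.
    rewrite norm_zero_H; exact He. }
  assert (Hd' : h * norm z <= eps / 4).
  { apply (Rmult_lt_compat_r (4 * (norm z + 1))) in Hd; [|lra].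
    replace (eps / (4 * (norm z + 1)) * (4 * (norm z + 1))) with eps in Hd by (field; lra).
    nra. }
  eapply Rle_lt_trans; [apply (norm_minus_trans (S h (G z)))|].
  rewrite <- (proj1 (semigroup_contraction h)).
  pose proof (proj2 (semigroup_contraction h) (minus x (G z))).
  pose proof (norm_minus_trans (G z) (S h (G z)) x).
  pose proof (semigroup_inverse_opp_diff h z ltac:(lra)).
  rewrite (norm_minus_sym x) in H1; lra.
Qed.

Lemma semigroup_continuous (x : H) (t : R) : continuous (fun s => S s x) t.
Proof.
  apply continuous_norm; intros e He.
  destruct (semigroup_continuous_0 x e He) as [d [Hd D]].
  assert (Key : forall a b, a <= b < a + d -> norm (minus (S b x) (S a x)) < e).
  { intros a b [Hab Hd']; destruct (Rle_dec a 0) as [Ha|Ha].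
    - rewrite (semigroup_nonpos a) by exact Ha; apply D; lra.
    - replace (S b x) with (S a (S (b - a) x))
        by (rewrite semigroup_add by lra; f_equal; ring).
      rewrite <- (proj1 (semigroup_contraction a)).
      eapply Rle_lt_trans; [apply semigroup_contraction|apply D; lra]. }
  exists d; split; [exact Hd|]; intros s Hs; apply Rabs_def2 in Hs.
  destruct (Rle_dec t s); [apply Key; lra|rewrite norm_minus_sym; apply Key; lra].
Qed.

Lemma semigroup_continuous_2 (f : R -> H) (g : R -> R) (t : R) :
  continuous f t -> continuous g t -> continuous (fun s => S (g s) (f s)) t.
Proof.
  intros Cf Cg; apply continuous_norm; intros e He.
  destruct (proj1 (continuous_norm f t) Cf (e / 2) ltac:(lra)) as [d1 [Hd1 D1]].
  destruct (proj1 (continuous_norm (fun s => S (g s) (f t)) t)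
    (continuous_comp g (fun s => S s (f t)) t Cg (semigroup_continuous (f t) (g t)))
    (e / 2) ltac:(lra)) as [d2 [Hd2 D2]].
  exists (Rmin d1 d2); split; [apply Rmin_glb_lt; assumption|intros s Hs].
  pose proof (Rmin_l d1 d2); pose proof (Rmin_r d1 d2).
  specialize (D1 s ltac:(lra)); specialize (D2 s ltac:(lra)).
  eapply Rle_lt_trans; [apply (norm_minus_trans (S (g s) (f t)))|].
  rewrite <- (proj1 (semigroup_contraction (g s))).
  pose proof (proj2 (semigroup_contraction (g s)) (minus (f s) (f t))); lra.
Qed.

(* The function [S s (G z) - min(s, 0) z] is a C^1 extension to the real line of
   [s |-> S s (G z)], [s >= 0]. *)
Lemma semigroup_RInt (m : R) (z : H) : 0 <= m ->
  is_RInt (fun s => S s z) 0 m (minus (G z) (G (S m z))).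
Proof.
  intros Hm; set (phi := fun s => minus (S s (G z)) (scal (Rmin s 0) z)).
  (* Forward increments are expanded uniformly in the base point [a]. Left difference quotients then
     follow by expanding from the earlier time and using continuity of [S s z]. *)
  assert (Fwd : forall e, 0 < e -> exists d, 0 < d /\ forall a b, a <= b < a + d ->
    norm (plus (minus (phi b) (phi a)) (scal (b - a) (S a z))) <= e * (b - a)).
  { intros e He; destruct (semigroup_first_order z e He) as [d [Hd D]].
    exists d; split; [exact Hd|intros a b [Hab Hbd]]; unfold phi.
    destruct (Rle_dec 0 a) as [Ha|Ha]; [|destruct (Rle_dec 0 b) as [Hb|Hb]].
    - rewrite !Rmin_right by lra.
      replace (S b (G z)) with (S a (S (b - a) (G z)))
        by (rewrite semigroup_add by lra; f_equal; ring).
      replace (plus _ _) with (S a (plus (minus (S (b - a) (G z)) (G z)) (scal (b - a) z))).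
      + eapply Rle_trans; [apply semigroup_contraction|apply D; lra].
      + rewrite (linear_plus _ (semigroup_linear a)), (linear_scal _ (semigroup_linear a)),
          (proj1 (semigroup_contraction a)); vec.
    - rewrite Rmin_right, Rmin_left by lra; rewrite !(semigroup_nonpos a) by lra.
      replace (plus _ _) with (plus (minus (S b (G z)) (G z)) (scal b z)) by vec.
      eapply Rle_trans; [apply D; lra|apply Rmult_le_compat_l; lra].
    - rewrite !Rmin_left by lra; rewrite !semigroup_nonpos by lra.
      replace (plus _ _) with (zero : H) by vec.
      rewrite norm_zero_H; apply Rmult_le_pos; lra. }
  assert (Dphi : forall t, is_derive phi t (opp (S t z))).
  { intros t; apply is_derive_norm; intros e He.
    destruct (Fwd (e / 2) ltac:(lra)) as [d1 [Hd1 D1]].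
    destruct (proj1 (continuous_norm _ t) (semigroup_continuous z t) (e / 2) ltac:(lra))
      as [d2 [Hd2 D2]].
    exists (Rmin d1 d2); split; [apply Rmin_glb_lt; assumption|intros s Hs].
    pose proof (Rmin_l d1 d2); pose proof (Rmin_r d1 d2).
    specialize (D2 s ltac:(lra)); apply Rabs_def2 in Hs.
    destruct (Rle_dec t s) as [Hts|Hts].
    - rewrite Rabs_pos_eq by lra; specialize (D1 t s ltac:(lra)).
      replace (minus _ _) with (plus (minus (phi s) (phi t)) (scal (s - t) (S t z))) by vec.
      nra.
    - rewrite Rabs_left by lra; specialize (D1 s t ltac:(lra)).
      replace (minus _ _) with (minus (scal (t - s) (minus (S s z) (S t z)))
        (plus (minus (phi t) (phi s)) (scal (t - s) (S s z)))) by vec.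
      eapply Rle_trans; [apply norm_minus_le|].
      rewrite norm_scal_eq, Rabs_pos_eq by lra.
      assert ((t - s) * norm (minus (S s z) (S t z)) <= (t - s) * (e / 2))
        by (apply Rmult_le_compat_l; lra). lra. }
  assert (Int : is_RInt (fun s => opp (S s z)) 0 m (minus (phi m) (phi 0))).
  { apply is_RInt_derive; intros s _; [apply Dphi|].
    apply (continuous_opp (V := H)), semigroup_continuous. }
  apply is_RInt_opp in Int.
  replace (minus (G z) (G (S m z))) with (opp (minus (phi m) (phi 0))).
  - eapply is_RInt_ext; [|exact Int]; intros s _; vec.
  - unfold phi; rewrite !Rmin_right, (semigroup_nonpos 0), semigroup_inverse_opp by lra; vec.
Qed.

End Semigroup.

(** * Smoothing *)

Lemma nonincreasing_sum_le (c : R) (p r : nat -> R) :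
  0 <= c -> (forall j, r (S (S j)) <= r (S j)) -> (forall j, c * r (S j) <= p j - p (S j)) ->
  forall m n, INR n * c * r (m + n)%nat <= p m - p (m + n)%nat.
Proof.
  intros Hc Dr Dp m n; induction n as [|n IH].
  - rewrite Nat.add_0_r; simpl; lra.
  - rewrite Nat.add_succ_r, S_INR; specialize (Dp (m + n)%nat).
    assert (INR n * c * r (S (m + n)) <= INR n * c * r (m + n)%nat); [|nra].
    destruct n as [|n]; [simpl; lra|].
    apply Rmult_le_compat_l; [apply Rmult_le_pos; [apply pos_INR|exact Hc]|].
    rewrite Nat.add_succ_r; apply Dr.
Qed.

Section Smoothing.

Context {H : HilbertSpace} {A : LinearOperator H} {lam : R}
  {CA : coercive_selfadjoint A lam}.

Let lam_pos : 0 < lam := coercive_pos.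

Local Notation G := (inverse_opp A).
Local Notation E := (euler_step A).

(* Discrete energy argument for the implicit Euler scheme x_j = G y_j:
   |x_j|^2 and (y_j, x_j) decrease by at least 2h (y_j+1, x_j+1) and
   2h |y_j+1|^2 at each step. *)
Lemma euler_smoothing (h : R) (n : nat) (y : H) : 0 <= h ->
  INR n * (2 * h) * norm (Nat.iter (2 * n) (E h) y) <= norm (G y).
Proof.
  intros Hh; set (Y := fun j => Nat.iter j (E h) y).
  assert (Step : forall j, G (Y j) = plus (G (Y (S j))) (scal h (Y (S j)))).
  { intros j; unfold Y; simpl; rewrite <- (proj2 (euler_step_commuting h)).
    rewrite euler_step_inverse_opp by exact Hh; vec. }
  set (q := fun j => ip (Y j) (G (Y j))).
  assert (Dx : forall j, 2 * h * q (S j) <= norm (G (Y j)) ^ 2 - norm (G (Y (S j))) ^ 2).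
  { intros j; rewrite <- !ip_norm, (Step j); unfold q; ip_simpl.
    rewrite (ip_sym _ (G (Y (S j))) (Y (S j))).
    pose proof (ip_self_nonneg (Y (S j))); assert (0 <= h * h) by nra; nra. }
  assert (Dq : forall j, 2 * h * norm (Y (S j)) ^ 2 <= q j - q (S j)).
  { intros j; set (d := minus (Y j) (Y (S j))).
    assert (Ed : G d = scal h (Y (S j)))
      by (unfold d; rewrite (linear_minus G _ _ inverse_opp_linear), (Step j); vec).
    assert (P : q j = q (S j) + 2 * ip (G d) (Y (S j)) + ip (G d) d).
    { unfold q, d; rewrite !(linear_minus G _ _ inverse_opp_linear); ip_simpl.
      rewrite (ip_sym _ (G (Y j))), (ip_sym _ (G (Y (S j))) (Y (S j))).
      rewrite (ip_sym _ (G (Y (S j))) (Y j)), (ip_sym _ (Y (S j)) (G (Y j))), inverse_opp_sym.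
      rewrite (ip_sym _ (G (Y j)) (Y j)); ring. }
    rewrite P, Ed at 1; pose proof (inverse_opp_pos d); rewrite ip_scal_l, ip_norm; lra. }
  assert (Dn : forall j, norm (Y (S j)) ^ 2 <= norm (Y j) ^ 2).
  { intros j; apply pow_incr; split; [apply norm_ge_0|apply euler_step_contraction]. }
  assert (Qd : forall j, q (S (S j)) <= q (S j)).
  { intros j; specialize (Dq (S j)); pose proof (pow2_ge_0 (norm (Y (S (S j))))); nra. }
  assert (Q0 : forall j, 0 <= q j)
    by (intros j; unfold q; rewrite ip_sym; apply inverse_opp_pos).
  (* The first [n] steps bound [q n] by |G y|^2 / (2 h n), and the next [n] bound |Y_2n|^2 by q_n /
     (2 h n); this is why 2 n steps are taken. *)
  pose proof (nonincreasing_sum_le (2 * h) (fun j => norm (G (Y j)) ^ 2) q ltac:(lra) Qd Dx 0 n) as S1.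
  pose proof (nonincreasing_sum_le (2 * h) q (fun j => norm (Y j) ^ 2) ltac:(lra)
    (fun j => Dn (S j)) Dq n n) as S2.
  cbv beta in S1, S2; replace (n + n)%nat with (2 * n)%nat in S2 by lia; simpl (0 + n)%nat in S1.
  change (Y 0%nat) with y in S1; fold (Y (2 * n)%nat).
  pose proof (pow2_ge_0 (norm (G (Y n)))); pose proof (Q0 (2 * n)%nat).
  assert (Hc : 0 <= INR n * (2 * h)) by (apply Rmult_le_pos; [apply pos_INR|lra]).
  set (c := INR n * (2 * h)) in *; set (v := norm (Y (2 * n)%nat)) in *.
  assert (c * (c * v ^ 2) <= c * q n) by (apply Rmult_le_compat_l; lra).
  apply Rsqr_incr_0_var; [unfold Rsqr; nra|apply norm_ge_0].
Qed.

(** The analytic bound t ||A S(t)|| <= 1, on the range of G. The Euler estimate is used with n = 2^k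
    and h = t / 2^(k+1), so that 2 h n = t. *)
Lemma semigroup_smoothing_range (t : R) (y : H) : 0 <= t ->
  t * norm (semigroup A t y) <= norm (G y).
Proof.
  intros Ht.
  pose proof (seq_lim_scal t _ _ (semigroup_lim (A := A) t y)) as L.
  rewrite <- (Rabs_pos_eq t) at 1 by exact Ht; rewrite <- norm_scal_eq.
  replace (scal t (semigroup A t y)) with (minus (scal t (semigroup A t y)) zero) by vec.
  apply (seq_lim_norm_le _ _ _ _ L); exists 1%nat; intros k Hk.
  replace (minus _ _) with (scal t (euler A k t y)) by vec.
  rewrite norm_scal_eq, Rabs_pos_eq by exact Ht.
  destruct k as [|k]; [lia|].
  assert (P2 : 0 < 2 ^ k) by (apply pow_lt; lra).
  pose proof (euler_smoothing (t / 2 ^ (S k)) (2 ^ k) y) as B.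
  rewrite INR_pow2 in B; unfold euler; change (2 ^ (S k))%nat with (2 * 2 ^ k)%nat.
  replace (2 ^ k * (2 * (t / 2 ^ (S k)))) with t in B by (simpl; field; lra).
  apply B, Rdiv_le_0_compat; [exact Ht|apply pow_lt; lra].
Qed.

(** If G y_n tends to x, the bound on the range makes S(t) y_n a Cauchy sequence, and its limit z
    satisfies G z = S(t) x, so z is -A S(t) x. *)
Lemma semigroup_smoothing (t : R) (x : H) : 0 < t ->
  exists z, semigroup A t x = G z /\ t * norm z <= norm x.
Proof.
  intros Ht.
  assert (Ex : forall n : nat, exists z, norm (minus (G z) x) < / (INR n + 1)).
  { intros n; apply inverse_opp_dense, Rinv_0_lt_compat; pose proof (pos_INR n); lra. }
  destruct (functional_choice _ Ex) as [y Hy].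
  assert (Lb : is_lim_seq (fun n => / (INR n + 1)) 0).
  { apply (is_lim_seq_ext (fun n => / INR (S n))); [intros n; rewrite S_INR; reflexivity|].
    apply (is_lim_seq_incr_1 (fun n => / INR n)).
    apply (is_lim_seq_inv INR p_infty); [apply is_lim_seq_INR|discriminate]. }
  assert (Ly : filterlim (fun n => G (y n)) eventually (locally x)).
  { apply (seq_lim_of_norm _ _ _ Lb); intros n; left; apply Hy. }
  assert (D : forall n m, t * norm (minus (semigroup A t (y n)) (semigroup A t (y m)))
    <= norm (minus (G (y n)) (G (y m)))).
  { intros n m; rewrite <- (proj1 (semigroup_contraction t)).
    rewrite <- (linear_minus G _ _ inverse_opp_linear).
    apply semigroup_smoothing_range; lra. }
  destruct (cauchy_seq_lim (fun n => semigroup A t (y n))) as [z Lz].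
  { intros e He.
    destruct (proj1 (seq_lim_norm _ _) Ly (t * e / 2)) as [n0 N0]; [nra|].
    exists n0; intros n m Hn Hm; pose proof (N0 n Hn); pose proof (N0 m Hm); cbv beta in *.
    pose proof (norm_minus_trans x (G (y n)) (G (y m))).
    rewrite (norm_minus_sym x) in H2; apply (Rmult_lt_reg_l t); [exact Ht|].
    specialize (D n m); lra. }
  exists z; split.
  - apply (seq_lim_unique (fun n => semigroup A t (G (y n)))).
    + apply linear_seq_lim; [apply semigroup_linear|exact Ly].
    + apply (seq_lim_ext (fun n => G (semigroup A t (y n)))).
      * intros n; symmetry; apply semigroup_inverse_opp.
      * apply linear_seq_lim; [apply inverse_opp_linear|exact Lz].
  - apply Rle_plus_epsilon; intros e He.
    destruct (proj1 (seq_lim_norm _ _) Ly (e / 2) ltac:(lra)) as [n1 N1].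
    destruct (proj1 (seq_lim_norm _ _) Lz (e / 2 / t)) as [n2 N2].
    { apply Rdiv_lt_0_compat; lra. }
    set (n := Nat.max n1 n2); specialize (N1 n (Nat.le_max_l _ _));
      specialize (N2 n (Nat.le_max_r _ _)); cbv beta in *.
    pose proof (semigroup_smoothing_range t (y n) ltac:(lra)) as B.
    pose proof (norm_le_minus z (semigroup A t (y n))) as B1.
    pose proof (norm_le_minus (G (y n)) x) as B2.
    rewrite (norm_minus_sym z) in B1.
    apply (Rmult_lt_compat_l t) in N2; [|exact Ht].
    replace (t * (e / 2 / t)) with (e / 2) in N2 by (field; lra).
    apply (Rmult_le_compat_l t) in B1; [|lra]; lra.
Qed.

Lemma semigroup_time_lipschitz (h d : R) (x : H) : 0 <= h -> 0 < d ->
  d * norm (minus (semigroup A h (semigroup A d x)) (semigroup A d x)) <= h * norm x.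
Proof.
  intros Hh Hd; destruct (semigroup_smoothing d x Hd) as [z [Ez Bz]]; rewrite Ez.
  pose proof (semigroup_inverse_opp_diff (A := A) h z Hh) as B.
  apply (Rmult_le_compat_l d) in B; [|lra].
  assert (h * (d * norm z) <= h * norm x) by (apply Rmult_le_compat_l; lra); lra.
Qed.

End Smoothing.

(** * Integrals over the half-line *)

Definition half_line_int {H : HilbertSpace} (phi : R -> H) (J : H) : Prop :=
  filterlim (fun a => RInt phi 0 a) (Rbar_locally p_infty) (locally J).

(** After the substitution t = x^2 all Balakrishnan integrands decay like this majorant. Its
    primitive is [atan_scaled], so its total mass on the half-line is [PI / 2 / sqrt mu]. *)
Definition dominated {H : HilbertSpace} (mu M : R) (phi : R -> H) : Prop :=
  (forall x, continuous phi x) /\ forall x, norm (phi x) <= M * / (x ^ 2 + mu).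

Definition atan_scaled (mu a : R) : R := atan (a / sqrt mu) / sqrt mu.

Lemma is_derive_atan_scaled (mu x : R) : 0 < mu ->
  is_derive (atan_scaled mu) x (/ (x ^ 2 + mu)).
Proof.
  intros Hmu; unfold atan_scaled.
  pose proof (sqrt_lt_R0 mu Hmu); pose proof (sqrt_sqrt mu (Rlt_le _ _ Hmu)).
  auto_derive; [lra|].
  replace (x ^ 2 + mu) with (x ^ 2 + sqrt mu * sqrt mu) by (rewrite H0; reflexivity).
  field; repeat split; try lra; pose proof (pow2_ge_0 x); nra.
Qed.

Lemma inv_sq_continuous (mu x : R) : 0 < mu -> continuous (fun x => / (x ^ 2 + mu)) x.
Proof.
  intros Hmu; apply: ex_derive_continuous; auto_derive; pose proof (pow2_ge_0 x); simpl in *; lra.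
Qed.

Lemma atan_scaled_RInt (mu a b : R) : 0 < mu ->
  is_RInt (fun x => / (x ^ 2 + mu)) a b (atan_scaled mu b - atan_scaled mu a).
Proof.
  intros Hmu; apply (is_RInt_derive (V := R_CompleteNormedModule) (atan_scaled mu)); intros x _.
  - apply is_derive_atan_scaled, Hmu.
  - apply inv_sq_continuous, Hmu.
Qed.

Lemma atan_scaled_le (mu a : R) : 0 < mu -> atan_scaled mu a <= PI / 2 / sqrt mu.
Proof.
  intros Hmu; pose proof (sqrt_lt_R0 mu Hmu); apply Rmult_le_compat_r.
  - left; apply Rinv_0_lt_compat; assumption.
  - left; apply atan_bound.
Qed.

Lemma atan_scaled_ge (mu eps : R) : 0 < mu -> 0 < eps ->
  exists a0, forall a, a0 < a -> PI / 2 / sqrt mu - eps < atan_scaled mu a.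
Proof.
  intros Hmu He; pose proof (sqrt_lt_R0 mu Hmu) as Hs.
  set (e := Rmin (eps * sqrt mu) (PI / 2)).
  assert (He' : 0 < e) by (apply Rmin_glb_lt; [nra|pose proof PI_RGT_0; lra]).
  pose proof (Rmin_l (eps * sqrt mu) (PI / 2)) as E1; fold e in E1.
  pose proof (Rmin_r (eps * sqrt mu) (PI / 2)) as E2; fold e in E2.
  exists (tan (PI / 2 - e) * sqrt mu); intros a Ha.
  assert (L : PI / 2 - e < atan (a / sqrt mu)).
  { rewrite <- (atan_tan (PI / 2 - e)) by lra; apply atan_increasing.
    apply (Rmult_lt_reg_r (sqrt mu)); [exact Hs|].
    replace (a / sqrt mu * sqrt mu) with a by (field; lra); exact Ha. }
  unfold atan_scaled; apply (Rmult_lt_reg_r (sqrt mu)); [exact Hs|].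
  replace (atan (a / sqrt mu) / sqrt mu * sqrt mu) with (atan (a / sqrt mu)) by (field; lra).
  replace ((PI / 2 / sqrt mu - eps) * sqrt mu) with (PI / 2 - eps * sqrt mu) by (field; lra).
  lra.
Qed.

Section HalfLineIntegral.

Context {H : HilbertSpace}.
Implicit Types (phi psi : R -> H) (J : H).

Lemma ex_RInt_all phi a b : (forall x, continuous phi x) -> ex_RInt phi a b.
Proof. intros C; apply (ex_RInt_continuous (V := H)); intros; apply C. Qed.

Lemma RInt_all phi a b : (forall x, continuous phi x) -> is_RInt phi a b (RInt phi a b).
Proof. intros C; apply (RInt_correct (V := H)), ex_RInt_all, C. Qed.

Lemma RInt_tail phi a b : (forall x, continuous phi x) ->
  minus (RInt phi 0 b) (RInt phi 0 a) = RInt phi a b.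
Proof.
  intros C; rewrite <- (RInt_Chasles (V := H) phi 0 a b) by (apply ex_RInt_all, C); vec.
Qed.

Lemma dominated_RInt mu M phi a b : 0 < mu -> dominated mu M phi -> a <= b ->
  norm (RInt phi a b) <= M * (atan_scaled mu b - atan_scaled mu a).
Proof.
  intros Hmu [C B] Hab.
  apply (norm_RInt_le (V := H) phi (fun x => M * / (x ^ 2 + mu)) a b); [exact Hab| | |].
  - intros x _; apply B.
  - apply RInt_all, C.
  - apply (is_RInt_scal (V := R_NormedModule)), atan_scaled_RInt, Hmu.
Qed.

Lemma half_line_int_ex mu M phi : 0 < mu -> 0 <= M -> dominated mu M phi ->
  exists J, half_line_int phi J.
Proof.
  intros Hmu HM D.
  apply (proj1 (filterlim_locally_cauchy (U := CompleteNormedModule.CompleteSpace _ H)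
    (F := Rbar_locally p_infty) (fun a => RInt phi 0 a))); intros [e He].
  destruct (atan_scaled_ge mu (e / (M + 1)) Hmu) as [a0 A0]; [apply Rdiv_lt_0_compat; lra|].
  exists (fun a => a0 < a); split; [exists a0; auto|].
  assert (Key : forall a b, a0 < a -> a <= b -> norm (RInt phi a b) < e).
  { intros a b Ha Hab; eapply Rle_lt_trans; [apply (dominated_RInt mu M); assumption|].
    pose proof (A0 a Ha); pose proof (atan_scaled_le mu b Hmu).
    assert (Hd : atan_scaled mu b - atan_scaled mu a < e / (M + 1)) by lra.
    apply (Rmult_lt_compat_l (M + 1)) in Hd; [|lra].
    replace ((M + 1) * (e / (M + 1))) with e in Hd by (field; lra).
    assert (0 <= atan_scaled mu b - atan_scaled mu a); [|nra].
    apply Rge_le, Rge_minus, Rle_ge; unfold atan_scaled.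
    pose proof (sqrt_lt_R0 mu Hmu); assert (0 < / sqrt mu) by (apply Rinv_0_lt_compat; lra).
    apply Rmult_le_compat_r; [lra|].
    destruct Hab as [Hab| ->]; [left; apply atan_increasing|lra].
    apply Rmult_lt_compat_r; lra. }
  intros a b Ha Hb; apply: (norm_compat1 (V := H)).
  change (norm (minus (RInt phi 0 b : H) (RInt phi 0 a : H)) < e).
  destruct (Rle_dec a b).
  - rewrite RInt_tail by apply D; apply Key; assumption.
  - rewrite norm_minus_sym, RInt_tail by apply D; apply Key; [assumption|lra].
Qed.

Lemma half_line_int_bound mu M phi J : 0 < mu -> 0 <= M -> dominated mu M phi ->
  half_line_int phi J -> norm J <= M * (PI / 2 / sqrt mu).
Proof.
  intros Hmu HM D L; apply Rle_plus_epsilon; intros e He.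
  destruct (proj1 (filterlim_norm_lt _ _ _) L e He) as [a0 A0].
  set (a := Rmax a0 0 + 1).
  pose proof (Rmax_l a0 0); pose proof (Rmax_r a0 0).
  specialize (A0 a ltac:(unfold a; lra)); cbv beta in A0.
  pose proof (dominated_RInt mu M phi 0 a Hmu D ltac:(unfold a; lra)) as B.
  pose proof (atan_scaled_le mu a Hmu).
  assert (Z : atan_scaled mu 0 = 0) by (unfold atan_scaled, Rdiv; rewrite Rmult_0_l, atan_0; ring).
  rewrite Z, Rminus_0_r in B.
  pose proof (norm_le_minus J (RInt phi 0 a)) as B1; rewrite norm_minus_sym in B1.
  assert (M * atan_scaled mu a <= M * (PI / 2 / sqrt mu)) by (apply Rmult_le_compat_l; assumption).
  lra.
Qed.

Lemma half_line_int_unique phi J J' : half_line_int phi J -> half_line_int phi J' -> J = J'.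
Proof.
  exact (filterlim_locally_unique (V := H) (F := Rbar_locally p_infty) _ J J').
Qed.

Lemma half_line_int_ext phi psi J : (forall x, phi x = psi x) ->
  half_line_int phi J -> half_line_int psi J.
Proof.
  intros E; apply filterlim_ext; intros a; apply (RInt_ext (V := H)); intros; apply E.
Qed.

Lemma half_line_int_eq phi J K : J = K -> half_line_int phi J -> half_line_int phi K.
Proof. intros ->; auto. Qed.

Lemma half_line_int_linear (T : H -> H) phi J : is_linear T -> (forall x, continuous phi x) ->
  half_line_int phi J -> half_line_int (fun x => T (phi x)) (T J).
Proof.
  intros LT C L.
  apply (filterlim_ext (fun a => T (RInt phi 0 a))).
  - intros a; symmetry; apply (is_RInt_unique (V := H)).
    apply (is_RInt_linear (U := H) (V := H) T); [exact LT|apply RInt_all, C].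
  - eapply filterlim_comp; [exact L|exact (linear_cont T J LT)].
Qed.

Lemma half_line_int_plus phi psi J K : (forall x, continuous phi x) ->
  (forall x, continuous psi x) -> half_line_int phi J -> half_line_int psi K ->
  half_line_int (fun x => plus (phi x) (psi x)) (plus J K).
Proof.
  intros Cf Cg LJ LK.
  apply (filterlim_ext (fun a => plus (RInt phi 0 a) (RInt psi 0 a))).
  - intros a; symmetry; apply (RInt_plus (V := H)); apply ex_RInt_all; assumption.
  - eapply filterlim_comp_2; [exact LJ|exact LK|exact (filterlim_plus (V := H) J K)].
Qed.

Lemma half_line_int_scal k phi J : (forall x, continuous phi x) ->
  half_line_int phi J -> half_line_int (fun x => scal k (phi x)) (scal k J).
Proof.
  intros Cf LJ; apply (half_line_int_linear (fun x => scal k x)); try assumption.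
  exact (is_linear_scal_r (V := H) k Rmult_comm).
Qed.

Lemma half_line_int_ip phi J (z : H) : (forall x, continuous phi x) ->
  half_line_int phi J ->
  filterlim (fun a => RInt (fun x => ip (phi x) z) 0 a) (Rbar_locally p_infty) (locally (ip J z)).
Proof.
  intros C L.
  apply (filterlim_ext (fun a => ip (RInt phi 0 a) z)).
  - intros a; symmetry; apply (is_RInt_unique (V := R_CompleteNormedModule)).
    apply (is_RInt_linear (U := H) (V := R_NormedModule) (fun x => ip x z));
      [apply is_linear_ip_l|apply RInt_all, C].
  - refine (filterlim_comp _ _ _ _ (fun v => ip v z) _ _ _ L _); exact (linear_cont (fun x => ip x z) J (is_linear_ip_l z)).
Qed.

Lemma half_line_int_inv_sq (mu : R) (f : H) : 0 < mu ->
  half_line_int (fun x => scal (/ (x ^ 2 + mu)) f) (scal (PI / 2 / sqrt mu) f).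
Proof.
  intros Hmu; unfold half_line_int.
  apply (filterlim_ext (fun a => scal (atan_scaled mu a) f)).
  - intros a; symmetry; apply (is_RInt_unique (V := H)).
    replace (atan_scaled mu a) with (atan_scaled mu a - atan_scaled mu 0)
      by (unfold atan_scaled at 2; unfold Rdiv; rewrite Rmult_0_l, atan_0; ring).
    apply (is_RInt_linear (U := R_NormedModule) (V := H) (fun r => scal r f));
      [exact (is_linear_scal_l (V := H) f)|apply atan_scaled_RInt, Hmu].
  - apply (filterlim_norm_lt _ _ _); intros e He; pose proof (norm_ge_0 f).
    destruct (atan_scaled_ge mu (e / (norm f + 1)) Hmu) as [a0 A0]; [apply Rdiv_lt_0_compat; lra|].
    exists a0; intros a Ha; specialize (A0 a Ha); pose proof (atan_scaled_le mu a Hmu).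
    replace (minus _ _) with (scal (atan_scaled mu a - PI / 2 / sqrt mu) f) by vec.
    rewrite norm_scal_eq, Rabs_minus_sym, Rabs_pos_eq by lra.
    apply Rle_lt_trans with ((PI / 2 / sqrt mu - atan_scaled mu a) * (norm f + 1)).
    + apply Rmult_le_compat_l; lra.
    + apply (Rmult_lt_reg_r (/ (norm f + 1))); [apply Rinv_0_lt_compat; lra|].
      rewrite Rmult_assoc, Rinv_r, Rmult_1_r by lra; unfold Rdiv in A0 at 3; lra.
Qed.

End HalfLineIntegral.

(** * The Balakrishnan integral *)

(* (s - A)^(-1/2), by the substitution t = x^2 in the Balakrishnan integral. *)
Definition inverse_sqrt {H : HilbertSpace} (A : LinearOperator H) (s : R) (f : H) : H :=
  scal (2 / PI) (iota (half_line_int (fun x => shifted_inverse A (x ^ 2 + s) 1 f))).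

Section Resolvent.

Context {H : HilbertSpace} {A : LinearOperator H} {lam : R}
  {CA : coercive_selfadjoint A lam}.

Let lam_pos : 0 < lam := coercive_pos.

Local Notation G := (inverse_opp A).
Local Notation Rs s := (shifted_inverse A s 1).

Lemma resolvent_bound (s : R) (f : H) : 0 < s + lam -> norm (Rs s f) <= norm f * / (s + lam).
Proof.
  intros Hs; pose proof (shifted_inverse_bound (A := A) s 1 f ltac:(lra) ltac:(lra)) as B.
  apply (Rmult_le_reg_l (s + lam)); [exact Hs|].
  replace ((s + lam) * (norm f * / (s + lam))) with (norm f) by (field; lra); lra.
Qed.

Lemma resolvent_linear (s : R) : 0 < s + lam -> is_linear (Rs s).
Proof. intros; apply shifted_inverse_linear; lra. Qed.

Lemma resolvent_commuting (s : R) : 0 < s + lam -> commuting A (Rs s).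
Proof. intros; apply shifted_inverse_commuting; lra. Qed.

Lemma commuting_resolvent_comm (C : H -> H) (s : R) (f : H) : 0 < s + lam ->
  commuting A C -> C (Rs s f) = Rs s (C f).
Proof. intros; apply commuting_shifted_inverse_comm; [assumption|lra..]. Qed.

Lemma resolvent_identity (s s' : R) (f : H) : 0 < s + lam -> 0 < s' + lam ->
  minus (Rs s f) (Rs s' f) = scal (s' - s) (Rs s (Rs s' f)).
Proof.
  intros Hs Hs'.
  destruct (shifted_inverse_spec (A := A) s' 1 f ltac:(lra) ltac:(lra)) as [D Eq].
  set (u := Rs s' f) in *.
  assert (Eu : Rs s (minus (scal s u) (scal 1 (A u))) = u)
    by (apply shifted_inverse_unique; try lra; [exact D|reflexivity]).
  replace f with (plus (minus (scal s u) (scal 1 (A u))) (scal (s' - s) u)) by (rewrite <- Eq; vec).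
  rewrite (linear_plus _ (resolvent_linear s Hs)), (linear_scal _ (resolvent_linear s Hs)), Eu; vec.
Qed.

(** A first-order expansion with exact remainder, by two uses of the resolvent identity. It serves
    to differentiate the resolvent and then, under the integral sign, [inverse_sqrt]. *)
Lemma resolvent_taylor (s s' : R) (f : H) : 0 < s + lam -> 0 < s' + lam ->
  plus (minus (Rs s' f) (Rs s f)) (scal (s' - s) (Rs s (Rs s f)))
    = scal ((s' - s) ^ 2) (Rs s (Rs s (Rs s' f))).
Proof.
  intros Hs Hs'.
  pose proof (resolvent_identity s s' f Hs Hs') as I1.
  transitivity (scal (s' - s) (minus (Rs s (Rs s f)) (Rs s (Rs s' f)))).
  - transitivity (minus (scal (s' - s) (Rs s (Rs s f))) (minus (Rs s f) (Rs s' f))); [vec|].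
    rewrite I1; vec.
  - rewrite (commuting_resolvent_comm (Rs s) s' f Hs' (resolvent_commuting s Hs)).
    rewrite resolvent_identity by assumption; vec.
Qed.

Lemma resolvent_is_derive (s : R) (f : H) : 0 < s + lam ->
  is_derive (fun s => Rs s f) s (opp (Rs s (Rs s f))).
Proof.
  intros Hs; apply is_derive_norm; intros e He; pose proof (norm_ge_0 f).
  set (K := norm f * / (s + lam) * / (s + lam) * (2 / (s + lam)) + 1).
  assert (Hi : 0 < / (s + lam)) by (apply Rinv_0_lt_compat; exact Hs).
  assert (HK : 0 < K).
  { unfold K, Rdiv; assert (0 <= norm f * / (s + lam) * / (s + lam) * (2 * / (s + lam))); [|lra].
    repeat apply Rmult_le_pos; lra. }
  exists (Rmin ((s + lam) / 2) (e / K)); split.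
  { apply Rmin_glb_lt; apply Rdiv_lt_0_compat; lra. }
  intros t Ht; pose proof (Rmin_l ((s + lam) / 2) (e / K)); pose proof (Rmin_r ((s + lam) / 2) (e / K)).
  assert (Ht1 : (s + lam) / 2 < t + lam) by (apply Rlt_le_trans with (1 := Ht), Rabs_def2 in H1; lra).
  replace (minus _ _) with (plus (minus (Rs t f) (Rs s f)) (scal (t - s) (Rs s (Rs s f)))) by vec.
  rewrite resolvent_taylor by lra.
  rewrite norm_scal_eq, <- RPow_abs.
  assert (B : norm (Rs s (Rs s (Rs t f))) <= K).
  { eapply Rle_trans; [apply resolvent_bound, Hs|].
    eapply Rle_trans; [apply Rmult_le_compat_r; [lra|apply resolvent_bound, Hs]|].
    eapply Rle_trans; [do 2 (apply Rmult_le_compat_r; [lra|]); apply resolvent_bound; lra|].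
    assert (/ (t + lam) <= 2 / (s + lam)).
    { replace (2 / (s + lam)) with (/ ((s + lam) / 2)) by (field; lra).
      apply Rinv_le_contravar; lra. }
    unfold K; assert (norm f * / (t + lam) * / (s + lam) * / (s + lam) <=
      norm f * (2 / (s + lam)) * / (s + lam) * / (s + lam)); [|lra].
    do 2 (apply Rmult_le_compat_r; [lra|]); apply Rmult_le_compat_l; lra. }
  pose proof (Rabs_pos (t - s)).
  assert (Rabs (t - s) * K <= e).
  { assert (Hd : Rabs (t - s) < e / K) by lra; apply (Rmult_lt_compat_r K) in Hd; [|exact HK].
    replace (e / K * K) with e in Hd by (field; lra); lra. }
  apply Rle_trans with (Rabs (t - s) * (Rabs (t - s) * K)); [|nra].
  replace (Rabs (t - s) ^ 2) with (Rabs (t - s) * Rabs (t - s)) by ring.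
  rewrite Rmult_assoc; do 2 (apply Rmult_le_compat_l; [lra|]); exact B.
Qed.

Lemma resolvent_continuous (s : R) (f : H) : 0 < s + lam -> continuous (fun s => Rs s f) s.
Proof. intros Hs; eapply is_derive_continuous_H, resolvent_is_derive, Hs. Qed.

Lemma resolvent_sq_is_derive (s x : R) (f : H) : 0 < s + lam ->
  is_derive (fun x => Rs (x ^ 2 + s) f) x (scal (2 * x) (opp (Rs (x ^ 2 + s) (Rs (x ^ 2 + s) f)))).
Proof.
  intros Hs; apply (is_derive_comp (V := H) (fun s => Rs s f) (fun x => x ^ 2 + s)).
  - apply resolvent_is_derive; pose proof (pow2_ge_0 x); lra.
  - auto_derive; [trivial|ring].
Qed.

Lemma resolvent_sq_continuous (s x : R) (f : H) : 0 < s + lam ->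
  continuous (fun x => Rs (x ^ 2 + s) f) x.
Proof. intros Hs; eapply is_derive_continuous_H, resolvent_sq_is_derive, Hs. Qed.

Lemma resolvent_joint_continuous (s x : R) (phi : R -> H) : 0 < s + lam ->
  continuous phi x -> continuous (fun x => Rs (x ^ 2 + s) (phi x)) x.
Proof.
  intros Hs C; apply continuous_norm; intros e He.
  destruct (proj1 (continuous_norm _ _) C (e / 2 * (s + lam))) as [d1 [Hd1 D1]]; [nra|].
  destruct (proj1 (continuous_norm _ _) (resolvent_sq_continuous s x (phi x) Hs) (e / 2) ltac:(lra))
    as [d2 [Hd2 D2]].
  exists (Rmin d1 d2); split; [apply Rmin_glb_lt; assumption|intros y Hy].
  pose proof (Rmin_l d1 d2); pose proof (Rmin_r d1 d2).
  specialize (D1 y ltac:(lra)); specialize (D2 y ltac:(lra)).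
  pose proof (pow2_ge_0 y); cbv beta in D1, D2.
  eapply Rle_lt_trans; [apply (norm_minus_trans (Rs (y ^ 2 + s) (phi x)))|].
  rewrite <- (linear_minus _ _ _ (resolvent_linear (y ^ 2 + s) ltac:(lra))).
  replace e with (e / 2 + e / 2) by lra; apply Rplus_lt_compat; [|exact D2].
  eapply Rle_lt_trans; [apply resolvent_bound; lra|].
  apply Rle_lt_trans with (norm (minus (phi y) (phi x)) * / (s + lam)).
  - apply Rmult_le_compat_l; [apply norm_ge_0|apply Rinv_le_contravar; lra].
  - apply (Rmult_lt_reg_r (s + lam)); [exact Hs|].
    rewrite Rmult_assoc, Rinv_l, Rmult_1_r by lra; exact D1.
Qed.

Lemma resolvent_sq_dominated (s : R) (f : H) : 0 < s + lam ->
  dominated (s + lam) (norm f) (fun x => Rs (x ^ 2 + s) f).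
Proof.
  intros Hs; split; [intros; apply resolvent_sq_continuous, Hs|intros x].
  rewrite <- Rplus_assoc; apply resolvent_bound; pose proof (pow2_ge_0 x); lra.
Qed.

Lemma inverse_sqrt_int (s : R) (f : H) : 0 < s + lam ->
  half_line_int (fun x => Rs (x ^ 2 + s) f) (scal (PI / 2) (inverse_sqrt A s f)).
Proof.
  intros Hs.
  destruct (half_line_int_ex _ _ _ Hs (norm_ge_0 f) (resolvent_sq_dominated s f Hs)) as [J HJ].
  assert (E : iota (half_line_int (fun x => Rs (x ^ 2 + s) f)) = J).
  { apply: (iota_unique (V := H)); [|exact HJ]; intros K HK; apply (half_line_int_unique _ _ _ HK HJ). }
  unfold inverse_sqrt; rewrite E.
  replace (scal (PI / 2) (scal (2 / PI) J)) with J; [exact HJ|].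
  vec; pose proof PI_RGT_0; field; lra.
Qed.

Lemma inverse_sqrt_eq (s : R) (f J : H) : 0 < s + lam ->
  half_line_int (fun x => Rs (x ^ 2 + s) f) (scal (PI / 2) J) -> inverse_sqrt A s f = J.
Proof.
  intros Hs HJ; pose proof (half_line_int_unique _ _ _ (inverse_sqrt_int s f Hs) HJ) as E.
  pose proof PI_RGT_0.
  transitivity (scal (2 / PI) (scal (PI / 2) (inverse_sqrt A s f))); [vec; field; lra|].
  rewrite E; vec; field; lra.
Qed.

Lemma inverse_sqrt_bound (s : R) (f : H) : 0 < s + lam ->
  norm (inverse_sqrt A s f) <= norm f / sqrt (s + lam).
Proof.
  intros Hs; pose proof PI_RGT_0.
  pose proof (half_line_int_bound _ _ _ _ Hs (norm_ge_0 f) (resolvent_sq_dominated s f Hs)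
    (inverse_sqrt_int s f Hs)) as B.
  rewrite norm_scal_eq, Rabs_pos_eq in B by lra.
  apply (Rmult_le_reg_l (PI / 2)); [lra|].
  replace (PI / 2 * (norm f / sqrt (s + lam))) with (norm f * (PI / 2 / sqrt (s + lam)))
    by (unfold Rdiv; ring); exact B.
Qed.

Lemma inverse_sqrt_linear (s : R) : 0 < s + lam -> is_linear (inverse_sqrt A s).
Proof.
  intros Hs; assert (C : forall f x, continuous (fun x => Rs (x ^ 2 + s) f) x)
    by (intros; apply resolvent_sq_continuous, Hs).
  assert (L : forall x, is_linear (Rs (x ^ 2 + s)))
    by (intros x; apply resolvent_linear; pose proof (pow2_ge_0 x); lra).
  split.
  - intros f g; apply inverse_sqrt_eq; [exact Hs|].
    apply (half_line_int_ext (fun x => plus (Rs (x ^ 2 + s) f) (Rs (x ^ 2 + s) g))).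
    + intros x; symmetry; apply (linear_plus _ (L x)).
    + eapply half_line_int_eq; [|apply half_line_int_plus; auto; apply inverse_sqrt_int, Hs]; vec.
  - intros k f; apply inverse_sqrt_eq; [exact Hs|].
    apply (half_line_int_ext (fun x => scal k (Rs (x ^ 2 + s) f))).
    + intros x; symmetry; apply (linear_scal _ (L x)).
    + eapply half_line_int_eq; [|apply half_line_int_scal; auto; apply inverse_sqrt_int, Hs]; vec.
  - exists (/ sqrt (s + lam)); split; [apply Rinv_0_lt_compat, sqrt_lt_R0, Hs|].
    intros f; rewrite Rmult_comm; apply inverse_sqrt_bound, Hs.
Qed.

Lemma commuting_inverse_sqrt_comm (C : H -> H) (s : R) (f : H) : 0 < s + lam ->
  commuting A C -> C (inverse_sqrt A s f) = inverse_sqrt A s (C f).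
Proof.
  intros Hs CC; symmetry; apply inverse_sqrt_eq; [exact Hs|].
  apply (half_line_int_ext (fun x => C (Rs (x ^ 2 + s) f))).
  - intros x; apply commuting_resolvent_comm; [pose proof (pow2_ge_0 x); lra|exact CC].
  - rewrite <- (linear_scal C (proj1 CC)).
    apply half_line_int_linear; [apply CC|intros; apply resolvent_sq_continuous, Hs|].
    apply inverse_sqrt_int, Hs.
Qed.

Lemma inverse_sqrt_sym (s : R) (f g : H) : 0 < s + lam ->
  ip (inverse_sqrt A s f) g = ip f (inverse_sqrt A s g).
Proof.
  intros Hs.
  assert (C : forall f x, continuous (fun x => Rs (x ^ 2 + s) f) x)
    by (intros; apply resolvent_sq_continuous, Hs).
  pose proof (half_line_int_ip _ _ g (C f) (inverse_sqrt_int s f Hs)) as L1.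
  pose proof (half_line_int_ip _ _ f (C g) (inverse_sqrt_int s g Hs)) as L2.
  assert (L3 : filterlim (fun a => RInt (fun x => ip (Rs (x ^ 2 + s) f) g) 0 a)
    (Rbar_locally p_infty) (locally (ip (scal (PI / 2) (inverse_sqrt A s g)) f))).
  { eapply filterlim_ext; [|exact L2]; intros a; apply RInt_ext; intros x _.
    rewrite ip_sym; symmetry; apply shifted_inverse_sym; pose proof (pow2_ge_0 x); lra. }
  pose proof (filterlim_locally_unique (V := R_NormedModule) (F := Rbar_locally p_infty)
    _ _ _ L1 L3) as E.
  revert E; ip_simpl; rewrite (ip_sym _ _ f); intros E; pose proof PI_RGT_0.
  apply (Rmult_eq_reg_l (PI / 2)); [exact E|lra].
Qed.

(** With R = R_(x^2+s), the derivative of x R f is R f - 2 x^2 R R f. Applying R_s and using x^2 R_s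
    R = R_s - R turns it into 2 R R f - R_s R f, whose integral is the boundary term, vanishing at
    infinity. *)
Lemma inverse_sqrt_int_sq (s : R) (f : H) : 0 < s + lam ->
  half_line_int (fun x => Rs (x ^ 2 + s) (Rs (x ^ 2 + s) f))
    (scal (PI / 2) (scal (1 / 2) (Rs s (inverse_sqrt A s f)))).
Proof.
  intros Hs.
  assert (Hx : forall x, 0 < x ^ 2 + s + lam) by (intros x; pose proof (pow2_ge_0 x); lra).
  assert (C1 : forall f x, continuous (fun x => Rs (x ^ 2 + s) f) x)
    by (intros; apply resolvent_sq_continuous, Hs).
  assert (C2 : forall f x, continuous (fun x => Rs (x ^ 2 + s) (Rs (x ^ 2 + s) f)) x)
    by (intros; apply resolvent_joint_continuous; auto).
  assert (CR : forall x, continuous (fun x => Rs s (Rs (x ^ 2 + s) f)) x).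
  { intros x; apply (continuous_comp (fun x => Rs (x ^ 2 + s) f) (Rs s)); [apply C1|].
    exact (linear_cont (Rs s) _ (resolvent_linear s Hs)). }
  assert (P : forall a, is_RInt (fun x => plus (scal 2 (Rs (x ^ 2 + s) (Rs (x ^ 2 + s) f)))
      (scal (-1) (Rs s (Rs (x ^ 2 + s) f)))) 0 a (Rs s (scal a (Rs (a ^ 2 + s) f)))).
  { intros a.
    assert (I : is_RInt (fun x => plus (scal 1 (Rs (x ^ 2 + s) f))
      (scal x (scal (2 * x) (opp (Rs (x ^ 2 + s) (Rs (x ^ 2 + s) f)))))) 0 a
      (minus (scal a (Rs (a ^ 2 + s) f)) (scal 0 (Rs (0 ^ 2 + s) f)))).
    { apply (is_RInt_scal_derive (V := H) (fun x => x) (fun x => Rs (x ^ 2 + s) f) (fun _ => 1)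
        (fun x => scal (2 * x) (opp (Rs (x ^ 2 + s) (Rs (x ^ 2 + s) f))))).
      - intros x _; apply: is_derive_id.
      - intros x _; apply resolvent_sq_is_derive, Hs.
      - intros x _; apply continuous_const.
      - intros x _; apply (continuous_scal (V := H)).
        + apply: ex_derive_continuous; auto_derive; trivial.
        + apply (continuous_opp (V := H)), C2. }
    apply (is_RInt_linear (U := H) (V := H) (Rs s) _ _ _ _ (resolvent_linear s Hs)) in I.
    replace (minus (scal a (Rs (a ^ 2 + s) f)) (scal 0 (Rs (0 ^ 2 + s) f)))
      with (scal a (Rs (a ^ 2 + s) f)) in I by vec.
    eapply is_RInt_ext; [|exact I]; intros x _.
    assert (LR := resolvent_linear s Hs).
    pose proof (resolvent_identity s (x ^ 2 + s) (Rs (x ^ 2 + s) f) Hs (Hx x)) as RI.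
    symmetry; transitivity (minus (Rs s (Rs (x ^ 2 + s) f)) (scal 2
      (scal (x ^ 2 + s - s) (Rs s (Rs (x ^ 2 + s) (Rs (x ^ 2 + s) f)))))); [rewrite <- RI; vec|].
    transitivity (Rs s (minus (Rs (x ^ 2 + s) f)
      (scal (2 * x ^ 2) (Rs (x ^ 2 + s) (Rs (x ^ 2 + s) f))))); [|f_equal; vec].
    rewrite (linear_minus _ _ _ LR), (linear_scal _ LR); vec. }
  assert (Z : half_line_int (fun x => plus (scal 2 (Rs (x ^ 2 + s) (Rs (x ^ 2 + s) f)))
      (scal (-1) (Rs s (Rs (x ^ 2 + s) f)))) zero).
  { unfold half_line_int; apply (filterlim_ext (fun a => Rs s (scal a (Rs (a ^ 2 + s) f)))).
    { intros a; symmetry; apply (is_RInt_unique (V := H)), P. }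
    apply (filterlim_norm_lt _ _ _); intros e He; pose proof (norm_ge_0 f).
    set (K := norm f * / (s + lam) + 1).
    assert (Hi : 0 < / (s + lam)) by (apply Rinv_0_lt_compat; exact Hs).
    assert (HK : 0 < K) by (unfold K; nra).
    exists (K / e); intros a Ha.
    assert (Pa : 0 < a) by (assert (0 < K / e) by (apply Rdiv_lt_0_compat; lra); lra).
    apply (Rle_lt_trans _ (norm (Rs s (scal a (Rs (a ^ 2 + s) f))))); [apply Req_le; f_equal; vec|].
    eapply Rle_lt_trans; [apply resolvent_bound, Hs|].
    rewrite norm_scal_eq, Rabs_pos_eq by lra.
    pose proof (resolvent_bound (a ^ 2 + s) f (Hx a)) as B.
    assert (B2 : / (a ^ 2 + s + lam) <= / (a * a)) by (apply Rinv_le_contravar; nra).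
    assert (B3 : a * norm (Rs (a ^ 2 + s) f) <= norm f * / a).
    { apply Rle_trans with (a * (norm f * / (a * a))).
      - apply Rmult_le_compat_l; [lra|]; eapply Rle_trans; [exact B|].
        apply Rmult_le_compat_l; assumption.
      - apply Req_le; field; lra. }
    apply Rle_lt_trans with (norm f * / a * / (s + lam)); [apply Rmult_le_compat_r; lra|].
    apply (Rmult_lt_reg_l a); [exact Pa|].
    replace (a * (norm f * / a * / (s + lam))) with (norm f * / (s + lam)) by (field; lra).
    apply (Rmult_lt_compat_r e) in Ha; [|exact He].
    replace (K / e * e) with K in Ha by (field; lra); unfold K in Ha; lra. }
  pose proof (inverse_sqrt_int s f Hs) as J1.
  apply (half_line_int_linear (Rs s) _ _ (resolvent_linear s Hs) (C1 f)) in J1.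
  rewrite (linear_scal _ (resolvent_linear s Hs)) in J1.
  assert (C3 : forall x, continuous (fun x => plus (scal 2 (Rs (x ^ 2 + s) (Rs (x ^ 2 + s) f)))
      (scal (-1) (Rs s (Rs (x ^ 2 + s) f)))) x).
  { intros x; apply (continuous_plus (V := H)); apply (continuous_scal_r (V := H)); auto. }
  pose proof (half_line_int_plus _ _ _ _ C3 CR Z J1) as J2.
  apply (half_line_int_scal (1 / 2)) in J2; [|intros x; apply (continuous_plus (V := H)); auto].
  eapply half_line_int_eq; [|eapply half_line_int_ext; [|exact J2]; intros x; vec; field]; vec.
Qed.

(** Differentiation under the integral: [resolvent_taylor] provides a dominated remainder of order
    (t - s)^2, and the derivative - R R f is integrated by [inverse_sqrt_int_sq]. *)
Lemma inverse_sqrt_is_derive (s : R) (f : H) : 0 < s + lam ->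
  is_derive (fun s => inverse_sqrt A s f) s (scal (- (1 / 2)) (Rs s (inverse_sqrt A s f))).
Proof.
  intros Hs; apply is_derive_norm; intros e He; pose proof (norm_ge_0 f) as Hf.
  set (mu := s + lam) in *; pose proof (sqrt_lt_R0 mu Hs) as Hq.
  assert (Hi : 0 < / mu) by (apply Rinv_0_lt_compat; exact Hs).
  set (K := norm f * (2 / mu) * / mu).
  assert (HK : 0 <= K) by (unfold K, Rdiv; repeat apply Rmult_le_pos; lra).
  assert (HKq : 0 < K / sqrt mu + 1) by (pose proof (Rdiv_le_0_compat K _ HK Hq); lra).
  exists (Rmin (mu / 2) (e / (K / sqrt mu + 1))); split.
  { apply Rmin_glb_lt; apply Rdiv_lt_0_compat; lra. }
  intros t Ht; pose proof (Rmin_l (mu / 2) (e / (K / sqrt mu + 1)));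
    pose proof (Rmin_r (mu / 2) (e / (K / sqrt mu + 1))).
  assert (Ht1 : mu / 2 < t + lam)
    by (assert (Ht' : Rabs (t - s) < mu / 2) by lra; apply Rabs_def2 in Ht'; unfold mu in *; lra).
  assert (Ht0 : 0 < t + lam) by lra.
  assert (C1 : forall t x, 0 < t + lam -> continuous (fun x => Rs (x ^ 2 + t) f) x)
    by (intros; apply resolvent_sq_continuous; assumption).
  assert (C2 : forall x, continuous (fun x => Rs (x ^ 2 + s) (Rs (x ^ 2 + s) f)) x)
    by (intros; apply resolvent_joint_continuous; auto).
  assert (I : half_line_int (fun x => plus (plus (Rs (x ^ 2 + t) f) (scal (-1) (Rs (x ^ 2 + s) f)))
      (scal (t - s) (Rs (x ^ 2 + s) (Rs (x ^ 2 + s) f))))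
    (scal (PI / 2) (minus (minus (inverse_sqrt A t f) (inverse_sqrt A s f))
      (scal (t - s) (scal (- (1 / 2)) (Rs s (inverse_sqrt A s f))))))).
  { apply (half_line_int_eq _ (plus (plus (scal (PI / 2) (inverse_sqrt A t f))
      (scal (-1) (scal (PI / 2) (inverse_sqrt A s f))))
      (scal (t - s) (scal (PI / 2) (scal (1 / 2) (Rs s (inverse_sqrt A s f))))))); [vec|].
    apply half_line_int_plus; [| | apply half_line_int_plus |].
    - intros x; apply (continuous_plus (V := H)); [auto|apply (continuous_scal_r (V := H)); auto].
    - intros x; apply (continuous_scal_r (V := H)); auto.
    - auto.
    - intros x; apply (continuous_scal_r (V := H)); auto.
    - apply inverse_sqrt_int, Ht0.
    - apply half_line_int_scal; [auto|apply inverse_sqrt_int, Hs].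
    - apply half_line_int_scal; [auto|apply inverse_sqrt_int_sq, Hs]. }
  assert (D : dominated mu ((t - s) ^ 2 * K)
    (fun x => plus (plus (Rs (x ^ 2 + t) f) (scal (-1) (Rs (x ^ 2 + s) f)))
      (scal (t - s) (Rs (x ^ 2 + s) (Rs (x ^ 2 + s) f))))).
  { split.
    - intros x; apply (continuous_plus (V := H)); [apply (continuous_plus (V := H))|];
        try apply (continuous_scal_r (V := H)); auto.
    - intros x; pose proof (pow2_ge_0 x).
      replace (plus _ _) with (plus (minus (Rs (x ^ 2 + t) f) (Rs (x ^ 2 + s) f))
        (scal (x ^ 2 + t - (x ^ 2 + s)) (Rs (x ^ 2 + s) (Rs (x ^ 2 + s) f)))) by vec.
      rewrite resolvent_taylor by (unfold mu in *; lra).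
      rewrite norm_scal_eq, Rabs_pos_eq by apply pow2_ge_0.
      replace (x ^ 2 + t - (x ^ 2 + s)) with (t - s) by ring; rewrite Rmult_assoc.
      apply Rmult_le_compat_l; [apply pow2_ge_0|].
      eapply Rle_trans; [apply resolvent_bound; unfold mu in *; lra|].
      replace (x ^ 2 + s + lam) with (x ^ 2 + mu) by (unfold mu; ring).
      apply Rmult_le_compat_r; [left; apply Rinv_0_lt_compat; lra|].
      eapply Rle_trans; [apply resolvent_bound; unfold mu in *; lra|].
      unfold K; apply Rmult_le_compat; [apply norm_ge_0| | |].
      + left; apply Rinv_0_lt_compat; unfold mu in *; lra.
      + eapply Rle_trans; [apply resolvent_bound; lra|].
        apply Rmult_le_compat_l; [exact Hf|].
        replace (2 / mu) with (/ (mu / 2)) by (field; lra); apply Rinv_le_contravar; lra.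
      + apply Rinv_le_contravar; unfold mu in *; lra. }
  assert (HM : 0 <= (t - s) ^ 2 * K) by (apply Rmult_le_pos; [apply pow2_ge_0|exact HK]).
  pose proof (half_line_int_bound _ _ _ _ Hs HM D I) as B; pose proof PI_RGT_0.
  rewrite norm_scal_eq, Rabs_pos_eq in B by lra.
  apply (Rmult_le_reg_l (PI / 2)); [lra|]; eapply Rle_trans; [exact B|].
  replace ((t - s) ^ 2 * K * (PI / 2 / sqrt mu)) with (PI / 2 * ((t - s) ^ 2 * (K / sqrt mu)))
    by (field; lra).
  apply Rmult_le_compat_l; [lra|].
  rewrite <- pow2_abs; pose proof (Rabs_pos (t - s)).
  assert (Rabs (t - s) * (K / sqrt mu + 1) <= e).
  { assert (Hd : Rabs (t - s) < e / (K / sqrt mu + 1)) by lra.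
    apply (Rmult_lt_compat_r (K / sqrt mu + 1)) in Hd; [|exact HKq].
    replace (e / (K / sqrt mu + 1) * (K / sqrt mu + 1)) with e in Hd by (field; lra); lra. }
  nra.
Qed.

End Resolvent.

(** * The square root *)

Section SquareRoot.

Context {H : HilbertSpace} {A : LinearOperator H} {lam : R}
  {CA : coercive_selfadjoint A lam}.

Let lam_pos : 0 < lam := coercive_pos.

Local Notation G := (inverse_opp A).
Local Notation Rs s := (shifted_inverse A s 1).
Local Notation Bs := (inverse_sqrt A).

(** On the range of G one has R_t G g = (G g - R_t g) / t. The first part integrates exactly to G g
    / sqrt s, and the second is smaller by a factor of order 1 / s. *)
Lemma inverse_sqrt_asymp (s : R) (g : H) : 0 < s ->
  norm (minus (Bs s (G g)) (scal (/ sqrt s) (G g))) <= norm g / s / sqrt s.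
Proof.
  intros Hs; assert (Hs' : 0 < s + lam) by lra; pose proof PI_RGT_0; pose proof (norm_ge_0 g).
  pose proof (sqrt_lt_R0 s Hs).
  assert (Cr : forall x, continuous (fun x => Rs (x ^ 2 + s) (G g)) x)
    by (intros; apply resolvent_sq_continuous, Hs').
  assert (Ci : forall x, continuous (fun x => scal (/ (x ^ 2 + s)) (G g)) x)
    by (intros; apply (continuous_scal_l (V := H)), inv_sq_continuous, Hs).
  assert (I : half_line_int (fun x => plus (Rs (x ^ 2 + s) (G g)) (scal (-1) (scal (/ (x ^ 2 + s)) (G g))))
    (scal (PI / 2) (minus (Bs s (G g)) (scal (/ sqrt s) (G g))))).
  { eapply half_line_int_eq; [|apply half_line_int_plus; [exact Cr| |apply inverse_sqrt_int, Hs'|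
      apply half_line_int_scal; [exact Ci|apply half_line_int_inv_sq, Hs]]].
    - vec; field; lra.
    - intros x; apply (continuous_scal_r (V := H)), Ci. }
  assert (D : dominated s (norm g / s)
    (fun x => plus (Rs (x ^ 2 + s) (G g)) (scal (-1) (scal (/ (x ^ 2 + s)) (G g))))).
  { split.
    - intros x; apply (continuous_plus (V := H)); [apply Cr|apply (continuous_scal_r (V := H)), Ci].
    - intros x; pose proof (pow2_ge_0 x); set (t := x ^ 2 + s).
      assert (Ht : 0 < t) by (unfold t; lra).
      destruct (shifted_inverse_spec (A := A) t 1 g ltac:(lra) ltac:(lra)) as [D Eq].
      assert (E : Rs t (G g) = minus (scal (/ t) (G g)) (scal (/ t) (Rs t g))).
      { rewrite (proj2 (resolvent_commuting (lam := lam) t ltac:(lra))).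
        assert (LG := inverse_opp_linear (A := A)).
        transitivity (minus (scal (/ t) (G (minus (scal t (Rs t g)) (scal 1 (A (Rs t g))))))
          (scal (/ t) (Rs t g))); [|rewrite Eq; reflexivity].
        rewrite (linear_minus _ _ _ LG), !(linear_scal _ LG).
        replace (A (Rs t g)) with (scal (-1) (opp (A (Rs t g)))) by vec.
        rewrite (linear_scal _ LG), inverse_opp_op by exact D; vec; field; lra. }
      rewrite E.
      apply (Rle_trans _ (norm (scal (- / t) (Rs t g)))); [apply Req_le; f_equal; vec|].
      assert (Hit : 0 < / t) by (apply Rinv_0_lt_compat, Ht).
      rewrite norm_scal_eq, Rabs_Ropp, Rabs_pos_eq by lra.
      rewrite Rmult_comm; apply Rmult_le_compat_r; [lra|].
      eapply Rle_trans; [apply resolvent_bound; lra|].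
      apply Rmult_le_compat_l; [assumption|apply Rinv_le_contravar; unfold t; lra]. }
  assert (HM : 0 <= norm g / s) by (apply Rdiv_le_0_compat; lra).
  pose proof (half_line_int_bound _ _ _ _ Hs HM D I) as B.
  rewrite norm_scal_eq, Rabs_pos_eq in B by lra.
  apply (Rmult_le_reg_l (PI / 2)); [lra|].
  replace (PI / 2 * (norm g / s / sqrt s)) with (norm g / s * (PI / 2 / sqrt s)) by (unfold Rdiv; ring).
  exact B.
Qed.

(* With L = -A, the form ((L + s) B_s f, B_s f') on dom A does not depend on the
   shift s, since d/ds B_s = - 1/2 (L + s)^(-1) B_s, and tends to (f, f') as s
   tends to infinity. *)
Let form (g g' : H) (s : R) : R :=
  ip (Bs s g) (Bs s (G g')) + s * ip (Bs s (G g)) (Bs s (G g')).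

Lemma form_constant (g g' : H) (s : R) : 0 < s -> form g g' 0 = form g g' s.
Proof.
  intros Hs; apply (eq_is_derive (V := R_NormedModule)); [|exact Hs]; intros t [Ht _].
  assert (Ht' : 0 < t + lam) by lra.
  pose proof (inverse_sqrt_is_derive t g Ht') as D1.
  pose proof (inverse_sqrt_is_derive t (G g) Ht') as D2.
  pose proof (inverse_sqrt_is_derive t (G g') Ht') as D3.
  pose proof (is_derive_ip _ _ _ _ _ D1 D3) as I1.
  pose proof (is_derive_ip _ _ _ _ _ D2 D3) as I2.
  pose proof (is_derive_mult (K := R_AbsRing) (fun x => x) _ t _ _ (is_derive_id t) I2 Rmult_comm) as I3.
  pose proof (is_derive_plus (V := R_NormedModule) _ _ _ _ _ I1 I3) as I4.
  unfold form; evar_last; [exact I4|].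
  assert (E : Rs t (plus (Bs t g) (scal t (Bs t (G g)))) = Bs t (G g)).
  { assert (LB := inverse_sqrt_linear t Ht').
    rewrite <- (linear_scal _ LB), <- (linear_plus _ LB).
    rewrite (commuting_inverse_sqrt_comm (Rs t)) by (try apply resolvent_commuting; assumption).
    f_equal; apply shifted_inverse_eq; [lra|lra|vec]. }
  assert (S : forall x y, ip (Rs t x) y = ip x (Rs t y))
    by (intros; apply shifted_inverse_sym; lra).
  set (b := Bs t (G g)) in *; set (b' := Bs t (G g')) in *; set (p := Bs t g) in *.
  (* By symmetry of R_t the derivative of the form is [ip b b'] minus the left-hand side. *)
  assert (E' : ip (Rs t p) b' + t * ip (Rs t b) b' = ip b b').
  { assert (LR := resolvent_linear t Ht').
    assert (E2 : plus (Rs t p) (scal t (Rs t b)) = b).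
    { rewrite <- (linear_scal _ LR), <- (linear_plus _ LR); exact E. }
    rewrite <- E2 at 2; ip_simpl; ring. }
  unfold plus, mult, one, zero; simpl.
  ip_simpl; rewrite <- !S; change (Bs t (G g)) with b; change (Bs t (G g')) with b'; rewrite <- E'; field.
Qed.

Lemma inverse_sqrt_form (g g' : H) : ip (Bs 0 g) (Bs 0 (G g')) = ip (G g) (G g').
Proof.
  apply Rminus_diag_uniq.
  set (d := ip (Bs 0 g) (Bs 0 (G g')) - ip (G g) (G g')).
  set (C := norm g * norm (G g') + norm (G g) * norm g' + norm g * norm (G g') + norm g * norm g').
  assert (B : forall s, 1 <= s -> Rabs d <= C / s).
  { intros s Hs; assert (Hs0 : 0 < s) by lra.
    pose proof (form_constant g g' s Hs0) as F; unfold form in F.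
    rewrite Rmult_0_l, Rplus_0_r in F; unfold d; rewrite F; clear d F.
    pose proof (sqrt_lt_R0 s Hs0) as Hq; pose proof (sqrt_sqrt s (Rlt_le _ _ Hs0)) as Hqq.
    pose proof (norm_ge_0 g); pose proof (norm_ge_0 g'); pose proof (norm_ge_0 (G g)).
    pose proof (norm_ge_0 (G g')).
    set (e := minus (Bs s (G g)) (scal (/ sqrt s) (G g))).
    set (e' := minus (Bs s (G g')) (scal (/ sqrt s) (G g'))).
    assert (Be : norm e <= norm g / s / sqrt s) by apply inverse_sqrt_asymp, Hs0.
    assert (Be' : norm e' <= norm g' / s / sqrt s) by apply inverse_sqrt_asymp, Hs0.
    (* Inserting B_s G g = G g / sqrt s + e, and likewise for g', the leading part of the form is (G
       g, G g'); the four remaining terms are O(1 / s) and make up [C]. *)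
    replace (ip (Bs s g) (Bs s (G g')) + s * ip (Bs s (G g)) (Bs s (G g')) - ip (G g) (G g'))
      with (ip (Bs s g) (Bs s (G g')) + (sqrt s * ip (G g) e' + sqrt s * ip e (G g') + s * ip e e')).
    2:{ unfold e, e'; ip_simpl.
        generalize (ip (Bs s g) (Bs s (G g'))), (ip (Bs s (G g)) (Bs s (G g'))),
          (ip (G g) (Bs s (G g'))), (ip (Bs s (G g)) (G g')), (ip (G g) (G g')).
        intros x1 x2 x3 x4 x5; rewrite <- Hqq; generalize (sqrt s) Hq.
        intros q Pq; rewrite sqrt_square by lra; field; lra. }
    assert (Bb : forall f, norm (Bs s f) <= norm f / sqrt s).
    { intros f; eapply Rle_trans; [apply inverse_sqrt_bound; lra|].
      apply Rmult_le_compat_l; [apply norm_ge_0|apply Rinv_le_contravar; [exact Hq|]].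
      apply sqrt_le_1; lra. }
    assert (T1 : Rabs (ip (Bs s g) (Bs s (G g'))) <= norm g * norm (G g') / s).
    { eapply Rle_trans; [apply cauchy_schwarz|].
      replace (norm g * norm (G g') / s) with ((norm g / sqrt s) * (norm (G g') / sqrt s))
        by (rewrite <- Hqq at 3; field; lra).
      apply Rmult_le_compat; try apply norm_ge_0; apply Bb. }
    assert (T2 : Rabs (sqrt s * ip (G g) e') <= norm (G g) * norm g' / s).
    { rewrite Rabs_mult, (Rabs_pos_eq (sqrt s)) by lra.
      replace (norm (G g) * norm g' / s) with (sqrt s * (norm (G g) * (norm g' / s / sqrt s))) by (field; lra).
      apply Rmult_le_compat_l; [lra|]; eapply Rle_trans; [apply cauchy_schwarz|].
      apply Rmult_le_compat_l; assumption. }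
    assert (T3 : Rabs (sqrt s * ip e (G g')) <= norm g * norm (G g') / s).
    { rewrite Rabs_mult, (Rabs_pos_eq (sqrt s)) by lra.
      replace (norm g * norm (G g') / s) with (sqrt s * (norm g / s / sqrt s * norm (G g'))) by (field; lra).
      apply Rmult_le_compat_l; [lra|]; eapply Rle_trans; [apply cauchy_schwarz|].
      apply Rmult_le_compat_r; assumption. }
    assert (T4 : Rabs (s * ip e e') <= norm g * norm g' / s).
    { rewrite Rabs_mult, (Rabs_pos_eq s) by lra.
      apply Rle_trans with (s * (norm g / s / sqrt s * (norm g' / s / sqrt s))).
      - apply Rmult_le_compat_l; [lra|]; eapply Rle_trans; [apply cauchy_schwarz|].
        apply Rmult_le_compat; try apply norm_ge_0; assumption.
      - replace (s * (norm g / s / sqrt s * (norm g' / s / sqrt s)))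
          with (norm g * norm g' / s * / (sqrt s * sqrt s)) by (field; lra).
        rewrite Hqq; assert (0 <= norm g * norm g' / s) by (apply Rdiv_le_0_compat; [apply Rmult_le_pos; assumption|lra]).
        assert (/ s <= 1) by (rewrite <- Rinv_1; apply Rinv_le_contravar; lra). nra. }
    eapply Rle_trans; [apply Rabs_triang|].
    eapply Rle_trans; [apply Rplus_le_compat_l, Rabs_triang|].
    eapply Rle_trans; [apply Rplus_le_compat_l, Rplus_le_compat_r, Rabs_triang|].
    unfold C, Rdiv in *; lra. }
  assert (HC : 0 <= C) by (specialize (B 1 (Rle_refl 1)); pose proof (Rabs_pos d); unfold Rdiv in B;
    rewrite Rinv_1 in B; lra).
  destruct (Req_dec d 0) as [Z|N]; [exact Z|exfalso].
  pose proof (Rabs_pos_lt d N) as Pd.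
  (* The difference [d] does not depend on [s]; at this value of [s] the bound [C / s] is smaller
     than |d|. *)
  specialize (B (C / Rabs d + 1)).
  assert (H1 : 0 <= C / Rabs d) by (apply Rdiv_le_0_compat; assumption).
  specialize (B ltac:(lra)).
  apply (Rmult_le_compat_r (C / Rabs d + 1)) in B; [|lra].
  replace (C / (C / Rabs d + 1) * (C / Rabs d + 1)) with C in B by (field; split; lra).
  replace (Rabs d * (C / Rabs d + 1)) with (C + Rabs d) in B by (field; lra); lra.
Qed.

(** In [inverse_sqrt_form] the second argument is of the form G g'; density of the range of G and
    symmetry of B_0 remove this restriction. *)
Lemma inverse_sqrt_ip (g k : H) : ip (Bs 0 g) (Bs 0 k) = ip (G g) k.
Proof.
  assert (P : 0 < 0 + lam) by lra.
  assert (E : Bs 0 (Bs 0 g) = G g).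
  { apply ip_ext; intros z; apply cond_eq; intros e He.
    pose proof (norm_ge_0 (Bs 0 (Bs 0 g))); pose proof (norm_ge_0 (G g)).
    set (K := norm (Bs 0 (Bs 0 g)) + norm (G g) + 1).
    destruct (inverse_opp_dense (A := A) z (e / K)) as [y By];
      [apply Rdiv_lt_0_compat; unfold K; lra|].
    rewrite norm_minus_sym in By.
    replace (ip (Bs 0 (Bs 0 g)) z - ip (G g) z) with (ip (minus (Bs 0 (Bs 0 g)) (G g)) (minus z (G y))).
    - eapply Rle_lt_trans; [apply cauchy_schwarz|].
      pose proof (norm_minus_le (Bs 0 (Bs 0 g)) (G g)).
      apply Rle_lt_trans with (K * norm (minus z (G y))).
      + apply Rmult_le_compat_r; [apply norm_ge_0|unfold K; lra].
      + apply (Rmult_lt_compat_l K) in By; [|unfold K; lra].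
        replace (K * (e / K)) with e in By by (field; unfold K; lra); exact By.
    - assert (Z : ip (minus (Bs 0 (Bs 0 g)) (G g)) (G y) = 0).
      { rewrite ip_minus_l, inverse_sqrt_sym, inverse_sqrt_form by exact P; ring. }
      rewrite (ip_minus_r _ z), Z, ip_minus_l; ring. }
  rewrite <- E, (inverse_sqrt_sym 0 (Bs 0 g)) by exact P; reflexivity.
Qed.

Lemma inverse_sqrt_sq (g : H) : Bs 0 (Bs 0 g) = G g.
Proof.
  apply ip_ext; intros z; rewrite inverse_sqrt_sym by lra; apply inverse_sqrt_ip.
Qed.

Lemma inverse_sqrt_injective (g k : H) : Bs 0 g = Bs 0 k -> g = k.
Proof.
  intros E; apply (inverse_opp_injective (A := A)); rewrite <- !inverse_sqrt_sq, E; reflexivity.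
Qed.

Lemma Rpower_neg_half (y : R) : 0 < y -> Rpower (y ^ 2) (- (1 / 2)) = / y.
Proof.
  intros Hy; rewrite Rpower_Ropp; replace (1 / 2) with (/ 2) by lra.
  assert (0 < y ^ 2) by nra.
  rewrite Rpower_sqrt by assumption; rewrite sqrt_pow2 by lra; reflexivity.
Qed.

(** The change of variables t = x^2 absorbs the weight t^(-1/2) together with its singularity at 0,
    leaving an integrand continuous on the whole line. *)
Lemma balakrishnan_RInt (w : H) (a b : R) : 0 < a -> 0 < b ->
  is_RInt (fun t => scal (Rpower t (- (1 / 2))) (Rs t w)) a b
    (scal 2 (minus (RInt (fun x => Rs (x ^ 2 + 0) w) 0 (sqrt b))
      (RInt (fun x => Rs (x ^ 2 + 0) w) 0 (sqrt a)))).
Proof.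
  intros Ha Hb; set (f := fun t => scal (Rpower t (- (1 / 2))) (Rs t w)).
  assert (Cr : forall x, continuous (fun x => Rs (x ^ 2 + 0) w) x)
    by (intros; apply resolvent_sq_continuous; lra).
  assert (Cf : forall t, 0 < t -> continuous f t).
  { intros t Ht; apply (continuous_scal (V := H)).
    - unfold Rpower; apply: ex_derive_continuous; auto_derive; exact Ht.
    - apply resolvent_continuous; lra. }
  assert (Pos : forall x y z, 0 < x -> 0 < y -> Rmin x y <= z <= Rmax x y -> 0 < z).
  { intros x y z Hx Hy [Hz _]; pose proof (Rmin_glb_lt x y 0 Hx Hy); lra. }
  pose proof (sqrt_lt_R0 a Ha) as Qa; pose proof (sqrt_lt_R0 b Hb) as Qb.
  assert (I1 : is_RInt (fun y => scal (2 * y) (f (y ^ 2))) (sqrt a) (sqrt b) (RInt f a b)).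
  { rewrite <- (pow2_sqrt a), <- (pow2_sqrt b) at 2 by lra.
    apply (is_RInt_comp (V := H) f (fun y => y ^ 2) (fun y => 2 * y)).
    - intros y Hy; apply Cf; pose proof (Pos _ _ _ Qa Qb Hy); nra.
    - intros y _; split; [auto_derive; [trivial|ring]|].
      apply: ex_derive_continuous; auto_derive; trivial. }
  assert (I2 : is_RInt (fun y => scal 2 (Rs (y ^ 2 + 0) w)) (sqrt a) (sqrt b) (RInt f a b)).
  { eapply is_RInt_ext; [|exact I1]; intros y Hy.
    assert (Py : 0 < y) by (apply (Pos _ _ _ Qa Qb); lra).
    unfold f; rewrite Rpower_neg_half, Rplus_0_r by exact Py; vec; field; lra. }
  assert (I3 : is_RInt (fun y => scal 2 (Rs (y ^ 2 + 0) w)) (sqrt a) (sqrt b)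
    (scal 2 (RInt (fun y => Rs (y ^ 2 + 0) w) (sqrt a) (sqrt b)))).
  { apply (is_RInt_scal (V := H)), RInt_all, Cr. }
  rewrite RInt_tail by exact Cr.
  rewrite <- (is_RInt_unique (V := H) _ _ _ _ I3), (is_RInt_unique (V := H) _ _ _ _ I2).
  apply (RInt_correct (V := H)), (ex_RInt_continuous (V := H)).
  intros t Ht; apply Cf, (Pos _ _ _ Ha Hb Ht).
Qed.

Lemma balakrishnan_RInt_gen (w : H) :
  is_RInt_gen (fun t => scal (Rpower t (- (1 / 2))) (Rs t w))
    (at_right 0) (Rbar_locally p_infty) (scal PI (Bs 0 w)).
Proof.
  assert (P : 0 < 0 + lam) by lra.
  assert (Cr : forall x, continuous (fun x => Rs (x ^ 2 + 0) w) x)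
    by (intros; apply resolvent_sq_continuous, P).
  pose proof (inverse_sqrt_int 0 w P) as I.
  intros Q HQ; destruct (locally_norm_le_locally (V := H) _ _ HQ) as [[e He] HQ'].
  clear HQ; rename HQ' into HQ.
  destruct (proj1 (filterlim_norm_lt _ _ _) I (e / 4) ltac:(lra)) as [M HM].
  pose proof (norm_ge_0 w) as Hw; set (K := norm w * / (0 + lam) + 1).
  assert (HK : 0 < K) by (unfold K; assert (0 < / (0 + lam)) by (apply Rinv_0_lt_compat, P); nra).
  assert (Small : forall c, 0 <= c -> norm (RInt (fun x => Rs (x ^ 2 + 0) w) 0 c) <= c * K).
  { intros c Hc.
    apply (norm_RInt_le (V := H) (fun x => Rs (x ^ 2 + 0) w) (fun _ => K) 0 c); [exact Hc| | |].
    - intros x _; pose proof (pow2_ge_0 x).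
      eapply Rle_trans; [apply resolvent_bound; lra|].
      assert (/ (x ^ 2 + 0 + lam) <= / (0 + lam)) by (apply Rinv_le_contravar; lra).
      unfold K; nra.
    - apply RInt_all, Cr.
    - pose proof (is_RInt_const (V := R_NormedModule) 0 c K) as IC.
      replace (c * K) with (scal (c - 0) K) by (unfold scal; simpl; unfold mult; simpl; ring).
      exact IC. }
  assert (Hd : 0 < e / (4 * K)) by (apply Rdiv_lt_0_compat; lra).
  (* The thresholds are squares because the endpoints enter through [sqrt a] and [sqrt b]. *)
  apply (Filter_prod _ _ _ (fun a => 0 < a < (e / (4 * K)) ^ 2) (fun b => Rmax M 0 ^ 2 < b)).
  - assert (Hd2 : 0 < (e / (4 * K)) ^ 2) by (apply pow_lt, Hd).
    exists (mkposreal _ Hd2); intros y Hy Py; split; [exact Py|].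
    assert (Hy' : Rabs (y - 0) < (e / (4 * K)) ^ 2) by exact Hy.
    apply Rabs_def2 in Hy'; lra.
  - exists (Rmax M 0 ^ 2); auto.
  - intros a b [Ha Ha'] Hb; simpl.
    assert (Hb0 : 0 < b) by (pose proof (pow2_ge_0 (Rmax M 0)); lra).
    eexists; split; [apply balakrishnan_RInt; assumption|apply HQ].
    unfold ball_norm.
    assert (Sa : sqrt a < e / (4 * K)).
    { rewrite <- (sqrt_pow2 (e / (4 * K))) by lra; apply sqrt_lt_1; [lra|apply pow2_ge_0|exact Ha']. }
    assert (Sb : M < sqrt b).
    { apply Rle_lt_trans with (Rmax M 0); [apply Rmax_l|].
      rewrite <- (sqrt_pow2 (Rmax M 0)) by apply Rmax_r.
      apply sqrt_lt_1; [apply pow2_ge_0|lra|exact Hb]. }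
    specialize (HM _ Sb); specialize (Small (sqrt a) (sqrt_pos a)); cbv beta in HM.
    assert (sqrt a * K < e / 4).
    { apply (Rmult_lt_compat_r K) in Sa; [|exact HK].
      replace (e / (4 * K) * K) with (e / 4) in Sa by (field; lra); exact Sa. }
    set (x1 := RInt (fun x => Rs (x ^ 2 + 0) w) 0 (sqrt b)) in *.
    set (x2 := RInt (fun x => Rs (x ^ 2 + 0) w) 0 (sqrt a)) in *.
    apply (Rle_lt_trans _ (norm (minus (scal 2 (minus x1 (scal (PI / 2) (Bs 0 w)))) (scal 2 x2)))).
    + apply Req_le; f_equal; vec; field.
    + eapply Rle_lt_trans; [apply norm_minus_le|].
      rewrite !norm_scal_eq, Rabs_pos_eq by lra; simpl; lra.
Qed.

Lemma frac_graph_half (u w : H) : frac_graph A (1 / 2) u w <-> u = Bs 0 w.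
Proof.
  assert (Sin : sin (PI * (1 / 2)) / PI = / PI).
  { replace (PI * (1 / 2)) with (PI / 2) by field; rewrite sin_PI2; unfold Rdiv; ring. }
  pose proof PI_RGT_0; pose proof (balakrishnan_RInt_gen w) as BI.
  split.
  - intros (r & J & Hr & HJ & ->).
    assert (E : J = scal PI (Bs 0 w)).
    { assert (HJ' : is_RInt_gen (fun t => scal (Rpower t (- (1 / 2))) (Rs t w))
        (at_right 0) (Rbar_locally p_infty) J).
      { eapply (is_RInt_gen_ext (V := H)); [|exact HJ].
        apply (Filter_prod _ _ _ (fun a => 0 < a) (fun b => 0 < b)).
        - exists (mkposreal 1 Rlt_0_1); intros y _ Py; exact Py.
        - exists 0; auto.
        - intros a b Ha Hb x [Hx _]; simpl in Hx.
          pose proof (Rmin_glb_lt a b 0 Ha Hb); f_equal.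
          destruct (Hr x ltac:(lra)) as [D Eq]; symmetry.
          apply shifted_inverse_unique; [lra|lra|exact D|rewrite <- Eq; vec]. }
      rewrite <- (is_RInt_gen_unique (V := H) _ _ HJ'), <- (is_RInt_gen_unique (V := H) _ _ BI).
      reflexivity. }
    rewrite E; vec; rewrite Sin; field; lra.
  - intros ->; exists (fun t => Rs t w), (scal PI (Bs 0 w)); split; [|split; [exact BI|]].
    + intros t Ht; destruct (shifted_inverse_spec (A := A) t 1 w ltac:(lra) ltac:(lra)) as [D Eq].
      split; [exact D|].
      transitivity (minus (scal t (Rs t w)) (scal 1 (A (Rs t w)))); [vec|exact Eq].
    + vec; rewrite Sin; field; lra.
Qed.

Lemma in_V_iff (u : H) : in_V A u <-> exists w, u = Bs 0 w.
Proof. split; intros [w Hw]; exists w; apply frac_graph_half; exact Hw. Qed.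

Lemma norm_V_inverse_sqrt (w : H) : norm_V A (Bs 0 w) = norm w.
Proof.
  unfold norm_V, frac_norm, frac_pow; f_equal.
  apply: (iota_unique (V := H)); [|apply frac_graph_half; reflexivity].
  intros y Hy; apply frac_graph_half in Hy; apply inverse_sqrt_injective; auto.
Qed.

Lemma inverse_sqrt_0_bound (w : H) : norm (Bs 0 w) <= norm w / sqrt lam.
Proof. rewrite <- (Rplus_0_l lam); apply inverse_sqrt_bound; lra. Qed.

End SquareRoot.

(** * The Duhamel integral *)

Definition duhamel {H : HilbertSpace} (A : LinearOperator H) (g : R -> H) (t : R) : H :=
  RInt (fun s => semigroup A (t - s) (g s)) 0 t.

Section Duhamel.

Context {H : HilbertSpace} {A : LinearOperator H} {lam : R}
  {CA : coercive_selfadjoint A lam}.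

Let lam_pos : 0 < lam := coercive_pos.

Local Notation G := (inverse_opp A).
Local Notation S := (semigroup A).
Local Notation B := (inverse_sqrt A 0).
Local Notation D := (duhamel A).

Lemma shift_continuous (g : R -> H) (t : R) :
  (forall s, continuous g s) -> forall s, continuous (fun s => g (t + s)) s.
Proof.
  intros Cg s; apply (continuous_comp (fun s => t + s) g); [|apply Cg].
  apply: ex_derive_continuous; auto_derive; trivial.
Qed.

Lemma duhamel_integrand_continuous (g : R -> H) (t : R) :
  (forall s, continuous g s) -> forall s, continuous (fun s => S (t - s) (g s)) s.
Proof.
  intros Cg s; apply (semigroup_continuous_2 g (fun s => t - s)); [apply Cg|].
  apply: ex_derive_continuous; auto_derive; trivial.
Qed.

Lemma duhamel_is_RInt (g : R -> H) (t : R) : (forall s, continuous g s) ->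
  is_RInt (fun s => S (t - s) (g s)) 0 t (D g t).
Proof. intros Cg; apply RInt_all, duhamel_integrand_continuous, Cg. Qed.

Lemma norm_RInt_le_const_H (f : R -> H) (a b M : R) (I : H) : a <= b ->
  (forall x, a <= x <= b -> norm (f x) <= M) -> is_RInt f a b I -> norm I <= (b - a) * M.
Proof.
  intros Hab Bf HI; apply (norm_RInt_le (V := H) f (fun _ => M) a b); try assumption.
  exact (is_RInt_const (V := R_NormedModule) a b M).
Qed.

Lemma duhamel_norm (g : R -> H) (t M : R) : (forall s, continuous g s) -> 0 <= t ->
  (forall s, 0 <= s <= t -> norm (g s) <= M) -> norm (D g t) <= t * M.
Proof.
  intros Cg Ht Bg; replace (t * M) with ((t - 0) * M) by ring.
  eapply norm_RInt_le_const_H; [exact Ht| |apply duhamel_is_RInt, Cg].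
  intros s Hs; simpl; eapply Rle_trans; [apply semigroup_norm|apply Bg, Hs].
Qed.

Lemma duhamel_zero (g : R -> H) : D g 0 = zero.
Proof. apply (RInt_point (V := H)). Qed.

Lemma duhamel_minus (f g : R -> H) (t : R) :
  (forall s, continuous f s) -> (forall s, continuous g s) ->
  D (fun s => minus (f s) (g s)) t = minus (D f t) (D g t).
Proof.
  intros Cf Cg; apply (is_RInt_unique (V := H)).
  eapply is_RInt_ext; [|apply (is_RInt_minus (V := H)); apply duhamel_is_RInt; assumption].
  intros s _; symmetry; apply (proj1 (semigroup_contraction (t - s))).
Qed.

Lemma duhamel_add (g : R -> H) (t d : R) : (forall s, continuous g s) -> 0 <= t -> 0 <= d ->
  D g (t + d) = plus (S d (D g t)) (D (fun s => g (t + s)) d).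
Proof.
  intros Cg Ht Hd; apply (is_RInt_unique (V := H)).
  apply (is_RInt_Chasles (V := H) _ 0 t).
  - eapply is_RInt_ext; [|apply (is_RInt_linear (U := H) (V := H) (S d)
      (fun s => S (t - s) (g s))); [apply semigroup_linear|apply duhamel_is_RInt, Cg]].
    intros s Hs; rewrite Rmin_left, Rmax_right in Hs by lra.
    simpl; rewrite semigroup_add by lra; f_equal; ring.
  - assert (I : is_RInt (fun s => S (t + d - s) (g s)) (1 * 0 + t) (1 * d + t)
      (RInt (fun s => S (t + d - s) (g s)) (1 * 0 + t) (1 * d + t)))
      by apply RInt_all, duhamel_integrand_continuous, Cg.
    pose proof (is_RInt_comp_lin (V := H) _ 1 t 0 d _ I) as I2.
    assert (E : RInt (fun s => S (t + d - s) (g s)) (1 * 0 + t) (1 * d + t)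
      = D (fun s => g (t + s)) d).
    { rewrite <- (is_RInt_unique (V := H) _ _ _ _ I2); unfold duhamel.
      apply (RInt_ext (V := H)); intros s _; simpl.
      replace (t + d - (1 * s + t)) with (d - s) by ring.
      replace (1 * s + t) with (t + s) by ring; vec. }
    rewrite E in I.
    replace (1 * 0 + t) with t in I by ring; replace (1 * d + t) with (t + d) in I by ring.
    exact I.
Qed.

Lemma duhamel_const (c : H) (m : R) : 0 <= m -> D (fun _ => c) m = minus (G c) (G (S m c)).
Proof.
  intros Hm; apply (is_RInt_unique (V := H)).
  pose proof (semigroup_RInt (A := A) m c Hm) as I.
  apply (is_RInt_swap (V := H)) in I.
  assert (I0 : is_RInt (fun s => S s c) ((-1) * 0 + m) ((-1) * m + m)
    (opp (minus (G c) (G (S m c))))).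
  { replace ((-1) * 0 + m) with m by ring; replace ((-1) * m + m) with 0 by ring; exact I. }
  apply (is_RInt_comp_lin (V := H)) in I0.
  apply (is_RInt_scal (V := H) _ _ _ (-1)) in I0.
  assert (E : scal (-1) (opp (minus (G c) (G (S m c)))) = minus (G c) (G (S m c))) by vec.
  rewrite <- E; eapply is_RInt_ext; [|exact I0].
  intros s _; simpl; replace (-1 * s + m) with (m - s) by ring; vec.
Qed.

Lemma duhamel_near_const (f : R -> H) (c : H) (h e : R) : (forall s, continuous f s) -> 0 <= h ->
  (forall s, 0 <= s <= h -> norm (minus (f s) c) <= e) ->
  (forall s, 0 <= s <= h -> norm (minus (S s c) c) <= e) ->
  norm (minus (D f h) (scal h c)) <= h * (2 * e).
Proof.
  intros Cf Hh Bf Bc; replace (h * (2 * e)) with ((h - 0) * (2 * e)) by ring.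
  replace (scal h c) with (scal (h - 0) c) by (f_equal; ring).
  eapply norm_RInt_le_const_H; [exact Hh| |apply (is_RInt_minus (V := H));
    [apply duhamel_is_RInt, Cf|apply (is_RInt_const (V := H))]].
  intros s Hs; cbv beta.
  eapply Rle_trans; [apply (norm_minus_trans (S (h - s) c))|].
  rewrite <- (proj1 (semigroup_contraction (h - s))).
  pose proof (semigroup_norm (A := A) (h - s) (minus (f s) c)).
  pose proof (Bf s Hs); pose proof (Bc (h - s) ltac:(lra)); lra.
Qed.

(** If S(d) x = G z then q = B z, and |q|^2 = (S(d) x, z) interpolates between |x| and |x| / d. For
    the increment, one half of the time [d] pays for the square root and the other for time
    regularity. *)
Lemma semigroup_smoothing_V (d : R) (x : H) : 0 < d ->
  exists q, S d x = B q /\ sqrt d * norm q <= norm x /\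
    forall h, 0 <= h -> d * (sqrt d * norm (minus (S h q) q)) <= 4 * h * norm x.
Proof.
  intros Hd.
  assert (Base : forall d x, 0 < d -> exists q, S d x = B q /\ sqrt d * norm q <= norm x).
  { clear d x Hd; intros d x Hd; destruct (semigroup_smoothing (A := A) d x Hd) as [z [Ez Bz]].
    exists (B z); rewrite inverse_sqrt_sq; split; [exact Ez|].
    pose proof (norm_ge_0 x) as Px; pose proof (sqrt_sqrt d (Rlt_le _ _ Hd)).
    assert (E : norm (B z) ^ 2 = ip (S d x) z) by (rewrite <- ip_norm, inverse_sqrt_ip, Ez; reflexivity).
    pose proof (ip_le_norm (S d x) z); pose proof (semigroup_norm (A := A) d x).
    pose proof (norm_ge_0 z).
    apply Rsqr_incr_0_var; [unfold Rsqr|exact Px].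
    replace (sqrt d * norm (B z) * (sqrt d * norm (B z))) with ((sqrt d * sqrt d) * norm (B z) ^ 2) by ring.
    rewrite H0, E; apply Rle_trans with (norm x * (d * norm z)); [|apply Rmult_le_compat_l; lra].
    replace (norm x * (d * norm z)) with (d * (norm x * norm z)) by ring.
    apply Rmult_le_compat_l; [lra|]; eapply Rle_trans; [eassumption|].
    apply Rmult_le_compat_r; assumption. }
  destruct (Base (d / 2) x ltac:(lra)) as [p [Ep Bp]].
  exists (S (d / 2) p).
  assert (E : S d x = B (S (d / 2) p)).
  { rewrite (commuting_inverse_sqrt_comm (S (d / 2))) || idtac.
    rewrite <- (commuting_inverse_sqrt_comm (S (d / 2)) 0 p) by
      (try apply semigroup_commuting; lra).
    rewrite <- Ep, semigroup_add by lra; f_equal; field. }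
  split; [exact E|split].
  - destruct (Base d x Hd) as [q [Eq Bq]].
    rewrite E in Eq; apply inverse_sqrt_injective in Eq; rewrite Eq; exact Bq.
  - intros h Hh; pose proof (semigroup_time_lipschitz (A := A) h (d / 2) p Hh ltac:(lra)) as L.
    pose proof (sqrt_sqrt d ltac:(lra)) as Q; pose proof (sqrt_lt_R0 d Hd) as Qp.
    pose proof (sqrt_sqrt (d / 2) ltac:(lra)) as Q'; pose proof (sqrt_lt_R0 (d / 2) ltac:(lra)) as Qp'.
    assert (Qc : sqrt d <= 2 * sqrt (d / 2)) by nra.
    pose proof (norm_ge_0 p); set (n := norm (minus (S h (S (d / 2) p)) (S (d / 2) p))) in *.
    replace (d * (sqrt d * n)) with (2 * sqrt d * (d / 2 * n)) by field.
    apply Rle_trans with (2 * sqrt d * (h * norm p)); [apply Rmult_le_compat_l; lra|].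
    apply Rle_trans with (4 * h * (sqrt (d / 2) * norm p)); [|apply Rmult_le_compat_l; lra].
    assert (0 <= h * norm p) by (apply Rmult_le_pos; assumption); nra.
Qed.

(** Interpolates the bounds s and h / s with weights 3/4 and 1/4. A positive power of s survives,
    which keeps the pieces of the Duhamel integral summable. *)
Lemma min_quarter_power (s h c : R) : 0 < s -> 0 <= h -> c <= s -> s * c <= h ->
  c <= sqrt s * sqrt (sqrt h).
Proof.
  intros Hs Hh Hc Hsc.
  pose proof (sqrt_sqrt s (Rlt_le _ _ Hs)) as E1; pose proof (sqrt_lt_R0 s Hs) as P1.
  pose proof (sqrt_sqrt h Hh) as E2; pose proof (sqrt_pos h) as P2.
  pose proof (sqrt_sqrt (sqrt h) P2) as E3; pose proof (sqrt_pos (sqrt h)) as P3.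
  set (a := sqrt s) in *; set (r := sqrt (sqrt h)) in *.
  destruct (Rle_dec a r) as [Har|Har]; [nra|].
  assert (Hra : r < a) by lra.
  apply Rmult_le_reg_l with s; [exact Hs|eapply Rle_trans; [exact Hsc|]].
  rewrite <- E2, <- E3, <- E1.
  replace (r * r * (r * r)) with (r * (r * (r * r))) by ring.
  replace (a * a * (a * r)) with (r * (a * (a * a))) by ring.
  apply Rmult_le_compat_l; [exact P3|].
  apply Rmult_le_compat; try nra.
Qed.

Fixpoint partial_sum (q : nat -> H) (n : nat) : H :=
  match n with O => zero | Datatypes.S n => plus (partial_sum q n) (q n) end.

(* With d_k = t / 16^k, the Duhamel integral is the sum of the terms
   S(d_k+1) int_(t - d_k)^(t - d_k+1) S(t - d_k+1 - s) g(s) ds, to each of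
   which the smoothing estimates apply. *)
Lemma duhamel_V (g : R -> H) (t M : R) : (forall s, continuous g s) -> 0 <= t -> 0 <= M ->
  (forall s, 0 <= s <= t -> norm (g s) <= M) ->
  exists y, D g t = B y /\ norm y <= 8 * sqrt t * M /\
    forall h, 0 <= h ->
      norm (minus (S h y) y) <= 512 * M * sqrt (sqrt t) * sqrt (sqrt h).
Proof.
  intros Cg [Ht|Ht] HM Bg.
  2:{ subst t; exists zero; rewrite duhamel_zero, sqrt_0, sqrt_0, norm_zero_H.
      assert (LB := inverse_sqrt_linear (A := A) (lam := lam) 0 ltac:(lra)).
      split; [symmetry; apply (linear_zero _ LB)|split; [lra|intros h Hh]].
      replace (S h zero) with (zero : H) by (symmetry; apply (linear_zero _ (semigroup_linear h))).
      rewrite norm_minus_diag; lra. }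
  assert (LB := inverse_sqrt_linear (A := A) (lam := lam) 0 ltac:(lra)).
  (* The ratio 16 makes the fourth roots of [d k], which govern the Hoelder estimate, a geometric
     sequence of ratio 1/2. *)
  set (d := fun k : nat => t / 16 ^ k).
  assert (P16 : forall k, 1 <= 16 ^ k) by (intros; apply pow_R1_Rle; lra).
  assert (Hd : forall k, 0 < d k <= t).
  { intros k; specialize (P16 k); unfold d; split; [apply Rdiv_lt_0_compat; lra|].
    apply (Rmult_le_reg_r (16 ^ k)); [lra|]; unfold Rdiv; rewrite Rmult_assoc, Rinv_l by lra; nra. }
  assert (dS : forall k, d (Datatypes.S k) = d k / 16).
  { intros k; specialize (P16 k); unfold d; simpl; field; lra. }
  assert (sd : forall k, sqrt (d k) = sqrt t * (1 / 4) ^ k).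
  { induction k as [|k IH]; [unfold d; simpl; rewrite Rdiv_1_r; ring|].
    rewrite dS, sqrt_div_alt, IH by lra; replace 16 with (4 * 4) by ring.
    rewrite sqrt_square by lra; simpl; field. }
  assert (ssd : forall k, sqrt (sqrt (d k)) = sqrt (sqrt t) * (1 / 2) ^ k).
  { induction k as [|k IH]; [unfold d; simpl; rewrite Rdiv_1_r; ring|].
    rewrite dS, sqrt_div_alt by lra; replace 16 with (4 * 4) by ring.
    rewrite sqrt_square, sqrt_div_alt, IH by lra; replace 4 with (2 * 2) by ring.
    rewrite sqrt_square by lra; simpl; field. }
  set (y := fun k => S (d k) (D g (t - d k))).
  (* The length [15 / 16 * d k] is d_k - d_(k+1). *)
  set (x := fun k => D (fun s => g (t - d k + s)) (15 / 16 * d k)).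
  assert (Bx : forall k, norm (x k) <= d k * M).
  { intros k; specialize (Hd k); eapply Rle_trans.
    - apply (duhamel_norm _ _ M); [apply shift_continuous, Cg|lra|].
      intros s Hs; apply Bg; lra.
    - apply Rmult_le_compat_r; lra. }
  assert (yS : forall k, y (Datatypes.S k) = plus (y k) (S (d (Datatypes.S k)) (x k))).
  { intros k; unfold y, x; pose proof (Hd k); rewrite dS.
    replace (t - d k / 16) with (t - d k + 15 / 16 * d k) by field.
    rewrite duhamel_add by (try exact Cg; lra).
    etransitivity; [exact (linear_plus _ (semigroup_linear (d k / 16)) _ _)|].
    rewrite semigroup_add by lra; f_equal; f_equal; field. }
  assert (Ly : filterlim y eventually (locally (D g t))).
  { apply (seq_lim_of_norm _ _ (fun k => t * M * (1 / 16) ^ k)).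
    - replace (Finite 0) with (Rbar_mult (t * M) 0) by (simpl; f_equal; ring).
      apply is_lim_seq_scal_l, is_lim_seq_geom; rewrite Rabs_pos_eq; lra.
    - intros k; specialize (Hd k).
      replace t with (t - d k + d k) at 1 by ring; rewrite duhamel_add by (try exact Cg; lra).
      rewrite norm_minus_sym.
      apply (Rle_trans _ (norm (D (fun s => g (t - d k + s)) (d k)))).
      { apply Req_le; f_equal; unfold y; vec. }
      replace (t * M * (1 / 16) ^ k) with (d k * M).
      + apply duhamel_norm; [apply shift_continuous, Cg|lra|intros s Hs; apply Bg; lra].
      + specialize (P16 k); unfold d, Rdiv; rewrite Rmult_1_l, pow_inv; ring. }
  (* Smoothing over the time d_k / 16 of a vector of norm at most d_k M: sqrt (d_k / 16) |q| <= d_k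
     M gives 4, and (d_k / 16) (sqrt d_k / 4) n <= 4 h d_k M gives 256 = 4 * 16 * 4. *)
  assert (Ex : forall k, exists q, S (d (Datatypes.S k)) (x k) = B q /\
    norm q <= 4 * sqrt (d k) * M /\
    forall h, 0 <= h -> norm (minus (S h q) q) <= 256 * M * sqrt (sqrt (d k)) * sqrt (sqrt h)).
  { intros k; pose proof (Hd k) as [dk _]; pose proof (Hd (Datatypes.S k)) as [dSk _].
    destruct (semigroup_smoothing_V (d (Datatypes.S k)) (x k) dSk) as [q [Eq [Bq Hq]]].
    specialize (Bx k); rewrite dS in Bq, Hq.
    pose proof (sqrt_lt_R0 _ dk) as Ps; pose proof (sqrt_sqrt _ (Rlt_le _ _ dk)) as Es.
    assert (E4 : sqrt (d k / 16) = sqrt (d k) / 4).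
    { rewrite sqrt_div_alt by lra; f_equal; replace 16 with (4 * 4) by ring; apply sqrt_square; lra. }
    rewrite E4 in Bq, Hq; set (s := sqrt (d k)) in *.
    assert (Bq' : norm q <= 4 * s * M).
    { apply (Rmult_le_reg_l (s / 4)); [lra|]; eapply Rle_trans; [exact Bq|].
      eapply Rle_trans; [exact Bx|]; rewrite <- Es; apply Req_le; field. }
    exists q; split; [exact Eq|split; [exact Bq'|intros h Hh]].
    specialize (Hq h Hh); set (n := norm (minus (S h q) q)) in *.
    assert (Bn : n <= 8 * s * M).
    { unfold n; eapply Rle_trans; [apply norm_minus_le|].
      pose proof (semigroup_norm (A := A) h q); lra. }
    assert (Bn2 : s * n <= 256 * h * M).
    { apply (Rmult_le_reg_l (d k)); [exact dk|].
      assert (4 * h * norm (x k) <= 4 * h * (d k * M)) by (apply Rmult_le_compat_l; lra).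
      nra. }
    destruct HM as [HM|HM].
    - assert (K : n / (256 * M) <= sqrt s * sqrt (sqrt h)).
      { apply min_quarter_power; [exact Ps|exact Hh| |].
        - apply (Rmult_le_reg_r (256 * M)); [lra|].
          replace (n / (256 * M) * (256 * M)) with n by (field; lra); nra.
        - apply (Rmult_le_reg_r (256 * M)); [lra|].
          replace (s * (n / (256 * M)) * (256 * M)) with (s * n) by (field; lra); lra. }
      apply (Rmult_le_compat_r (256 * M)) in K; [|lra].
      replace (n / (256 * M) * (256 * M)) with n in K by (field; lra); lra.
    - rewrite <- HM in Bn |- *; lra. }
  destruct (functional_choice _ Ex) as [q Hq].
  set (w := partial_sum q).
  assert (Bw : forall k, B (w k) = y k).
  { induction k as [|k IH].
    - unfold w, y, d; simpl; rewrite Rdiv_1_r, Rminus_diag_eq, duhamel_zero by reflexivity.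
      transitivity (zero : H); [apply (linear_zero _ LB)|].
      symmetry; apply (linear_zero _ (semigroup_linear t)).
    - rewrite yS, <- IH, (proj1 (Hq k)); unfold w; simpl.
      apply (linear_plus _ LB). }
  assert (Ps : 0 <= sqrt t) by apply sqrt_pos.
  (* The ratio 1/4 of the norms is relaxed to 1/2, whence 8 = 4 / (1 - 1/2); the increments have
     ratio exactly 1/2, whence 512 = 256 / (1 - 1/2). *)
  destruct (geometric_lim (1 / 2) (4 * sqrt t * M) w) as [v [Lv Bv]].
  - lra.
  - apply Rmult_le_pos; lra.
  - intros k; replace (minus (w (Datatypes.S k)) (w k)) with (q k) by (unfold w; simpl; vec).
    eapply Rle_trans; [apply Hq|]; rewrite sd.
    assert ((1 / 4) ^ k <= (1 / 2) ^ k) by (apply pow_incr; lra).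
    replace (4 * (sqrt t * (1 / 4) ^ k) * M) with (4 * sqrt t * M * (1 / 4) ^ k) by ring.
    apply Rmult_le_compat_l; [apply Rmult_le_pos; lra|assumption].
  - exists v; split; [|split].
    + apply (seq_lim_unique y); [exact Ly|].
      apply (seq_lim_ext (fun k => B (w k))); [exact Bw|apply linear_seq_lim; assumption].
    + specialize (Bv 0%nat); change (w 0%nat) with (zero : H) in Bv.
      apply (Rle_trans _ (norm (minus v zero))); [apply Req_le; f_equal; vec|].
      eapply Rle_trans; [exact Bv|apply Req_le; simpl; field].
    + intros h Hh.
      set (z := fun k => minus (S h (w k)) (w k)).
      assert (Lz : filterlim z eventually (locally (minus (S h v) v))).
      { apply (seq_lim_ext (fun k => plus (S h (w k)) (scal (-1) (w k)))).
        - intros k; unfold z; vec.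
        - replace (minus (S h v) v) with (plus (S h v) (scal (-1) v)) by vec.
          apply seq_lim_plus; [apply linear_seq_lim; [apply semigroup_linear|exact Lv]|].
          apply seq_lim_scal, Lv. }
      set (C := 256 * M * sqrt (sqrt t) * sqrt (sqrt h)).
      assert (HC : 0 <= C).
      { unfold C; repeat apply Rmult_le_pos; try apply sqrt_pos; lra. }
      assert (St : forall k, norm (minus (z (Datatypes.S k)) (z k)) <= C * (1 / 2) ^ k).
      { intros k; replace (minus (z (Datatypes.S k)) (z k)) with (minus (S h (q k)) (q k)).
        - eapply Rle_trans; [apply Hq, Hh|]; rewrite ssd; unfold C; apply Req_le; ring.
        - assert (Ew : S h (w (Datatypes.S k)) = plus (S h (w k)) (S h (q k)))
            by exact (linear_plus _ (semigroup_linear h) (w k) (q k)).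
          unfold z; rewrite Ew; change (w (Datatypes.S k)) with (plus (w k) (q k)); vec. }
      replace (minus (S h v) v) with (minus (minus (S h v) v) zero) by vec.
      apply (seq_lim_norm_le z); [exact Lz|exists 0%nat; intros k _].
      pose proof (geometric_tail (1 / 2) C z ltac:(lra) HC St 0 k) as Tl.
      replace (z 0%nat) with (zero : H) in Tl.
      * eapply Rle_trans; [exact Tl|apply Req_le; unfold C; simpl; field].
      * assert (Ez : S h (w 0%nat) = zero) by exact (linear_zero _ (semigroup_linear h)).
        unfold z; rewrite Ez; change (w 0%nat) with (zero : H); vec.
Qed.

End Duhamel.

(** * Regularity of mild solutions *)

Definition mild {H : HilbertSpace} (A : LinearOperator H) (v0 : H) (g : R -> H) (t : R) : H :=
  plus (semigroup A t v0) (duhamel A g t).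

Definition generator_semigroup {H : HilbertSpace} (A : LinearOperator H) (d : R) (x : H) : H :=
  opp (A (semigroup A d x)).

(** This is (-A)^(1/2) applied to the Duhamel integral: its H-norm is the V-norm of the latter. *)
Definition duhamel_half {H : HilbertSpace} (A : LinearOperator H) (g : R -> H) (t : R) : H :=
  iota (fun y => duhamel A g t = inverse_sqrt A 0 y).

Section Regularity.

Context {H : HilbertSpace} {A : LinearOperator H} {lam : R}
  {CA : coercive_selfadjoint A lam}.

Let lam_pos : 0 < lam := coercive_pos.

Local Notation G := (inverse_opp A).
Local Notation S := (semigroup A).
Local Notation B := (inverse_sqrt A 0).
Local Notation D := (duhamel A).
Local Notation DV := (duhamel_half A).
Local Notation AS := (generator_semigroup A).

Lemma mild_add (v0 : H) (g : R -> H) (t d : R) : (forall s, continuous g s) ->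
  0 <= t -> 0 <= d ->
  mild A v0 g (t + d) = mild A (mild A v0 g t) (fun s => g (t + s)) d.
Proof.
  intros Cg Ht Hd; unfold mild.
  transitivity (plus (S (t + d) v0) (plus (S d (D g t)) (D (fun s => g (t + s)) d))).
  { f_equal; apply duhamel_add; assumption. }
  transitivity (plus (plus (S d (S t v0)) (S d (D g t))) (D (fun s => g (t + s)) d)).
  { rewrite semigroup_add, (Rplus_comm d t) by lra; vec. }
  f_equal; symmetry; exact (linear_plus _ (semigroup_linear d) _ _).
Qed.

Lemma duhamel_half_spec (g : R -> H) (t M : R) : (forall s, continuous g s) -> 0 <= t -> 0 <= M ->
  (forall s, 0 <= s <= t -> norm (g s) <= M) ->
  D g t = B (DV g t) /\ norm (DV g t) <= 8 * sqrt t * M /\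
  forall h, 0 <= h ->
    norm (minus (S h (DV g t)) (DV g t)) <= 512 * M * sqrt (sqrt t) * sqrt (sqrt h).
Proof.
  intros Cg Ht HM Bg; destruct (duhamel_V (A := A) g t M Cg Ht HM Bg) as [y [Ey Hy]].
  assert (E : DV g t = y).
  { apply: (iota_unique (V := H)); [|exact Ey].
    intros z Ez; apply (inverse_sqrt_injective (A := A)); rewrite <- Ez; exact Ey. }
  rewrite E; split; assumption.
Qed.

Lemma duhamel_half_add (g : R -> H) (t d M : R) : (forall s, continuous g s) ->
  (forall s, norm (g s) <= M) -> 0 <= t -> 0 <= d ->
  DV g (t + d) = plus (S d (DV g t)) (DV (fun s => g (t + s)) d).
Proof.
  intros Cg Bg Ht Hd; assert (HM : 0 <= M) by (specialize (Bg 0); pose proof (norm_ge_0 (g 0)); lra).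
  assert (LB := inverse_sqrt_linear (A := A) (lam := lam) 0 ltac:(lra)).
  apply (inverse_sqrt_injective (A := A)).
  destruct (duhamel_half_spec g (t + d) M Cg ltac:(lra) HM (fun s _ => Bg s)) as [E1 _].
  destruct (duhamel_half_spec g t M Cg ltac:(lra) HM (fun s _ => Bg s)) as [E2 _].
  destruct (duhamel_half_spec _ d M (shift_continuous g t Cg) Hd HM (fun s _ => Bg (t + s))) as [E3 _].
  rewrite <- E1; etransitivity; [apply duhamel_add; assumption|].
  etransitivity; [|symmetry; exact (linear_plus _ LB _ _)].
  f_equal; [|exact E3].
  rewrite E2; apply commuting_inverse_sqrt_comm; [lra|apply semigroup_commuting].
Qed.

(** The increment splits into (S(t - s) - 1) applied to the value at s, which is Hoelder of exponent
    1/4, and the contribution of [s, t], which is of order sqrt (t - s). *)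
Lemma duhamel_half_holder (g : R -> H) (s t M : R) : (forall s, continuous g s) ->
  (forall s, norm (g s) <= M) -> 0 <= s <= t ->
  norm (minus (DV g t) (DV g s))
    <= 512 * M * sqrt (sqrt s) * sqrt (sqrt (t - s)) + 8 * sqrt (t - s) * M.
Proof.
  intros Cg Bg Hst; assert (HM : 0 <= M) by (specialize (Bg 0); pose proof (norm_ge_0 (g 0)); lra).
  replace t with (s + (t - s)) at 1 by ring.
  rewrite (duhamel_half_add g s (t - s) M) by (try assumption; lra).
  destruct (duhamel_half_spec g s M Cg ltac:(lra) HM (fun s _ => Bg s)) as [_ [_ E2]].
  destruct (duhamel_half_spec _ (t - s) M (shift_continuous g s Cg) ltac:(lra) HM
    (fun r _ => Bg (s + r))) as [_ [E3 _]].
  specialize (E2 (t - s) ltac:(lra)).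
  apply (Rle_trans _ (norm (plus (minus (S (t - s) (DV g s)) (DV g s))
    (DV (fun r => g (s + r)) (t - s))))); [apply Req_le; f_equal; vec|].
  eapply Rle_trans; [apply norm_plus_le|apply Rplus_le_compat; assumption].
Qed.

Lemma sqrt_small (e : R) : 0 < e -> exists d, 0 < d /\ forall h, 0 <= h < d -> sqrt h < e.
Proof.
  intros He; exists (e ^ 2); split; [apply pow_lt, He|intros h [Hh Hd]].
  rewrite <- (sqrt_pow2 e) by lra; apply sqrt_lt_1; [exact Hh|apply pow2_ge_0|exact Hd].
Qed.

Lemma duhamel_half_continuous (g : R -> H) (t M e : R) : (forall s, continuous g s) ->
  (forall s, norm (g s) <= M) -> 0 <= t -> 0 < e ->
  exists d, 0 < d /\ forall s, 0 <= s -> Rabs (s - t) < d -> norm (minus (DV g s) (DV g t)) < e.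
Proof.
  intros Cg Bg Ht He; assert (HM : 0 <= M) by (specialize (Bg 0); pose proof (norm_ge_0 (g 0)); lra).
  set (C := 512 * M * sqrt (sqrt (t + 1)) + 8 * M + 1).
  assert (HC0 : 0 <= 512 * M * sqrt (sqrt (t + 1))) by (repeat apply Rmult_le_pos; try apply sqrt_pos; lra).
  assert (HC : 0 < C) by (unfold C; lra).
  destruct (sqrt_small (Rmin 1 (e / C))) as [d1 [Hd1 D1]].
  { apply Rmin_glb_lt; [lra|apply Rdiv_lt_0_compat; lra]. }
  (* [sqrt_small] is used twice because it is the fourth root of the increment that must stay below
     [e / C]. *)
  destruct (sqrt_small (Rmin d1 1)) as [d2 [Hd2 D2]]; [apply Rmin_glb_lt; lra|].
  assert (Key : forall a b, 0 <= a <= b -> b - a < d2 -> a <= t + 1 ->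
    norm (minus (DV g b) (DV g a)) < e).
  { intros a b Hab Hd Ha.
    eapply Rle_lt_trans; [apply (duhamel_half_holder g a b M); assumption|].
    specialize (D2 (b - a) ltac:(lra)).
    pose proof (Rmin_l d1 1); pose proof (Rmin_r d1 1).
    pose proof (sqrt_pos (b - a)) as P1; set (r := sqrt (b - a)) in *.
    specialize (D1 r ltac:(lra)); pose proof (sqrt_pos r) as P2.
    pose proof (Rmin_l 1 (e / C)); pose proof (Rmin_r 1 (e / C)).
    pose proof (sqrt_sqrt r P1) as Q; set (q := sqrt r) in *.
    assert (Hrq : r <= q) by nra.
    assert (sqrt (sqrt a) <= sqrt (sqrt (t + 1))) by (apply sqrt_le_1_alt, sqrt_le_1_alt, Ha).
    pose proof (sqrt_pos (sqrt a)).
    apply Rle_lt_trans with (C * q).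
    - unfold C.
      assert (512 * M * sqrt (sqrt a) * q <= 512 * M * sqrt (sqrt (t + 1)) * q).
      { apply Rmult_le_compat_r; [exact P2|apply Rmult_le_compat_l; lra]. }
      assert (8 * r * M <= 8 * q * M) by (apply Rmult_le_compat_r; lra).
      nra.
    - assert (Hq : q < e / C) by lra; apply (Rmult_lt_compat_l C) in Hq; [|exact HC].
      replace (C * (e / C)) with e in Hq by (field; lra); exact Hq. }
  exists (Rmin d2 1); split; [apply Rmin_glb_lt; lra|intros s Hs Hd].
  pose proof (Rmin_l d2 1); pose proof (Rmin_r d2 1); apply Rabs_def2 in Hd.
  destruct (Rle_dec t s); [apply Key; lra|rewrite norm_minus_sym; apply Key; lra].
Qed.

Lemma mild_continuous (v0 : H) (g : R -> H) (t M : R) : (forall s, continuous g s) ->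
  (forall s, norm (g s) <= M) -> 0 < t -> continuous (mild A v0 g) t.
Proof.
  intros Cg Bg Ht; assert (HM : 0 <= M) by (specialize (Bg 0); pose proof (norm_ge_0 (g 0)); lra).
  assert (LB := inverse_sqrt_linear (A := A) (lam := lam) 0 ltac:(lra)).
  apply (continuous_plus (V := H)); [apply semigroup_continuous|].
  apply continuous_norm; intros e He.
  pose proof (sqrt_lt_R0 lam lam_pos) as Hq.
  destruct (duhamel_half_continuous g t M (e * sqrt lam) Cg Bg) as [d [Hd Dd]];
    [lra|apply Rmult_lt_0_compat; lra|].
  exists (Rmin d t); split; [apply Rmin_glb_lt; lra|intros s Hs].
  pose proof (Rmin_l d t); pose proof (Rmin_r d t).
  assert (Hs' := Hs); apply Rabs_def2 in Hs'; specialize (Dd s ltac:(lra) ltac:(lra)).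
  destruct (duhamel_half_spec g s M Cg ltac:(lra) HM (fun s _ => Bg s)) as [E1 _].
  destruct (duhamel_half_spec g t M Cg ltac:(lra) HM (fun s _ => Bg s)) as [E2 _].
  rewrite E1, E2, <- (linear_minus B _ _ LB).
  eapply Rle_lt_trans; [apply inverse_sqrt_0_bound|].
  apply (Rmult_lt_reg_r (sqrt lam)); [exact Hq|].
  unfold Rdiv; rewrite Rmult_assoc, Rinv_l, Rmult_1_r by lra; exact Dd.
Qed.

Lemma generator_semigroup_spec (d : R) (x : H) : 0 < d ->
  S d x = G (AS d x) /\ d * norm (AS d x) <= norm x.
Proof.
  intros Hd; destruct (semigroup_smoothing (A := A) d x Hd) as [z [Ez Bz]].
  assert (E : AS d x = z).
  { unfold generator_semigroup; rewrite Ez, op_inverse_opp; vec. }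
  rewrite E; split; assumption.
Qed.

Lemma generator_semigroup_eq (d : R) (x z : H) : S d x = G z -> AS d x = z.
Proof. intros E; unfold generator_semigroup; rewrite E, op_inverse_opp; vec. Qed.

Lemma generator_semigroup_linear (d : R) : 0 < d -> is_linear (AS d).
Proof.
  intros Hd; assert (LG := inverse_opp_linear (A := A)).
  split.
  - intros x y; apply generator_semigroup_eq.
    etransitivity; [exact (linear_plus _ (semigroup_linear d) _ _)|].
    etransitivity; [|symmetry; exact (linear_plus _ LG _ _)].
    f_equal; apply generator_semigroup_spec, Hd.
  - intros k x; apply generator_semigroup_eq.
    etransitivity; [exact (linear_scal _ (semigroup_linear d) _ _)|].
    etransitivity; [|symmetry; exact (linear_scal _ LG _ _)].
    f_equal; apply generator_semigroup_spec, Hd.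
  - exists (/ d); split; [apply Rinv_0_lt_compat, Hd|intros x].
    apply (Rmult_le_reg_l d); [exact Hd|].
    rewrite <- Rmult_assoc, Rinv_r, Rmult_1_l by lra; apply generator_semigroup_spec, Hd.
Qed.

Lemma generator_semigroup_add (d e : R) (x : H) : 0 < d -> 0 <= e ->
  AS d (S e x) = AS (d + e) x.
Proof.
  intros Hd He; apply generator_semigroup_eq; rewrite semigroup_add by lra.
  apply generator_semigroup_spec; lra.
Qed.

Lemma generator_semigroup_inverse_opp (d : R) (x : H) : AS d (G x) = S d x.
Proof. apply generator_semigroup_eq, semigroup_inverse_opp. Qed.

Lemma Rpower_halves (del gam : R) (k : nat) : 0 < del ->
  Rpower (del / 2 ^ k) gam = Rpower del gam * Rpower (1 / 2) gam ^ k.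
Proof.
  intros Hd; induction k as [|k IH]; [simpl; rewrite Rdiv_1_r; ring|].
  assert (0 < 2 ^ k) by (apply pow_lt; lra).
  replace (del / 2 ^ Datatypes.S k) with (del / 2 ^ k * (1 / 2)) by (simpl; field; lra).
  rewrite <- Rpower_mult_distr by (try apply Rdiv_lt_0_compat; lra).
  rewrite IH; simpl; ring.
Qed.

Lemma Rpower_half_lt_1 (gam : R) : 0 < gam -> 0 < Rpower (1 / 2) gam < 1.
Proof.
  intros Hg; split; [apply exp_pos|].
  unfold Rpower; apply Rlt_le_trans with (exp 0); [apply exp_increasing|rewrite exp_0; lra].
  assert (ln (1 / 2) < 0) by (rewrite <- ln_1; apply ln_increasing; lra); nra.
Qed.

(* With d_k = del / 2^k, the values Z_k(t) = L S(d_k) v(t - d_k) + (1 - S(d_k)) g(t)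
   satisfy L^(-1) Z_k(t) -> v(t), and Hoelder continuity of g makes them converge
   geometrically. *)
Lemma mild_generator_approx (v0 : H) (g : R -> H) (M L K gam del : R) :
  (forall s, continuous g s) -> (forall s, norm (g s) <= M) -> 0 < gam -> 0 < del -> 0 <= K ->
  (forall s t, 0 <= s <= L -> 0 <= t <= L -> s <> t ->
    norm (minus (g s) (g t)) <= K * Rpower (Rabs (s - t)) gam) ->
  forall t, del <= t <= L ->
    dom A (mild A v0 g t) /\
    forall k, norm (minus (opp (A (mild A v0 g t)))
      (plus (AS (del / 2 ^ k) (mild A v0 g (t - del / 2 ^ k)))
        (minus (g t) (S (del / 2 ^ k) (g t)))))
      <= K * Rpower del gam / (1 - Rpower (1 / 2) gam) * Rpower (1 / 2) gam ^ k.
Proof.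
  intros Cg Bg Hgam Hdel HK Hg t Ht.
  assert (HM : 0 <= M) by (specialize (Bg 0); pose proof (norm_ge_0 (g 0)); lra).
  set (v := mild A v0 g); set (d := fun k : nat => del / 2 ^ k).
  set (Z := fun k => plus (AS (d k) (v (t - d k))) (minus (g t) (S (d k) (g t)))).
  assert (P2 : forall k, 1 <= 2 ^ k) by (intros; apply pow_R1_Rle; lra).
  assert (Hd : forall k, 0 < d k <= del).
  { intros k; specialize (P2 k); unfold d; split; [apply Rdiv_lt_0_compat; lra|].
    apply (Rmult_le_reg_r (2 ^ k)); [lra|]; unfold Rdiv; rewrite Rmult_assoc, Rinv_l by lra; nra. }
  assert (dS : forall k, d (Datatypes.S k) = d k / 2).
  { intros k; specialize (P2 k); unfold d; simpl; field; lra. }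
  pose proof (Rpower_half_lt_1 gam Hgam) as Hq.
  assert (Pdel : 0 < Rpower del gam) by apply exp_pos.
  assert (St : forall k, norm (minus (Z (Datatypes.S k)) (Z k))
    <= K * Rpower del gam * Rpower (1 / 2) gam ^ k).
  { intros k; rewrite Rmult_assoc, <- Rpower_halves by exact Hdel; fold (d k).
    pose proof (Hd k) as Hdk; set (m := d k / 2).
    assert (Hm : 0 < m) by (unfold m; lra).
    assert (LA := generator_semigroup_linear m Hm).
    set (gs := fun s => g (t - d k + s)).
    assert (Cgs : forall s, continuous gs s) by (apply shift_continuous, Cg).
    assert (Ev : v (t - m) = plus (S m (v (t - d k))) (D gs m)).
    { replace (t - m) with (t - d k + m) by (unfold m; field).
      unfold v; rewrite mild_add by (try exact Cg; lra); reflexivity. }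
    (* The terms in [g t] are chosen to freeze g at time t: the increment is L S(m) applied to a
       Duhamel integral of g - g(t) over a length m. The factor 1 / m from smoothing cancels this
       length and leaves the Hoelder bound at scale [d k]. *)
    assert (E : minus (Z (Datatypes.S k)) (Z k) = AS m (D (fun s => minus (gs s) (g t)) m)).
    { rewrite (duhamel_minus gs (fun _ => g t)) by (try exact Cgs; intros; apply continuous_const).
      rewrite (linear_minus _ _ _ LA), duhamel_const by lra.
      rewrite (linear_minus (AS m) _ _ LA), !generator_semigroup_inverse_opp.
      rewrite semigroup_add by lra.
      unfold Z; rewrite dS; fold m; rewrite Ev.
      assert (E1 : AS m (plus (S m (v (t - d k))) (D gs m))
        = plus (AS (d k) (v (t - d k))) (AS m (D gs m))).
      { etransitivity; [exact (linear_plus _ LA _ _)|]; f_equal.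
        rewrite generator_semigroup_add by lra; f_equal; unfold m; field. }
      rewrite E1; replace (m + m) with (d k) by (unfold m; field); vec. }
    rewrite E; apply (Rmult_le_reg_l m); [exact Hm|].
    eapply Rle_trans; [apply generator_semigroup_spec, Hm|].
    apply duhamel_norm; [|lra|].
    - intros s; apply (continuous_minus (V := H)); [apply Cgs|apply continuous_const].
    - intros s Hs; unfold gs; eapply Rle_trans; [apply Hg; unfold m in *; lra|].
      apply Rmult_le_compat_l; [exact HK|].
      apply Rle_Rpower_l; [lra|]; unfold m in *; rewrite Rabs_left by lra; lra. }
  destruct (geometric_lim (Rpower (1 / 2) gam) (K * Rpower del gam) Z) as [l [Ll Bl]].
  - lra.
  - apply Rmult_le_pos; lra.
  - exact St.
  (* The error G Z_k - v(t) consists of (1 - S(d_k)) G g(t) and of a Duhamel integral over the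
     length d_k, each at most d_k M. *)
  - assert (El : v t = G l).
    { apply (seq_lim_unique (fun k => G (Z k)));
        [|apply linear_seq_lim; [apply inverse_opp_linear|exact Ll]].
      apply (seq_lim_of_norm _ _ (fun k => 2 * del * M * (1 / 2) ^ k)).
      { replace (Finite 0) with (Rbar_mult (2 * del * M) 0) by (simpl; f_equal; ring).
        apply is_lim_seq_scal_l, is_lim_seq_geom; rewrite Rabs_pos_eq; lra. }
      intros k; pose proof (Hd k) as Hdk.
      assert (LG := inverse_opp_linear (A := A)).
      assert (EG : G (Z k) = plus (S (d k) (v (t - d k))) (minus (G (g t)) (G (S (d k) (g t))))).
      { unfold Z; etransitivity; [exact (linear_plus _ LG _ _)|]; f_equal;
          [symmetry; apply generator_semigroup_spec; lra|apply (linear_minus G), LG]. }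
      set (gs := fun s => g (t - d k + s)).
      assert (Ev : v t = plus (S (d k) (v (t - d k))) (D gs (d k))).
      { replace t with (t - d k + d k) at 1 by ring.
        unfold v; rewrite mild_add by (try exact Cg; lra); reflexivity. }
      rewrite EG, Ev.
      apply (Rle_trans _ (norm (minus (minus (G (g t)) (S (d k) (G (g t)))) (D gs (d k))))).
      { apply Req_le; f_equal; rewrite semigroup_inverse_opp; vec. }
      eapply Rle_trans; [apply norm_minus_le|].
      rewrite (norm_minus_sym (G (g t))).
      pose proof (semigroup_inverse_opp_diff (A := A) (d k) (g t) ltac:(lra)) as B1.
      assert (B2 : norm (D gs (d k)) <= d k * M).
      { apply duhamel_norm; [apply shift_continuous, Cg|lra|intros; apply Bg]. }
      assert (B3 : d k * norm (g t) <= d k * M) by (apply Rmult_le_compat_l; [lra|apply Bg]).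
      replace (2 * del * M * (1 / 2) ^ k) with (2 * (d k * M)); [lra|].
      specialize (P2 k); unfold d, Rdiv; rewrite Rmult_1_l, pow_inv; ring. }
    rewrite El, op_inverse_opp; split; [apply inverse_opp_dom|intros k].
    replace (opp (opp l)) with l by vec; exact (Bl k).
Qed.

(** A locally uniform limit of continuous functions: the rate in [mild_generator_approx] is the same
    for all times in [del, L], and del = t / 2 leaves room on both sides of t. *)
Lemma mild_generator_continuous (v0 : H) (g : R -> H) (M L K gam : R) :
  (forall s, continuous g s) -> (forall s, norm (g s) <= M) -> 0 < gam -> 0 <= K ->
  (forall s t, 0 <= s <= L -> 0 <= t <= L -> s <> t ->
    norm (minus (g s) (g t)) <= K * Rpower (Rabs (s - t)) gam) ->
  forall t, 0 < t < L -> continuous (fun t => A (mild A v0 g t)) t.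
Proof.
  intros Cg Bg Hgam HK Hg t Ht; set (del := t / 2); assert (Hdel : 0 < del) by (unfold del; lra).
  assert (Edel : t = 2 * del) by (unfold del; field).
  pose proof (fun s Hs => proj2 (mild_generator_approx v0 g M L K gam del Cg Bg Hgam Hdel HK Hg s Hs)) as Ap.
  pose proof (Rpower_half_lt_1 gam Hgam) as Hq.
  apply continuous_norm; intros e He.
  destruct (pow_small (Rpower (1 / 2) gam) (K * Rpower del gam / (1 - Rpower (1 / 2) gam)) (e / 3))
    as [k Hk]; [lra|lra|specialize (Hk k (le_n _))].
  set (d := del / 2 ^ k) in *.
  assert (P2 : 1 <= 2 ^ k) by (apply pow_R1_Rle; lra).
  assert (Hd : 0 < d <= del).
  { unfold d; split; [apply Rdiv_lt_0_compat; lra|].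
    apply (Rmult_le_reg_r (2 ^ k)); [lra|]; unfold Rdiv; rewrite Rmult_assoc, Rinv_l by lra; nra. }
  set (Z := fun t => plus (AS d (mild A v0 g (t - d))) (minus (g t) (S d (g t)))).
  assert (CZ : continuous Z t).
  { apply (continuous_plus (V := H)).
    - apply (continuous_comp (fun t => mild A v0 g (t - d)) (AS d));
        [|exact (linear_cont (AS d) _ (generator_semigroup_linear d (proj1 Hd)))].
      apply (continuous_comp (fun t => t - d) (mild A v0 g)).
      + apply: ex_derive_continuous; auto_derive; trivial.
      + apply (mild_continuous v0 g _ M Cg Bg); unfold del in *; lra.
    - apply (continuous_minus (V := H)); [apply Cg|].
      apply (continuous_comp g (S d)); [apply Cg|exact (linear_cont (S d) _ (semigroup_linear d))]. }
  destruct (proj1 (continuous_norm _ _) CZ (e / 3) ltac:(lra)) as [r [Hr Dr]].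
  exists (Rmin r (Rmin del (L - t))); split.
  { repeat apply Rmin_glb_lt; lra. }
  intros s Hs; pose proof (Rmin_l r (Rmin del (L - t))); pose proof (Rmin_r r (Rmin del (L - t))).
  pose proof (Rmin_l del (L - t)); pose proof (Rmin_r del (L - t)).
  specialize (Dr s ltac:(lra)); apply Rabs_def2 in Hs.
  assert (As : norm (minus (opp (A (mild A v0 g s))) (Z s)) < e / 3).
  { eapply Rle_lt_trans; [exact (Ap s ltac:(lra) k)|exact Hk]. }
  assert (At : norm (minus (opp (A (mild A v0 g t))) (Z t)) < e / 3).
  { eapply Rle_lt_trans; [exact (Ap t ltac:(lra) k)|exact Hk]. }
  set (x := A (mild A v0 g s)) in *; set (y := A (mild A v0 g t)) in *.
  apply (Rle_lt_trans _ (norm (minus (opp x) (opp y)))).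
  { rewrite <- norm_opp_H; apply Req_le; f_equal; vec. }
  eapply Rle_lt_trans; [apply (norm_minus_trans (Z s))|].
  pose proof (norm_minus_trans (Z t) (Z s) (opp y)) as T.
  rewrite (norm_minus_sym (Z t)) in T; lra.
Qed.

(** With v(a) = G z, the increment v(b) - v(a) is exactly the Duhamel integral over [a, b] of g - z
    = g + A v(a), which is close to the constant c by continuity of A v. Both one-sided quotients
    are handled by taking a as the earlier time. *)
Lemma mild_is_derive (v0 : H) (g : R -> H) (M L K gam : R) :
  (forall s, continuous g s) -> (forall s, norm (g s) <= M) -> 0 < gam -> 0 <= K ->
  (forall s t, 0 <= s <= L -> 0 <= t <= L -> s <> t ->
    norm (minus (g s) (g t)) <= K * Rpower (Rabs (s - t)) gam) ->
  forall t, 0 < t < L ->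
    is_derive (mild A v0 g) t (plus (A (mild A v0 g t)) (g t)).
Proof.
  intros Cg Bg Hgam HK Hg t Ht.
  pose proof (mild_generator_continuous v0 g M L K gam Cg Bg Hgam HK Hg t Ht) as CA'.
  set (v := mild A v0 g) in *; set (c := plus (A (v t)) (g t)).
  assert (Dv : forall s, 0 < s <= L -> dom A (v s)).
  { intros s Hs; apply (mild_generator_approx v0 g M L K gam s); try assumption; lra. }
  apply is_derive_norm; intros e He.
  destruct (proj1 (continuous_norm _ _) CA' (e / 4) ltac:(lra)) as [d1 [Hd1 D1]].
  destruct (proj1 (continuous_norm _ _) (Cg t) (e / 4) ltac:(lra)) as [d2 [Hd2 D2]].
  destruct (semigroup_continuous_0 (A := A) c (e / 2) ltac:(lra)) as [d3 [Hd3 D3]].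
  set (r := Rmin (Rmin d1 d2) (Rmin d3 (Rmin t (L - t)))).
  assert (Hr : 0 < r) by (unfold r; repeat apply Rmin_glb_lt; lra).
  assert (Rr : r <= d1 /\ r <= d2 /\ r <= d3 /\ r <= t /\ r <= L - t).
  { unfold r; pose proof (Rmin_l (Rmin d1 d2) (Rmin d3 (Rmin t (L - t))));
    pose proof (Rmin_r (Rmin d1 d2) (Rmin d3 (Rmin t (L - t)))).
    pose proof (Rmin_l d1 d2); pose proof (Rmin_r d1 d2).
    pose proof (Rmin_l d3 (Rmin t (L - t))); pose proof (Rmin_r d3 (Rmin t (L - t))).
    pose proof (Rmin_l t (L - t)); pose proof (Rmin_r t (L - t)); lra. }
  assert (Key : forall a b, a <= b -> b - a < r -> Rabs (a - t) < r -> Rabs (b - t) < r ->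
    (forall s, a <= s <= b -> Rabs (s - t) < r) ->
    norm (minus (minus (v b) (v a)) (scal (b - a) c)) <= e * (b - a)).
  { intros a b Hab Hba Ha Hb Hs.
    assert (Ha' := Ha); assert (Hb' := Hb); apply Rabs_def2 in Ha'; apply Rabs_def2 in Hb'.
    set (z := opp (A (v a))); set (gs := fun s => g (a + s)).
    assert (Cgs : forall s, continuous gs s) by (apply shift_continuous, Cg).
    assert (Ez : v a = G z) by (symmetry; apply inverse_opp_op, Dv; lra).
    assert (Ev : v b = plus (S (b - a) (v a)) (D gs (b - a))).
    { replace b with (a + (b - a)) at 1 by ring.
      unfold v; rewrite mild_add by (try exact Cg; lra); reflexivity. }
    assert (E : minus (v b) (v a) = D (fun s => minus (gs s) z) (b - a)).
    { rewrite (duhamel_minus gs (fun _ => z)) by (try exact Cgs; intros; apply continuous_const).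
      rewrite duhamel_const by lra; rewrite Ev, Ez, semigroup_inverse_opp; vec. }
    rewrite E; replace (e * (b - a)) with ((b - a) * (2 * (e / 2))) by field.
    apply duhamel_near_const; [|lra| |].
    - intros s; apply (continuous_minus (V := H)); [apply Cgs|apply continuous_const].
    - intros s Hsb; unfold gs, z, c.
      specialize (D1 a ltac:(lra)).
      assert (Has : Rabs (a + s - t) < r) by (apply Hs; lra).
      specialize (D2 (a + s) ltac:(lra)).
      apply (Rle_trans _ (norm (plus (minus (g (a + s)) (g t)) (minus (A (v a)) (A (v t)))))).
      { apply Req_le; f_equal; vec. }
      eapply Rle_trans; [apply norm_plus_le|].
      cbv beta in D1; lra.
    - intros s Hsb; left; apply D3; lra. }
  exists r; split; [exact Hr|intros s Hs].
  assert (Hs' := Hs); apply Rabs_def2 in Hs'.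
  assert (R0 : Rabs (t - t) < r) by (rewrite Rminus_diag_eq, Rabs_R0; auto).
  destruct (Rle_dec t s) as [Hts|Hts].
  - rewrite Rabs_pos_eq by lra; apply Key; try assumption; try lra.
    intros x Hx; apply Rabs_def1; lra.
  - rewrite Rabs_left by lra.
    apply (Rle_trans _ (norm (minus (minus (v t) (v s)) (scal (t - s) c)))).
    { rewrite <- norm_opp_H; apply Req_le; f_equal; vec. }
    replace (e * - (s - t)) with (e * (t - s)) by ring.
    apply Key; try assumption; try lra.
    intros x Hx; apply Rabs_def1; lra.
Qed.

End Regularity.

(** * Local existence *)

(** Local, since [h1] and [h2] are only locally bounded. Equal times have their own clause because
    [Rpower 0 theta] is 1, so that the Hoelder term would not vanish there. *)
Definition locally_lip {H : HilbertSpace} (theta T : R) (Phi : R -> H -> H) (t0 : R) (w0 : H) : Prop :=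
  exists del K, 0 < del /\ 0 <= K /\
    forall t t' w w', 0 <= t <= T -> 0 <= t' <= T -> Rabs (t - t0) < del -> Rabs (t' - t0) < del ->
      norm (minus w w0) < del -> norm (minus w' w0) < del ->
      (t <> t' -> norm (minus (Phi t w) (Phi t' w'))
        <= K * norm (minus w w') + K * Rpower (Rabs (t - t')) theta) /\
      norm (minus (Phi t w) (Phi t w')) <= K * norm (minus w w').

Lemma Rpower_small (theta e : R) : 0 < theta -> 0 < e ->
  exists d, 0 < d /\ forall h, 0 < h < d -> Rpower h theta < e.
Proof.
  intros Ht He; exists (Rpower e (/ theta)); split; [apply exp_pos|intros h Hh].
  replace e with (Rpower (Rpower e (/ theta)) theta).
  - unfold Rpower at 1 2; apply exp_increasing, Rmult_lt_compat_l; [exact Ht|apply ln_increasing; apply Hh].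
  - rewrite Rpower_mult, Rinv_l, Rpower_1 by lra; reflexivity.
Qed.

Lemma Rpower_le_exponent (h x y : R) : 0 < h <= 1 -> x <= y -> Rpower h y <= Rpower h x.
Proof.
  intros Hh Hxy; unfold Rpower.
  assert (ln h <= 0) by (rewrite <- ln_1; apply Rcomplements.ln_le; lra).
  destruct (Req_dec (y * ln h) (x * ln h)) as [E|E]; [rewrite E; lra|].
  left; apply exp_increasing; nra.
Qed.

Lemma quarter_power (h : R) : 0 < h -> sqrt (sqrt h) = Rpower h (1 / 4).
Proof.
  intros Hh; rewrite <- !Rpower_sqrt by (try apply sqrt_lt_R0; exact Hh).
  rewrite Rpower_mult; f_equal; field.
Qed.

(** Extends data on [0, T] by constants to the whole line, where the lemmas on Duhamel integrals
    require continuity and boundedness. *)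
Definition clamp (T t : R) : R := Rmax 0 (Rmin t T).

Lemma clamp_range (T t : R) : 0 <= T -> 0 <= clamp T t <= T.
Proof.
  intros HT; unfold clamp; split; [apply Rmax_l|apply Rmax_lub; [exact HT|apply Rmin_r]].
Qed.

Lemma clamp_id (T t : R) : 0 <= t <= T -> clamp T t = t.
Proof. intros Ht; unfold clamp; rewrite Rmin_left, Rmax_right by lra; reflexivity. Qed.

Lemma clamp_lipschitz (T s t : R) : Rabs (clamp T s - clamp T t) <= Rabs (s - t).
Proof.
  unfold clamp, Rmax, Rmin.
  destruct (Rle_dec s T), (Rle_dec t T);
    repeat match goal with |- context [Rle_dec 0 ?b] => destruct (Rle_dec 0 b) end;
    apply Rabs_le; pose proof (Rle_abs (s - t)); pose proof (Rle_abs (- (s - t)));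
    rewrite Rabs_Ropp in *; lra.
Qed.

Section LocalExistence.

Context {H : HilbertSpace} {A : LinearOperator H} {lam : R}
  {CA : coercive_selfadjoint A lam}.

Let lam_pos : 0 < lam := coercive_pos.

Local Notation S := (semigroup A).
Local Notation B := (inverse_sqrt A 0).
Local Notation D := (duhamel A).
Local Notation DV := (duhamel_half A).

Lemma duhamel_half_minus (f g : R -> H) (t M e : R) :
  (forall s, continuous f s) -> (forall s, continuous g s) ->
  (forall s, norm (f s) <= M) -> (forall s, norm (g s) <= M) -> 0 <= t ->
  (forall s, norm (minus (f s) (g s)) <= e) ->
  norm (minus (DV f t) (DV g t)) <= 8 * sqrt t * e.
Proof.
  intros Cf Cg Bf Bg Ht Be.
  assert (HM : 0 <= M) by (specialize (Bg 0); pose proof (norm_ge_0 (g 0)); lra).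
  assert (He : 0 <= e) by (specialize (Be 0); pose proof (norm_ge_0 (minus (f 0) (g 0))); lra).
  assert (LB := inverse_sqrt_linear (A := A) (lam := lam) 0 ltac:(lra)).
  destruct (duhamel_half_spec (A := A) f t M Cf Ht HM (fun s _ => Bf s)) as [E1 _].
  destruct (duhamel_half_spec (A := A) g t M Cg Ht HM (fun s _ => Bg s)) as [E2 _].
  assert (Cfg : forall s, continuous (fun s => minus (f s) (g s)) s)
    by (intros s; apply (continuous_minus (V := H)); auto).
  destruct (duhamel_half_spec (A := A) _ t e Cfg Ht He (fun s _ => Be s)) as [E3 [B3 _]].
  assert (E : minus (DV f t) (DV g t) = DV (fun s => minus (f s) (g s)) t).
  { apply (inverse_sqrt_injective (A := A)); rewrite (linear_minus _ _ _ LB), <- E1, <- E2.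
    etransitivity; [|exact E3]; symmetry; apply duhamel_minus; assumption. }
  rewrite E; exact B3.
Qed.

Lemma mild_inverse_sqrt (w0 : H) (g : R -> H) (t M : R) :
  (forall s, continuous g s) -> (forall s, norm (g s) <= M) -> 0 <= t ->
  mild A (B w0) g t = B (plus (S t w0) (DV g t)).
Proof.
  intros Cg Bg Ht.
  assert (HM : 0 <= M) by (specialize (Bg 0); pose proof (norm_ge_0 (g 0)); lra).
  assert (LB := inverse_sqrt_linear (A := A) (lam := lam) 0 ltac:(lra)).
  symmetry; etransitivity; [exact (linear_plus _ LB _ _)|]; unfold mild; f_equal.
  - symmetry; apply commuting_inverse_sqrt_comm; [lra|apply semigroup_commuting].
  - symmetry; apply (duhamel_half_spec g t M); auto.
Qed.

Context (theta T : R) (Phi : R -> H -> H) (w0 : H).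
Hypothesis (theta_pos : 0 < theta).
Hypothesis (T_pos : 0 < T).
Hypothesis (Phi_lip : locally_lip theta T Phi 0 w0).

(* The unknown is w = (-A)^(1/2) u; the last clause is the mild formulation for u = B w. *)
Lemma picard_solution : exists T0 M K (w : R -> H),
  0 < T0 <= T /\ T0 <= 1 /\ 0 <= K /\ (forall t, continuous w t) /\
  (forall s, continuous (fun s => Phi (clamp T0 s) (w s)) s) /\
  (forall s, norm (Phi (clamp T0 s) (w s)) <= M) /\
  (forall s t, 0 <= s <= T0 -> 0 <= t <= T0 -> s <> t ->
    norm (minus (Phi s (w s)) (Phi t (w t)))
      <= K * norm (minus (w s) (w t)) + K * Rpower (Rabs (s - t)) theta) /\
  forall t, 0 <= t <= T0 -> w t = plus (S t w0) (DV (fun s => Phi (clamp T0 s) (w s)) t).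
Proof.
  destruct Phi_lip as (del & K & Hdel & HK & Lip).
  (* A bound for [Phi] on the neighbourhood, from the Lipschitz estimate between a point of it and
     [(0, w0)]. *)
  set (M := norm (Phi 0 w0) + K * del + K * Rpower del theta).
  assert (HP : 0 < Rpower del theta) by apply exp_pos.
  assert (HM : 0 <= M).
  { unfold M; pose proof (norm_ge_0 (Phi 0 w0)).
    assert (0 <= K * del) by (apply Rmult_le_pos; lra).
    assert (0 <= K * Rpower del theta) by (apply Rmult_le_pos; lra). lra. }
  set (r := del / 2).
  destruct (semigroup_continuous_0 (A := A) w0 (r / 2)) as [d1 [Hd1 D1]]; [unfold r; lra|].
  (* In view of the bound 8 sqrt t M on the Duhamel term, the first quantity keeps the ball of
     radius [r] invariant and the second makes the contraction factor 8 sqrt t K at most 1/2. *)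
  destruct (sqrt_small (Rmin (r / (16 * (M + 1))) (/ (16 * (K + 1))))) as [d2 [Hd2 D2]].
  { apply Rmin_glb_lt; [unfold r; apply Rdiv_lt_0_compat; lra|apply Rinv_0_lt_compat; lra]. }
  set (T0 := Rmin (Rmin T 1) (Rmin r (Rmin (d1 / 2) (d2 / 2)))).
  assert (HT0 : 0 < T0) by (unfold T0, r; repeat apply Rmin_glb_lt; lra).
  assert (RT0 : T0 <= T /\ T0 <= 1 /\ T0 <= r /\ T0 < d1 /\ T0 < d2).
  { unfold T0; pose proof (Rmin_l (Rmin T 1) (Rmin r (Rmin (d1 / 2) (d2 / 2)))).
    pose proof (Rmin_r (Rmin T 1) (Rmin r (Rmin (d1 / 2) (d2 / 2)))).
    pose proof (Rmin_l T 1); pose proof (Rmin_r T 1).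
    pose proof (Rmin_l r (Rmin (d1 / 2) (d2 / 2))); pose proof (Rmin_r r (Rmin (d1 / 2) (d2 / 2))).
    pose proof (Rmin_l (d1 / 2) (d2 / 2)); pose proof (Rmin_r (d1 / 2) (d2 / 2)). lra. }
  destruct RT0 as (RT & R1 & Rr & Rd1 & Rd2).
  set (c := clamp T0).
  assert (Hc : forall t, 0 <= c t <= T0) by (intros; apply clamp_range; lra).
  assert (Sq : forall t, 0 <= t <= T0 -> 8 * sqrt t * M <= r / 2 /\ 8 * sqrt t * K <= 1 / 2).
  { intros t Ht; specialize (D2 t ltac:(lra)); pose proof (sqrt_pos t).
    pose proof (Rmin_l (r / (16 * (M + 1))) (/ (16 * (K + 1)))).
    pose proof (Rmin_r (r / (16 * (M + 1))) (/ (16 * (K + 1)))). split.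
    - assert (Hs : sqrt t < r / (16 * (M + 1))) by lra.
      apply (Rmult_lt_compat_r (16 * (M + 1))) in Hs; [|lra].
      replace (r / (16 * (M + 1)) * (16 * (M + 1))) with r in Hs by (field; lra); nra.
    - assert (Hs : sqrt t < / (16 * (K + 1))) by lra.
      apply (Rmult_lt_compat_r (16 * (K + 1))) in Hs; [|lra].
      rewrite Rinv_l in Hs by lra; nra. }
  assert (Near : forall t, Rabs (c t - 0) < del).
  { intros t; specialize (Hc t); rewrite Rminus_0_r, Rabs_pos_eq by lra; unfold r in *; lra. }
  assert (In : forall t, 0 <= c t <= T) by (intros t; specialize (Hc t); lra).
  set (inball := fun w : R -> H => forall t, norm (minus (w t) w0) <= r).
  set (g := fun (w : R -> H) s => Phi (c s) (w s)).
  assert (gB : forall w, inball w -> forall s, norm (g w s) <= M).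
  { intros w Bw s; unfold g.
    assert (Bd : norm (minus (Phi (c s) (w s)) (Phi 0 w0)) <= K * del + K * Rpower del theta).
    { assert (Ws : norm (minus (w s) w0) < del) by (specialize (Bw s); unfold r in Bw; lra).
      assert (W0 : norm (minus w0 w0) < del) by (rewrite norm_minus_diag; exact Hdel).
      assert (Z0 : Rabs (0 - 0) < del) by (rewrite Rminus_diag_eq, Rabs_R0; auto).
      destruct (Lip (c s) 0 (w s) w0 (In s) ltac:(lra) (Near s) Z0 Ws W0) as [L1 L2].
      assert (K * norm (minus (w s) w0) <= K * del) by (apply Rmult_le_compat_l; lra).
      destruct (Req_dec (c s) 0) as [Z|N].
      - rewrite Z in *; assert (0 <= K * Rpower del theta) by (apply Rmult_le_pos; lra); lra.
      - specialize (L1 N); eapply Rle_trans; [exact L1|apply Rplus_le_compat; [assumption|]].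
        apply Rmult_le_compat_l; [exact HK|apply Rle_Rpower_l; [lra|]].
        specialize (Near s); split; [apply Rabs_pos_lt; lra|lra]. }
    pose proof (norm_le_minus (Phi (c s) (w s)) (Phi 0 w0)); unfold M; lra. }
  assert (gL : forall w, inball w -> forall s t, c s <> c t ->
    norm (minus (g w s) (g w t)) <= K * norm (minus (w s) (w t)) + K * Rpower (Rabs (c s - c t)) theta).
  { intros w Bw s t N; apply Lip; auto;
      [specialize (Bw s)|specialize (Bw t)]; unfold r in Bw; lra. }
  assert (gD : forall w w', inball w -> inball w' -> forall s,
    norm (minus (g w s) (g w' s)) <= K * norm (minus (w s) (w' s))).
  { intros w w' Bw Bw' s; apply (Lip (c s) (c s)); auto;
      [specialize (Bw s)|specialize (Bw' s)]; unfold r in *; lra. }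
  assert (gC : forall w, inball w -> (forall t, continuous w t) -> forall s, continuous (g w) s).
  { intros w Bw Cw s; apply continuous_norm; intros e He.
    destruct (proj1 (continuous_norm _ _) (Cw s) (e / 2 / (K + 1))) as [e1 [He1 E1]].
    { apply Rdiv_lt_0_compat; lra. }
    destruct (Rpower_small theta (e / 2 / (K + 1)) theta_pos) as [e2 [He2 E2]].
    { apply Rdiv_lt_0_compat; lra. }
    exists (Rmin e1 e2); split; [apply Rmin_glb_lt; assumption|intros s' Hs].
    pose proof (Rmin_l e1 e2); pose proof (Rmin_r e1 e2).
    specialize (E1 s' ltac:(lra)).
    assert (Hh : K * norm (minus (w s') (w s)) < e / 2).
    { apply Rle_lt_trans with ((K + 1) * norm (minus (w s') (w s)));
        [apply Rmult_le_compat_r; [apply norm_ge_0|lra]|].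
      apply (Rmult_lt_compat_l (K + 1)) in E1; [|lra].
      replace ((K + 1) * (e / 2 / (K + 1))) with (e / 2) in E1 by (field; lra); exact E1. }
    destruct (Req_dec (c s') (c s)) as [Z|N].
    - assert (Ez : norm (minus (g w s') (g w s)) <= K * norm (minus (w s') (w s))).
      { unfold g; rewrite Z; apply (Lip (c s) (c s)); auto;
          [specialize (Bw s')|specialize (Bw s)]; unfold r in *; lra. }
      lra.
    - pose proof (gL w Bw s' s N) as L.
      pose proof (clamp_lipschitz T0 s' s) as Cl; fold c in Cl.
      specialize (E2 (Rabs (c s' - c s)) ltac:(split; [apply Rabs_pos_lt; lra|lra])).
      assert (K * Rpower (Rabs (c s' - c s)) theta < e / 2); [|lra].
      set (p := Rpower (Rabs (c s' - c s)) theta) in *.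
      assert (0 < p) by apply exp_pos.
      apply Rle_lt_trans with ((K + 1) * p); [apply Rmult_le_compat_r; lra|].
      apply (Rmult_lt_compat_l (K + 1)) in E2; [|lra].
      replace ((K + 1) * (e / 2 / (K + 1))) with (e / 2) in E2 by (field; lra); exact E2. }
  (* The clamp makes each iterate a continuous function on the whole line, constant outside
     [0, T0]. *)
  set (step := fun (w : R -> H) t => plus (S (c t) w0) (DV (g w) (c t))).
  assert (stepB : forall w, inball w -> (forall t, continuous w t) -> inball (step w)).
  { intros w Bw Cw t; unfold step; specialize (Hc t).
    destruct (duhamel_half_spec (A := A) (g w) (c t) M (gC w Bw Cw) ltac:(lra) HM
      (fun s _ => gB w Bw s)) as [_ [Bv _]].
    destruct (Sq (c t) Hc) as [Q _]; specialize (D1 (c t) ltac:(lra)).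
    apply (Rle_trans _ (norm (plus (minus (S (c t) w0) w0) (DV (g w) (c t)))));
      [apply Req_le; f_equal; vec|].
    eapply Rle_trans; [apply norm_plus_le|lra]. }
  assert (Cc : forall t, continuous c t).
  { intros t; apply filterlim_locally; intros [e He]; exists (mkposreal e He); intros s Hs.
    eapply Rle_lt_trans; [apply clamp_lipschitz|exact Hs]. }
  assert (stepC : forall w, inball w -> (forall t, continuous w t) -> forall t, continuous (step w) t).
  { intros w Bw Cw t; apply (continuous_plus (V := H)).
    - apply (continuous_comp c (fun s => S s w0)); [apply Cc|apply semigroup_continuous].
    - apply continuous_norm; intros e He; specialize (Hc t) as Hct.
      destruct (duhamel_half_continuous (A := A) (g w) (c t) M e (gC w Bw Cw) (gB w Bw) ltac:(lra) He)
        as [d [Hd Dd]].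
      exists d; split; [exact Hd|intros s Hs; apply Dd; [apply Hc|]].
      eapply Rle_lt_trans; [apply clamp_lipschitz|exact Hs]. }
  assert (stepL : forall w w' e, inball w -> (forall t, continuous w t) -> inball w' ->
    (forall t, continuous w' t) -> 0 <= e -> (forall s, norm (minus (w s) (w' s)) <= e) ->
    forall t, norm (minus (step w t) (step w' t)) <= 1 / 2 * e).
  { intros w w' e Bw Cw Bw' Cw' He Dw t; specialize (Hc t).
    apply (Rle_trans _ (norm (minus (DV (g w) (c t)) (DV (g w') (c t)))));
      [apply Req_le; f_equal; unfold step; vec|].
    eapply Rle_trans; [apply (duhamel_half_minus (g w) (g w') (c t) M (K * e)); auto; [lra|]|].
    - intros s; eapply Rle_trans; [apply gD; assumption|apply Rmult_le_compat_l; auto].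
    - destruct (Sq (c t) Hc) as [_ Q].
      replace (8 * sqrt (c t) * (K * e)) with (8 * sqrt (c t) * K * e) by ring.
      apply Rmult_le_compat_r; assumption. }
  set (W := fun k => Nat.iter k step (fun _ => w0)).
  assert (WI : forall k, inball (W k) /\ forall t, continuous (W k) t).
  { induction k as [|k [IB IC]]; simpl.
    - split; [intros t; unfold W; simpl; rewrite norm_minus_diag; unfold r; lra|].
      intros t; apply continuous_const.
    - split; [apply stepB; assumption|apply stepC; assumption]. }
  assert (WD : forall k t, norm (minus (W (Datatypes.S k) t) (W k t)) <= r * (1 / 2) ^ k).
  { induction k as [|k IH]; intros t.
    - simpl (_ ^ _); rewrite Rmult_1_r; apply (proj1 (WI 1%nat)).
    - replace (r * (1 / 2) ^ Datatypes.S k) with (1 / 2 * (r * (1 / 2) ^ k)) by (simpl; ring).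
      apply (stepL (W (Datatypes.S k)) (W k)); try apply WI; [|exact IH].
      apply Rmult_le_pos; [unfold r; lra|apply pow_le; lra]. }
  assert (Ex : forall t, exists l, filterlim (fun k => W k t) eventually (locally l) /\
    forall n, norm (minus l (W n t)) <= r / (1 - 1 / 2) * (1 / 2) ^ n).
  { intros t; apply geometric_lim; [lra|unfold r; lra|intros k; apply WD]. }
  destruct (functional_choice _ Ex) as [w Hw]; clear Ex.
  assert (Hw2 : forall t n, norm (minus (w t) (W n t)) <= 2 * r * (1 / 2) ^ n).
  { intros t n; eapply Rle_trans; [apply Hw|apply Req_le; field]. }
  assert (wB : inball w).
  { intros t; apply (seq_lim_norm_le (fun k => W k t)); [apply Hw|exists 0%nat; intros n _].
    apply WI. }
  assert (Sm : forall e, 0 < e -> exists n, 2 * r * (1 / 2) ^ n < e).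
  { intros e He; destruct (pow_small (1 / 2) (2 * r) e) as [n Hn]; [lra|exact He|].
    exists n; apply Hn; auto. }
  assert (wC : forall t, continuous w t).
  { intros t; apply continuous_norm; intros e He; destruct (Sm (e / 3) ltac:(lra)) as [n Hn].
    destruct (proj1 (continuous_norm _ _) (proj2 (WI n) t) (e / 3) ltac:(lra)) as [d [Hd Dd]].
    exists d; split; [exact Hd|intros s Hs; specialize (Dd s Hs)].
    pose proof (Hw2 s n); pose proof (Hw2 t n).
    pose proof (norm_minus_trans (W n s) (w s) (w t)).
    pose proof (norm_minus_trans (W n t) (W n s) (w t)).
    rewrite (norm_minus_sym (W n t)) in H3; lra. }
  exists T0, M, K, w.
  split; [lra|]; split; [lra|]; split; [exact HK|]; split; [exact wC|].
  split; [exact (gC w wB wC)|]; split; [exact (gB w wB)|]; split.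
  - intros s t Hs Ht N.
    pose proof (gL w wB s t) as L; unfold g, c in L; rewrite !clamp_id in L by assumption.
    exact (L N).
  - intros t Ht; change (w t = plus (S t w0) (DV (g w) t)).
    assert (Ec : c t = t) by (apply clamp_id; exact Ht).
    rewrite <- Ec at 2 3; change (w t = step w t).
    apply eq_of_norm_small; intros e He; destruct (Sm (e / 2) ltac:(lra)) as [n Hn].
    assert (P : 0 <= 2 * r * (1 / 2) ^ n)
      by (apply Rmult_le_pos; [unfold r; lra|apply pow_le; lra]).
    pose proof (stepL (W n) w (2 * r * (1 / 2) ^ n) (proj1 (WI n)) (proj2 (WI n)) wB wC P) as L.
    specialize (L ltac:(intros s; rewrite norm_minus_sym; apply Hw2) t).
    pose proof (Hw2 t (Datatypes.S n)) as Q; simpl ((1 / 2) ^ _) in Q.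
    change (W (Datatypes.S n) t) with (step (W n) t) in Q.
    pose proof (norm_minus_trans (step (W n) t) (w t) (step w t)); nra.
Qed.

(** For fixed t > 0 the equation is restarted at a = t / 2. On [a, T0] the Picard solution is
    Hoelder of exponent 1/4, so the right-hand side is Hoelder of exponent min(1/4, theta) and the
    regularity theory applies at time t - a > 0. *)
Lemma local_existence : exists T0 (w : R -> H),
  0 < T0 <= T /\ (forall t, continuous w t) /\ w 0 = w0 /\
  forall t, 0 < t < T0 ->
    dom A (B (w t)) /\ continuous (fun t => A (B (w t))) t /\
    continuous (fun t => Phi t (w t)) t /\
    is_derive (fun t => B (w t)) t (plus (A (B (w t))) (Phi t (w t))).
Proof.
  destruct picard_solution as (T0 & M & K & w & HT & HT1 & HK & Cw & Cg & Bg & Lg & Ew).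
  set (g := fun s => Phi (clamp T0 s) (w s)) in *.
  change (forall s, continuous g s) in Cg; change (forall s, norm (g s) <= M) in Bg.
  assert (HM : 0 <= M) by (specialize (Bg 0); pose proof (norm_ge_0 (g 0)); lra).
  exists T0, w; split; [exact HT|split; [exact Cw|split]].
  { rewrite Ew by lra; rewrite semigroup_nonpos by lra.
    assert (E : DV g 0 = zero).
    { apply norm_zero_eq.
      destruct (duhamel_half_spec (A := A) g 0 M Cg ltac:(lra) HM (fun s _ => Bg s)) as [_ [Q _]].
      rewrite sqrt_0 in Q; pose proof (norm_ge_0 (DV g 0)); lra. }
    rewrite E; vec. }
  intros t Ht; set (a := t / 2); set (L := T0 - a).
  assert (Ha : 0 < a) by (unfold a; lra).
  set (ga := fun s => g (a + s)).
  (* One term for S(q) w0 - S(p) w0 with p >= a, two for the terms of [duhamel_half_holder]; as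
     times are at most 1, all powers of q - p are dominated by the fourth root. *)
  set (C := norm w0 / a + 512 * M + 8 * M).
  set (gam := Rmin (1 / 4) theta).
  assert (Hgam : 0 < gam) by (unfold gam; apply Rmin_glb_lt; lra).
  assert (HC : 0 <= C).
  { unfold C; pose proof (Rdiv_le_0_compat _ _ (norm_ge_0 w0) Ha); lra. }
  assert (wH : forall p q, a <= p -> p < q -> q <= T0 ->
    norm (minus (w q) (w p)) <= C * Rpower (q - p) (1 / 4)).
  { intros p q Hp Hpq Hq; rewrite !Ew by lra; fold g.
    pose proof (duhamel_half_holder (A := A) g p q M Cg Bg ltac:(lra)) as B1.
    pose proof (semigroup_time_lipschitz (A := A) (q - p) p w0 ltac:(lra) ltac:(lra)) as B2.
    rewrite semigroup_add in B2 by lra; replace (q - p + p) with q in B2 by ring.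
    apply (Rle_trans _ (norm (plus (minus (S q w0) (S p w0)) (minus (DV g q) (DV g p)))));
      [apply Req_le; f_equal; vec|].
    eapply Rle_trans; [apply norm_plus_le|].
    rewrite <- quarter_power by lra.
    set (h := q - p) in *; assert (Hh : 0 < h <= 1) by (unfold h; lra).
    pose proof (sqrt_lt_R0 h ltac:(lra)) as P1; pose proof (sqrt_sqrt h ltac:(lra)) as Q1.
    assert (S1 : sqrt h <= 1) by (rewrite <- sqrt_1; apply sqrt_le_1_alt; lra).
    pose proof (sqrt_lt_R0 (sqrt h) P1) as P2; pose proof (sqrt_sqrt (sqrt h) ltac:(lra)) as Q2.
    assert (S2 : sqrt (sqrt h) <= 1) by (rewrite <- sqrt_1; apply sqrt_le_1_alt; lra).
    assert (S3 : sqrt (sqrt p) <= 1).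
    { rewrite <- sqrt_1; apply sqrt_le_1_alt; rewrite <- sqrt_1; apply sqrt_le_1_alt; lra. }
    set (k := sqrt (sqrt h)) in *; pose proof (norm_ge_0 w0).
    assert (Hk : h <= k) by nra. assert (Hk2 : sqrt h <= k) by nra.
    assert (T1 : norm (minus (S q w0) (S p w0)) <= norm w0 / a * k).
    { apply (Rmult_le_reg_l a); [exact Ha|].
      replace (a * (norm w0 / a * k)) with (k * norm w0) by (field; lra).
      apply Rle_trans with (p * norm (minus (S q w0) (S p w0))).
      - apply Rmult_le_compat_r; [apply norm_ge_0|exact Hp].
      - eapply Rle_trans; [exact B2|apply Rmult_le_compat_r; assumption]. }
    assert (T2 : 512 * M * sqrt (sqrt p) * k <= 512 * M * k).
    { apply Rmult_le_compat_r; [lra|]; pose proof (sqrt_pos (sqrt p)); nra. }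
    assert (T3 : 8 * sqrt h * M <= 8 * M * k) by nra.
    unfold C; lra. }
  assert (Hg : forall x y, 0 <= x <= L -> 0 <= y <= L -> x <> y ->
    norm (minus (ga x) (ga y)) <= K * (C + 1) * Rpower (Rabs (x - y)) gam).
  { intros x y Hx Hy N; unfold ga, g; unfold L in *.
    rewrite !clamp_id by lra.
    eapply Rle_trans; [apply Lg; lra|].
    replace (a + x - (a + y)) with (x - y) by ring.
    assert (Hr : 0 < Rabs (x - y) <= 1).
    { split; [apply Rabs_pos_lt; lra|]; apply Rabs_le; lra. }
    assert (W : norm (minus (w (a + x)) (w (a + y))) <= C * Rpower (Rabs (x - y)) (1 / 4)).
    { destruct (Rlt_dec x y) as [Hxy|Hxy].
      - rewrite norm_minus_sym, Rabs_left by lra.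
        replace (- (x - y)) with (a + y - (a + x)) by ring; apply wH; lra.
      - rewrite Rabs_pos_eq by lra.
        replace (x - y) with (a + x - (a + y)) by ring; apply wH; lra. }
    pose proof (Rpower_le_exponent _ gam (1 / 4) Hr (Rmin_l _ _)) as E1.
    pose proof (Rpower_le_exponent _ gam theta Hr (Rmin_r _ _)) as E2.
    set (p := Rpower (Rabs (x - y)) gam) in *.
    replace (K * (C + 1) * p) with (K * (C * p) + K * p) by ring.
    apply Rplus_le_compat; apply Rmult_le_compat_l; auto.
    eapply Rle_trans; [exact W|apply Rmult_le_compat_l; assumption]. }
  assert (Cga : forall s, continuous ga s) by (apply shift_continuous, Cg).
  assert (Bga : forall s, norm (ga s) <= M) by (intros; apply Bg).
  assert (HKC : 0 <= K * (C + 1)) by (apply Rmult_le_pos; lra).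
  set (u := mild A (B (w a)) ga).
  assert (Eu : forall s, a <= s <= T0 -> B (w s) = u (s - a)).
  { assert (M0 : forall s, 0 <= s <= T0 -> B (w s) = mild A (B w0) g s).
    { intros s Hs; rewrite (mild_inverse_sqrt w0 g s M) by (try assumption; lra).
      rewrite Ew by lra; reflexivity. }
    intros s Hs; unfold u; rewrite !M0 by lra.
    replace s with (a + (s - a)) at 1 by ring.
    apply mild_add; [exact Cg|lra|lra]. }
  assert (HtL : 0 < t - a < L) by (unfold L, a; lra).
  pose proof (mild_generator_approx (A := A) (B (w a)) ga M L (K * (C + 1)) gam (t - a) Cga Bga Hgam
    (proj1 HtL) HKC Hg (t - a) ltac:(lra)) as [Du _].
  pose proof (mild_generator_continuous (A := A) (B (w a)) ga M L (K * (C + 1)) gam Cga Bga Hgam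
    HKC Hg (t - a) HtL) as Cu.
  pose proof (mild_is_derive (A := A) (B (w a)) ga M L (K * (C + 1)) gam Cga Bga Hgam
    HKC Hg (t - a) HtL) as Pu.
  fold u in Du, Cu, Pu; rewrite <- Eu in Du by (unfold a; lra).
  assert (Eg : ga (t - a) = Phi t (w t)).
  { unfold ga, g; replace (a + (t - a)) with t by ring; rewrite clamp_id by lra; reflexivity. }
  assert (Hr : 0 < Rmin a (T0 - t)) by (apply Rmin_glb_lt; lra).
  assert (Nr : forall s, Rabs (s - t) < Rmin a (T0 - t) -> a <= s <= T0).
  { intros s Hs; pose proof (Rmin_l a (T0 - t)); pose proof (Rmin_r a (T0 - t)).
    apply Rabs_def2 in Hs; unfold a in *; lra. }
  assert (Cs : continuous (fun s => s - a) t) by (apply: ex_derive_continuous; auto_derive; trivial).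
  split; [exact Du|split; [|split]].
  - apply (continuous_ext_loc _ (fun s => A (u (s - a)))).
    + exists (mkposreal _ Hr); intros s Hs; rewrite Eu by (apply Nr; exact Hs); reflexivity.
    + apply (continuous_comp (fun s => s - a) (fun s => A (u s))); assumption.
  - apply (continuous_ext_loc _ g); [|apply Cg].
    exists (mkposreal _ Hr); intros s Hs; unfold g.
    rewrite clamp_id by (assert (a <= s <= T0) by (apply Nr; exact Hs); lra); reflexivity.
  - rewrite (Eu t) by (unfold a; lra); rewrite <- Eg.
    apply (is_derive_ext_loc (fun s => u (s - a))).
    + exists (mkposreal _ Hr); intros s Hs; rewrite Eu by (apply Nr; exact Hs); reflexivity.
    + replace (plus (A (u (t - a))) (ga (t - a))) with (scal 1 (plus (A (u (t - a))) (ga (t - a)))) by vec.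
      apply (is_derive_comp (V := H) u (fun s => s - a)); [exact Pu|auto_derive; [trivial|ring]].
Qed.

End LocalExistence.

(** * The delay problem *)

Lemma orthant4_locally_bounded (h : R * R * R * R -> R) (a b c d : R) :
  continuous_on orthant4 h -> 0 <= a -> 0 <= b -> 0 <= c -> 0 <= d ->
  exists eta, 0 < eta /\ forall a' b' c' d', 0 <= a' -> 0 <= b' -> 0 <= c' -> 0 <= d' ->
    Rabs (a' - a) < eta -> Rabs (b' - b) < eta -> Rabs (c' - c) < eta -> Rabs (d' - d) < eta ->
    h (a', b', c', d') <= h (a, b, c, d) + 1.
Proof.
  intros Ch Ha Hb Hc Hd.
  assert (O : orthant4 (a, b, c, d)) by (repeat split; assumption).
  destruct (proj1 (filterlim_locally _ _) (Ch (a, b, c, d) O) (mkposreal 1 Rlt_0_1)) as [[e He] E].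
  exists e; split; [exact He|intros a' b' c' d' Ha' Hb' Hc' Hd' Na Nb Nc Nd].
  assert (Bl : Rabs (h (a', b', c', d') - h (a, b, c, d)) < 1).
  { apply (E (a', b', c', d')); [repeat split; assumption|repeat split; assumption]. }
  apply Rabs_def2 in Bl; lra.
Qed.

Lemma continuous_into_V_norm {H : HilbertSpace} (A : LinearOperator H) (I : R -> Prop)
    (U : R -> H) (t e : R) :
  continuous_into_V A I U -> I t -> 0 < e ->
  exists d, 0 < d /\ forall s, I s -> Rabs (s - t) < d -> norm_V A (minus (U s) (U t)) < e.
Proof.
  intros [_ C] It He.
  destruct (proj1 (filterlim_locally _ _) (C t It) (mkposreal e He)) as [[d Hd] D].
  exists d; split; [exact Hd|intros s Is Hs].
  assert (Bl : Rabs (norm_V A (minus (U s) (U t)) - 0) < e) by (apply (D s); assumption).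
  rewrite Rminus_0_r in Bl; apply Rabs_def2 in Bl; lra.
Qed.

Lemma locally_lip_sum {H : HilbertSpace} (theta T : R) (Phi : nat -> R -> H -> H) (n : nat)
    (t0 : R) (w0 : H) :
  (forall i, (1 <= i <= n)%nat -> locally_lip theta T (Phi i) t0 w0) ->
  locally_lip theta T (fun t w => sum_n_m (fun i => Phi i t w) 1 n) t0 w0.
Proof.
  induction n as [|n IH]; intros Lip.
  - exists 1, 0; split; [lra|split; [lra|]].
    assert (Z : forall t w, sum_n_m (fun i => Phi i t w) 1 0 = zero)
      by (intros; apply (sum_n_m_zero (G := H)); lia).
    intros t t' w w' _ _ _ _ _ _; rewrite !Z.
    assert (E : norm (minus (zero : H) (zero : H)) = 0) by apply norm_minus_diag.
    split; [intros _|]; eapply Rle_trans; [apply Req_le, E|lra|apply Req_le, E|lra].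
  - destruct IH as (d1 & K1 & Hd1 & HK1 & L1); [intros i Hi; apply Lip; lia|].
    destruct (Lip (S n) ltac:(lia)) as (d2 & K2 & Hd2 & HK2 & L2).
    exists (Rmin d1 d2), (K1 + K2); split; [apply Rmin_glb_lt; assumption|split; [lra|]].
    intros t t' w w' Ht Ht' Nt Nt' Nw Nw'.
    pose proof (Rmin_l d1 d2); pose proof (Rmin_r d1 d2).
    destruct (L1 t t' w w') as [A1 B1]; try assumption; try lra.
    destruct (L2 t t' w w') as [A2 B2]; try assumption; try lra.
    assert (E : forall t w, sum_n_m (fun i => Phi i t w) 1 (S n)
      = plus (sum_n_m (fun i => Phi i t w) 1 n) (Phi (S n) t w))
      by (intros; apply (sum_n_Sm (G := H)); lia).
    assert (Tri : forall x x' y y' : H, norm (minus (plus x y) (plus x' y'))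
      <= norm (minus x x') + norm (minus y y')).
    { intros x x' y y'; eapply Rle_trans; [|apply norm_plus_le]; apply Req_le; f_equal; vec. }
    rewrite !E; split; [intros N|].
    + specialize (A1 N); specialize (A2 N); eapply Rle_trans; [apply Tri|lra].
    + eapply Rle_trans; [apply Tri|lra].
Qed.

Section Problem.

Context {H : HilbertSpace} {A : LinearOperator H} {lam : R}
  {CA : coercive_selfadjoint A lam}.

Let lam_pos : 0 < lam := coercive_pos.

Local Notation G := (inverse_opp A).
Local Notation B := (inverse_sqrt A 0).

Lemma inverse_sqrt_minus (w w' : H) : minus (B w) (B w') = B (minus w w').
Proof. symmetry; apply (linear_minus B), (inverse_sqrt_linear (lam := lam)); lra. Qed.

Lemma norm_V_minus (w w' : H) : norm_V A (minus (B w) (B w')) = norm (minus w w').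
Proof. rewrite inverse_sqrt_minus; apply norm_V_inverse_sqrt. Qed.

Lemma norm_V_near (w w' : H) (e : R) : norm (minus w w') < e ->
  Rabs (norm_V A (B w) - norm_V A (B w')) < e.
Proof.
  intros E; rewrite !norm_V_inverse_sqrt.
  pose proof (norm_le_minus w w'); pose proof (norm_le_minus w' w).
  rewrite (norm_minus_sym w') in H1; apply Rabs_def1; lra.
Qed.

(** The V-norms occurring are norms of w, w' and of preimages of V(t), V(t'), hence close to those
    of w0 and p0, where h1 and h2 are bounded. The H-norm term is absorbed through lam^(-1/2), and
    the delayed term becomes Hoelder in time. *)
Lemma nonlinearity_locally_lip (F : H -> H -> H) (beta C0 theta L T : R)
    (h1 h2 : R * R * R * R -> R) (V : R -> H) (t0 : R) (w0 : H) :
  0 < theta -> 0 < T -> continuous_on orthant4 h1 -> continuous_on orthant4 h2 ->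
  (forall p, orthant4 p -> 0 <= h1 p) -> (forall p, orthant4 p -> 0 <= h2 p) ->
  (forall U1 U2 V1 V2 : H, in_V A U1 -> in_V A U2 -> in_V A V1 -> in_V A V2 ->
    norm (minus (F U1 V1) (F U2 V2)) <=
      C0 * norm (minus U1 U2)
      + h1 (norm_V A U1, norm_V A U2, norm_V A V1, norm_V A V2) * norm_V A (minus U1 U2)
      + h2 (norm_V A U1, norm_V A U2, norm_V A V1, norm_V A V2) * frac_norm A beta (minus V1 V2)) ->
  continuous_into_V A (fun t => 0 <= t <= T) V ->
  (forall s t, 0 <= s <= T -> 0 <= t <= T -> s <> t ->
    frac_norm A beta (minus (V s) (V t)) <= L * Rpower (Rabs (s - t)) theta) ->
  0 <= t0 <= T ->
  locally_lip theta T (fun t w => F (B w) (V t)) t0 w0.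
Proof.
  intros Hth HT Ch1 Ch2 Ph1 Ph2 HF CV HL Ht0.
  destruct (proj1 (in_V_iff (A := A) _) (proj1 CV t0 Ht0)) as [p0 Ep0].
  destruct (orthant4_locally_bounded h1 (norm w0) (norm w0) (norm p0) (norm p0) Ch1)
    as (e1 & He1 & E1); try apply norm_ge_0.
  destruct (orthant4_locally_bounded h2 (norm w0) (norm w0) (norm p0) (norm p0) Ch2)
    as (e2 & He2 & E2); try apply norm_ge_0.
  set (e := Rmin e1 e2); assert (He : 0 < e) by (apply Rmin_glb_lt; assumption).
  assert (Re1 : e <= e1) by apply Rmin_l. assert (Re2 : e <= e2) by apply Rmin_r.
  destruct (continuous_into_V_norm A _ V t0 e CV Ht0 He) as (d & Hd & D).
  pose proof (sqrt_lt_R0 lam lam_pos) as Hq.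
  set (M1 := h1 (norm w0, norm w0, norm p0, norm p0) + 1).
  set (M2 := h2 (norm w0, norm w0, norm p0, norm p0) + 1).
  assert (HM1 : 0 <= M1).
  { unfold M1; assert (0 <= h1 (norm w0, norm w0, norm p0, norm p0)); [|lra].
    apply Ph1; repeat split; apply norm_ge_0. }
  assert (HM2 : 0 <= M2).
  { unfold M2; assert (0 <= h2 (norm w0, norm w0, norm p0, norm p0)); [|lra].
    apply Ph2; repeat split; apply norm_ge_0. }
  set (K := Rabs C0 / sqrt lam + M1 + M2 * Rabs L).
  pose proof (Rabs_pos C0); pose proof (Rabs_pos L).
  assert (HC : 0 <= Rabs C0 / sqrt lam) by (apply Rdiv_le_0_compat; lra).
  assert (HML : 0 <= M2 * Rabs L) by (apply Rmult_le_pos; lra).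
  assert (HK : 0 <= K) by (unfold K; lra).
  set (del := Rmin e d); assert (Hdel : 0 < del) by (apply Rmin_glb_lt; assumption).
  assert (Rd1 : del <= e) by apply Rmin_l. assert (Rd2 : del <= d) by apply Rmin_r.
  assert (Main : forall t t' w w', 0 <= t <= T -> 0 <= t' <= T -> Rabs (t - t0) < del ->
    Rabs (t' - t0) < del -> norm (minus w w0) < del -> norm (minus w' w0) < del -> t <> t' ->
    norm (minus (F (B w) (V t)) (F (B w') (V t')))
      <= K * norm (minus w w') + K * Rpower (Rabs (t - t')) theta).
  { intros t t' w w' Ht Ht' Nt Nt' Nw Nw' N.
    destruct (proj1 (in_V_iff (A := A) _) (proj1 CV t Ht)) as [p Ep].
    destruct (proj1 (in_V_iff (A := A) _) (proj1 CV t' Ht')) as [p' Ep'].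
    pose proof (D t Ht ltac:(lra)) as Dp; pose proof (D t' Ht' ltac:(lra)) as Dp'.
    rewrite Ep, Ep0, norm_V_minus in Dp; rewrite Ep', Ep0, norm_V_minus in Dp'.
    assert (Iv : forall w, in_V A (B w)) by (intros x; apply in_V_iff; exists x; reflexivity).
    pose proof (HF (B w) (B w') (V t) (V t') (Iv w) (Iv w') (proj1 CV t Ht) (proj1 CV t' Ht')) as FL.
    specialize (HL t t' Ht Ht' N).
    pose proof (norm_V_near w w0 e ltac:(lra)) as Q1; pose proof (norm_V_near w' w0 e ltac:(lra)) as Q2.
    pose proof (norm_V_near p p0 e Dp) as Q3; pose proof (norm_V_near p' p0 e Dp') as Q4.
    rewrite !norm_V_inverse_sqrt in Q1, Q2, Q3, Q4.
    assert (EV : norm_V A (V t) = norm p) by (rewrite Ep; apply norm_V_inverse_sqrt).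
    assert (EV' : norm_V A (V t') = norm p') by (rewrite Ep'; apply norm_V_inverse_sqrt).
    rewrite EV, EV', !norm_V_inverse_sqrt, norm_V_minus in FL.
    pose proof (norm_ge_0 w); pose proof (norm_ge_0 w'); pose proof (norm_ge_0 p);
      pose proof (norm_ge_0 p').
    specialize (E1 (norm w) (norm w') (norm p) (norm p')).
    specialize (E2 (norm w) (norm w') (norm p) (norm p')).
    fold M1 in E1; fold M2 in E2.
    assert (B1 : h1 (norm w, norm w', norm p, norm p') <= M1) by (apply E1; lra).
    assert (B2 : h2 (norm w, norm w', norm p, norm p') <= M2) by (apply E2; lra).
    assert (P2 : 0 <= h2 (norm w, norm w', norm p, norm p')) by (apply Ph2; repeat split; assumption).
    eapply Rle_trans; [exact FL|].
    pose proof (norm_ge_0 (minus w w')) as Pw.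
    assert (T1 : C0 * norm (minus (B w) (B w')) <= Rabs C0 / sqrt lam * norm (minus w w')).
    { rewrite inverse_sqrt_minus.
      apply Rle_trans with (Rabs C0 * norm (B (minus w w'))).
      - apply Rmult_le_compat_r; [apply norm_ge_0|apply Rle_abs].
      - replace (Rabs C0 / sqrt lam * norm (minus w w'))
          with (Rabs C0 * (norm (minus w w') / sqrt lam)) by (unfold Rdiv; ring).
        apply Rmult_le_compat_l; [lra|apply inverse_sqrt_0_bound]. }
    assert (T2 : h1 (norm w, norm w', norm p, norm p') * norm (minus w w') <= M1 * norm (minus w w'))
      by (apply Rmult_le_compat_r; assumption).
    set (rho := Rpower (Rabs (t - t')) theta) in *; assert (Hrho : 0 < rho) by apply exp_pos.
    assert (T3 : h2 (norm w, norm w', norm p, norm p') * frac_norm A beta (minus (V t) (V t'))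
      <= M2 * Rabs L * rho).
    { apply Rle_trans with (h2 (norm w, norm w', norm p, norm p') * (Rabs L * rho)).
      - apply Rmult_le_compat_l; [exact P2|]; eapply Rle_trans; [exact HL|].
        apply Rmult_le_compat_r; [lra|apply Rle_abs].
      - rewrite Rmult_assoc; apply Rmult_le_compat_r; [apply Rmult_le_pos; lra|exact B2]. }
    assert (T4 : M2 * Rabs L * rho <= K * rho) by (apply Rmult_le_compat_r; unfold K; lra).
    assert (T5 : (Rabs C0 / sqrt lam + M1) * norm (minus w w') <= K * norm (minus w w'))
      by (apply Rmult_le_compat_r; unfold K; lra).
    lra. }
  exists del, K; split; [exact Hdel|split; [exact HK|]].
  intros t t' w w' Ht Ht' Nt Nt' Nw Nw'; split; [intros N; apply Main; assumption|].
  (* The case of equal times passes through a nearby time, as the Hoelder hypothesis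
     only concerns distinct times. *)
  apply Rle_plus_epsilon; intros eps Heps.
  destruct (Rpower_small theta (eps / (2 * (K + 1))) Hth) as (r & Hr & R).
  { apply Rdiv_lt_0_compat; lra. }
  (* Small enough that t + k or t - k lies in [0, T] and in the neighbourhood of t0. *)
  set (k := Rmin (Rmin r T) (del - Rabs (t - t0)) / 4).
  assert (Hk : 0 < k /\ k < r /\ 4 * k <= T /\ k < del - Rabs (t - t0)).
  { unfold k; pose proof (Rmin_l (Rmin r T) (del - Rabs (t - t0))).
    pose proof (Rmin_r (Rmin r T) (del - Rabs (t - t0))).
    pose proof (Rmin_l r T); pose proof (Rmin_r r T).
    assert (0 < Rmin (Rmin r T) (del - Rabs (t - t0))) by (repeat apply Rmin_glb_lt; lra). lra. }
  assert (Ex : exists s, 0 <= s <= T /\ Rabs (t - s) = k).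
  { destruct (Rle_dec t (T / 2)).
    - exists (t + k); split; [lra|rewrite Rabs_left; lra].
    - exists (t - k); split; [lra|rewrite Rabs_pos_eq; lra]. }
  destruct Ex as (s & Hs & Es).
  assert (Ns : t <> s) by (intros ->; rewrite Rminus_diag_eq, Rabs_R0 in Es by reflexivity; lra).
  assert (Ns0 : Rabs (s - t0) < del).
  { replace (s - t0) with ((s - t) + (t - t0)) by ring.
    eapply Rle_lt_trans; [apply Rabs_triang|rewrite (Rabs_minus_sym s); lra]. }
  pose proof (Main t s w w' Ht Hs Nt Ns0 Nw Nw' Ns) as M3.
  pose proof (Main t s w' w' Ht Hs Nt Ns0 Nw' Nw' Ns) as M4.
  rewrite norm_minus_diag, Rmult_0_r, Rplus_0_l in M4.
  rewrite Es in M3, M4; specialize (R k ltac:(lra)).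
  pose proof (norm_minus_trans (F (B w') (V s)) (F (B w) (V t)) (F (B w') (V t))) as Tri.
  rewrite (norm_minus_sym (F (B w') (V s))) in Tri.
  assert (K * Rpower k theta <= eps / 2).
  { assert (0 < Rpower k theta) by apply exp_pos.
    apply (Rmult_lt_compat_l (K + 1)) in R; [|lra].
    replace ((K + 1) * (eps / (2 * (K + 1)))) with (eps / 2) in R by (field; lra); lra. }
  lra.
Qed.

(** With y = -A B w one has B w = G y = B (B y), so w = B y and |w|^2 = (G y, y) by
    [inverse_sqrt_ip]. *)
Lemma generator_energy (w : H) : dom A (B w) -> ip (A (B w)) (B w) = - norm w ^ 2.
Proof.
  intros Dw; set (y := opp (A (B w))).
  assert (E : B w = B (B y)) by (rewrite inverse_sqrt_sq; symmetry; apply inverse_opp_op, Dw).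
  apply inverse_sqrt_injective in E.
  replace (A (B w)) with (opp y) by (unfold y; vec).
  rewrite ip_opp_l, E, inverse_sqrt_sq, <- ip_norm, inverse_sqrt_ip, ip_sym; reflexivity.
Qed.

(** Both points are interior because the differential equation is available only after the starting
    time. *)
Lemma nonincreasing_of_derivative (f df : R -> R) (a b p q : R) :
  (forall t, a < t < b -> is_derive f t (df t)) -> (forall t, a < t < b -> df t <= 0) ->
  a < p -> p <= q -> q < b -> f q <= f p.
Proof.
  intros Df Ndf Hp Hpq Hq.
  destruct (MVT_gen f p q df) as [c [Hc E]].
  - intros x Hx; rewrite Rmin_left, Rmax_right in Hx by lra; apply Df; lra.
  - intros x Hx; rewrite Rmin_left, Rmax_right in Hx by lra.
    apply continuity_pt_filterlim; apply: ex_derive_continuous; exists (df x); apply Df; lra.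
  - rewrite Rmin_left, Rmax_right in Hc by lra; specialize (Ndf c ltac:(lra)); nra.
Qed.

(** * Uniqueness by an energy estimate *)

Section Uniqueness.

Context (theta T : R) (Psi : R -> H -> H) (u1 u2 : R -> H).
Hypothesis (Psi_lip : forall t0 w0, 0 <= t0 <= T ->
  locally_lip theta T (fun t w => Psi t (B w)) t0 w0).
Hypothesis (u1_cont : continuous_into_V A (fun t => 0 <= t /\ Rbar_lt t T) u1).
Hypothesis (u2_cont : continuous_into_V A (fun t => 0 <= t /\ Rbar_lt t T) u2).
Hypothesis (u1_eq : forall t, 0 < t < T ->
  dom A (u1 t) /\ is_derive u1 t (plus (A (u1 t)) (Psi t (u1 t)))).
Hypothesis (u2_eq : forall t, 0 < t < T ->
  dom A (u2 t) /\ is_derive u2 t (plus (A (u2 t)) (Psi t (u2 t)))).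

Lemma uniqueness_step (t0 : R) : 0 <= t0 < T -> u1 t0 = u2 t0 ->
  exists d, 0 < d /\ forall t, t0 <= t < T -> t < t0 + d -> u1 t = u2 t.
Proof.
  intros Ht0 E0.
  assert (I0 : 0 <= t0 /\ Rbar_lt t0 T) by (split; [lra|simpl; lra]).
  destruct (proj1 (in_V_iff (A := A) _) (proj1 u1_cont t0 I0)) as [w0 Ew0].
  destruct (Psi_lip t0 w0 ltac:(lra)) as (del & K & Hdel & HK & Lip).
  destruct (continuous_into_V_norm A _ u1 t0 del u1_cont I0 Hdel) as (d1 & Hd1 & D1).
  destruct (continuous_into_V_norm A _ u2 t0 del u2_cont I0 Hdel) as (d2 & Hd2 & D2).
  set (d := Rmin (Rmin del (T - t0)) (Rmin d1 d2)).
  assert (Hd : 0 < d) by (unfold d; repeat apply Rmin_glb_lt; lra).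
  assert (Rd : d <= del /\ d <= T - t0 /\ d <= d1 /\ d <= d2).
  { unfold d; pose proof (Rmin_l (Rmin del (T - t0)) (Rmin d1 d2)).
    pose proof (Rmin_r (Rmin del (T - t0)) (Rmin d1 d2)).
    pose proof (Rmin_l del (T - t0)); pose proof (Rmin_r del (T - t0)).
    pose proof (Rmin_l d1 d2); pose proof (Rmin_r d1 d2); lra. }
  set (z := fun t => minus (u1 t) (u2 t)).
  (* The least c with 2 K m n - 2 m^2 <= c n^2, where m and n are the V-norm and the H-norm of the
     difference: the dissipation absorbs the V-norm coming from the Lipschitz bound. *)
  set (c := K ^ 2 / 2).
  set (dz := fun t => plus (minus (A (u1 t)) (A (u2 t))) (minus (Psi t (u1 t)) (Psi t (u2 t)))).
  set (Q := fun t => exp (- c * t) * ip (z t) (z t)).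
  set (dQ := fun t => - c * exp (- c * t) * ip (z t) (z t) + exp (- c * t) * (2 * ip (dz t) (z t))).
  assert (DQ : forall t, t0 < t < t0 + d -> is_derive Q t (dQ t)).
  { intros t Ht; destruct (u1_eq t ltac:(lra)) as [_ P1]; destruct (u2_eq t ltac:(lra)) as [_ P2].
    assert (Dz : is_derive z t (dz t)).
    { pose proof (is_derive_minus (V := H) _ _ _ _ _ P1 P2) as P3.
      assert (Ed : dz t = minus (plus (A (u1 t)) (Psi t (u1 t))) (plus (A (u2 t)) (Psi t (u2 t))))
        by (unfold dz; vec).
      rewrite Ed; exact P3. }
    pose proof (is_derive_ip z z t _ _ Dz Dz) as Dzz.
    assert (De : is_derive (fun t => exp (- c * t)) t (- c * exp (- c * t)))
      by (auto_derive; [trivial|ring]).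
    pose proof (is_derive_mult (K := R_AbsRing) _ _ t _ _ De Dzz Rmult_comm) as Dm.
    evar_last; [exact Dm|].
    unfold dQ, plus, mult; simpl; rewrite (ip_sym _ (z t) (dz t)); ring. }
  assert (NQ : forall t, t0 < t < t0 + d -> dQ t <= 0).
  { intros t Ht; assert (It : 0 <= t /\ Rbar_lt t T) by (split; [lra|simpl; lra]).
    destruct (proj1 (in_V_iff (A := A) _) (proj1 u1_cont t It)) as [w1 Ew1].
    destruct (proj1 (in_V_iff (A := A) _) (proj1 u2_cont t It)) as [w2 Ew2].
    destruct (u1_eq t ltac:(lra)) as [X1 _]; destruct (u2_eq t ltac:(lra)) as [X2 _].
    assert (At : Rabs (t - t0) < d) by (rewrite Rabs_pos_eq; lra).
    specialize (D1 t It ltac:(lra)); specialize (D2 t It ltac:(lra)).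
    rewrite Ew1, Ew0, norm_V_minus in D1; rewrite Ew2, <- E0, Ew0, norm_V_minus in D2.
    destruct (Lip t t w1 w2 ltac:(lra) ltac:(lra) ltac:(lra) ltac:(lra) D1 D2) as [_ L2].
    assert (En : ip (minus (A (u1 t)) (A (u2 t))) (z t) = - norm (minus w1 w2) ^ 2).
    { rewrite <- (op_minus (u1 t) (u2 t) X1 X2); unfold z.
      assert (Dm : dom A (minus (u1 t) (u2 t))) by (apply dom_minus; assumption).
      rewrite Ew1, Ew2, inverse_sqrt_minus in Dm |- *; apply generator_energy, Dm. }
    pose proof (exp_pos (- c * t)) as Pe.
    assert (Hs : - c * ip (z t) (z t) + 2 * ip (dz t) (z t) <= 0).
    { unfold dz; rewrite ip_plus_l, En, ip_norm.
      pose proof (ip_le_norm (minus (Psi t (u1 t)) (Psi t (u2 t))) (z t)) as CS.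
      rewrite <- Ew1, <- Ew2 in L2.
      pose proof (norm_ge_0 (z t)) as Pz; set (n := norm (z t)) in *.
      set (m := norm (minus w1 w2)) in *.
      assert (norm (minus (Psi t (u1 t)) (Psi t (u2 t))) * n <= K * m * n)
        by (apply Rmult_le_compat_r; assumption).
      pose proof (pow2_ge_0 (2 * m - K * n)); unfold c; nra. }
    unfold dQ; nra. }
  exists d; split; [exact Hd|intros t Ht Htd].
  destruct (Req_dec t t0) as [->|N]; [exact E0|].
  apply minus_zero_eq; fold (z t).
  (* [Q] is known to be differentiable only after [t0]. It is compared with its value at some p >
     t0, which continuity into V makes at most [e]. *)
  assert (Qt : Q t <= 0).
  { apply Rle_plus_epsilon; intros e He; rewrite Rplus_0_l.
    pose proof (sqrt_lt_R0 lam lam_pos) as Hq.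
    assert (He' : 0 < sqrt e * sqrt lam / 2)
      by (apply Rdiv_lt_0_compat; [apply Rmult_lt_0_compat; [apply sqrt_lt_R0; lra|lra]|lra]).
    destruct (continuous_into_V_norm A _ u1 t0 _ u1_cont I0 He') as (r1 & Hr1 & R1).
    destruct (continuous_into_V_norm A _ u2 t0 _ u2_cont I0 He') as (r2 & Hr2 & R2).
    set (p := t0 + Rmin (t - t0) (Rmin r1 r2) / 2).
    assert (Hm : 0 < Rmin (t - t0) (Rmin r1 r2)) by (repeat apply Rmin_glb_lt; lra).
    pose proof (Rmin_l (t - t0) (Rmin r1 r2)); pose proof (Rmin_r (t - t0) (Rmin r1 r2)).
    pose proof (Rmin_l r1 r2); pose proof (Rmin_r r1 r2).
    assert (Hp : t0 < p <= t) by (unfold p; lra).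
    assert (Ip : 0 <= p /\ Rbar_lt p T) by (split; [lra|simpl; lra]).
    assert (Ap : Rabs (p - t0) < Rmin r1 r2) by (unfold p in *; rewrite Rabs_pos_eq; lra).
    specialize (R1 p Ip ltac:(lra)); specialize (R2 p Ip ltac:(lra)).
    eapply Rle_trans; [apply (nonincreasing_of_derivative Q dQ t0 (t0 + d) p t DQ NQ); lra|].
    destruct (proj1 (in_V_iff (A := A) _) (proj1 u1_cont p Ip)) as [w1 Ew1].
    destruct (proj1 (in_V_iff (A := A) _) (proj1 u2_cont p Ip)) as [w2 Ew2].
    rewrite Ew1, Ew0, norm_V_minus in R1; rewrite Ew2, <- E0, Ew0, norm_V_minus in R2.
    assert (Bz : norm (z p) <= sqrt e).
    { unfold z; rewrite Ew1, Ew2, inverse_sqrt_minus.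
      eapply Rle_trans; [apply inverse_sqrt_0_bound|].
      apply (Rmult_le_reg_r (sqrt lam)); [exact Hq|].
      unfold Rdiv; rewrite Rmult_assoc, Rinv_l, Rmult_1_r by lra.
      pose proof (norm_minus_trans w0 w1 w2) as Tri; rewrite (norm_minus_sym w0) in Tri; lra. }
    unfold Q; rewrite ip_norm.
    assert (Pe : exp (- c * p) <= 1).
    { rewrite <- exp_0; assert (Hc : 0 <= c * p)
        by (apply Rmult_le_pos; [unfold c; pose proof (pow2_ge_0 K); lra|lra]).
      destruct Hc as [Hc|Hc]; [left; apply exp_increasing; lra|right; f_equal; lra]. }
    pose proof (exp_pos (- c * p)); pose proof (norm_ge_0 (z p)).
    pose proof (sqrt_sqrt e ltac:(lra)); pose proof (pow2_ge_0 (norm (z p))).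
    assert (norm (z p) ^ 2 <= e) by nra. nra. }
  unfold Q in Qt; rewrite ip_norm in Qt.
  pose proof (exp_pos (- c * t)) as Pe; pose proof (norm_ge_0 (z t)).
  assert (norm (z t) ^ 2 <= 0) by (apply (Rmult_le_reg_l (exp (- c * t))); lra). nra.
Qed.

(** Let m be the supremum of the times up to which the solutions agree: continuity gives agreement
    at m, and [uniqueness_step] carries it beyond. *)
Lemma uniqueness : u1 0 = u2 0 -> forall t, 0 <= t < T -> u1 t = u2 t.
Proof.
  intros E0 t1 Ht1; apply NNPP; intros N.
  set (P := fun t => 0 <= t <= t1 /\ forall s, 0 <= s <= t -> u1 s = u2 s).
  destruct (completeness P) as [m [Um Lm]].
  { exists t1; intros x [Hx _]; lra. }
  { exists 0; split; [lra|intros s Hs; replace s with 0 by lra; exact E0]. }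
  assert (Hm0 : 0 <= m).
  { apply Um; split; [lra|intros s Hs; replace s with 0 by lra; exact E0]. }
  assert (Hm1 : m <= t1) by (apply Lm; intros x [Hx _]; lra).
  assert (Lt : forall s, 0 <= s < m -> u1 s = u2 s).
  { intros s Hs; apply NNPP; intros Ns.
    assert (m <= s); [|lra].
    apply Lm; intros x [Hx Px]; apply Rnot_lt_le; intros L; apply Ns, Px; lra. }
  assert (Em : u1 m = u2 m).
  { destruct Hm0 as [Hm0|Hm0]; [|rewrite <- Hm0; exact E0].
    apply eq_of_norm_small; intros e He.
    pose proof (sqrt_lt_R0 lam lam_pos) as Hq.
    assert (He' : 0 < e * sqrt lam / 2) by (apply Rdiv_lt_0_compat; [nra|lra]).
    assert (Im : 0 <= m /\ Rbar_lt m T) by (split; [lra|simpl; lra]).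
    destruct (continuous_into_V_norm A _ u1 m _ u1_cont Im He') as (r1 & Hr1 & R1).
    destruct (continuous_into_V_norm A _ u2 m _ u2_cont Im He') as (r2 & Hr2 & R2).
    set (p := m - Rmin m (Rmin r1 r2) / 2).
    assert (Hmm : 0 < Rmin m (Rmin r1 r2)) by (repeat apply Rmin_glb_lt; lra).
    pose proof (Rmin_l m (Rmin r1 r2)); pose proof (Rmin_r m (Rmin r1 r2)).
    pose proof (Rmin_l r1 r2); pose proof (Rmin_r r1 r2).
    assert (Hp : 0 <= p < m) by (unfold p; lra).
    assert (Ip : 0 <= p /\ Rbar_lt p T) by (split; [lra|simpl; lra]).
    assert (Ap : Rabs (p - m) < Rmin r1 r2) by (unfold p in *; rewrite Rabs_left; lra).
    specialize (R1 p Ip ltac:(lra)); specialize (R2 p Ip ltac:(lra)).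
    destruct (proj1 (in_V_iff (A := A) _) (proj1 u1_cont p Ip)) as [w Ew].
    destruct (proj1 (in_V_iff (A := A) _) (proj1 u1_cont m Im)) as [w1 Ew1].
    destruct (proj1 (in_V_iff (A := A) _) (proj1 u2_cont m Im)) as [w2 Ew2].
    rewrite <- (Lt p Hp) in R2.
    rewrite Ew, Ew1, norm_V_minus in R1; rewrite Ew, Ew2, norm_V_minus in R2.
    rewrite Ew1, Ew2, inverse_sqrt_minus.
    eapply Rle_trans; [apply inverse_sqrt_0_bound|].
    apply (Rmult_le_reg_r (sqrt lam)); [exact Hq|].
    unfold Rdiv; rewrite Rmult_assoc, Rinv_l, Rmult_1_r by lra.
    pose proof (norm_minus_trans w w1 w2) as Tri; rewrite (norm_minus_sym w1 w) in Tri; lra. }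
  destruct (Req_dec m t1) as [E|Nm]; [apply N; rewrite <- E; exact Em|].
  destruct (uniqueness_step m ltac:(lra) Em) as (d & Hd & D).
  set (t' := Rmin (m + d / 2) t1).
  assert (Ht' : m < t') by (apply Rmin_glb_lt; lra).
  pose proof (Rmin_l (m + d / 2) t1); pose proof (Rmin_r (m + d / 2) t1); fold t' in H0, H1.
  assert (P t').
  { split; [lra|intros s Hs]; destruct (Rlt_dec s m); [apply Lt; lra|apply D; lra]. }
  pose proof (Um t' H2); lra.
Qed.

End Uniqueness.

End Problem.

(** * Existence and uniqueness for the delay problem *)

Theorem proposition3p1
  (H : HilbertSpace) (A : LinearOperator H) (lambda1 : R)
  (A_negative : negative A) (A_selfadjoint : selfadjoint A)
  (lambda1_pos : 0 < lambda1)
  (lambda1_smallest : smallest_eigenvalue_opp A lambda1)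
  (N : nat) (N_pos : (1 <= N)%nat)
  (tau : nat -> R)
  (tau_pos : forall i, (1 <= i <= N)%nat -> 0 < tau i)
  (tau_distinct : forall i j, (1 <= i <= N)%nat -> (1 <= j <= N)%nat ->
     i <> j -> tau i <> tau j)
  (tau_max : forall i, (2 <= i <= N)%nat -> tau i < tau 1%nat)
  (F : nat -> H -> H -> H)
  (beta : R) (beta_range : 0 < beta < 1 / 2)
  (C0 : R) (h1 h2 : R * R * R * R -> R)
  (h1_cont : continuous_on orthant4 h1)
  (h2_cont : continuous_on orthant4 h2)
  (h1_nonneg : forall p, orthant4 p -> 0 <= h1 p)
  (h2_nonneg : forall p, orthant4 p -> 0 <= h2 p)
  (F_lipschitz : forall i, (1 <= i <= N)%nat -> forall U1 U2 V1 V2 : H,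
     in_V A U1 -> in_V A U2 -> in_V A V1 -> in_V A V2 ->
     norm (minus (F i U1 V1) (F i U2 V2)) <=
       C0 * norm (minus U1 U2)
       + h1 (norm_V A U1, norm_V A U2, norm_V A V1, norm_V A V2)
         * norm_V A (minus U1 U2)
       + h2 (norm_V A U1, norm_V A U2, norm_V A V1, norm_V A V2)
         * frac_norm A beta (minus V1 V2))
  (theta : R) (theta_def : theta = Rmin beta (1 / 2 - beta))
  (U0 : R -> H)
  (U0_cont : continuous_into_V A (fun t => 0 <= t <= tau 1%nat) U0)
  (U0_holder : holder_into_frac A beta theta (fun t => 0 <= t <= tau 1%nat) U0) :
  exists T : Rbar, Rbar_lt 0 T /\
    exists U : R -> H,
      is_solution A N tau F U0 T U /\
      forall U' : R -> H, is_solution A N tau F U0 T U' ->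
        forall t : R, - tau 1%nat < t -> Rbar_lt t T -> U' t = U t.
Proof.
  assert (CA : coercive_selfadjoint A lambda1)
    by (constructor; [assumption|assumption|apply lambda1_smallest]).
  assert (theta_pos : 0 < theta) by (rewrite theta_def; apply Rmin_glb_lt; lra).
  assert (tau1 : 0 < tau 1%nat) by (apply tau_pos; lia).
  assert (tau_le : forall i, (1 <= i <= N)%nat -> tau i <= tau 1%nat).
  { intros i Hi; destruct (Nat.eq_dec i 1) as [->|Ni]; [lra|].
    left; apply tau_max; lia. }
  (* A positive time below all delays: on [0, T] every delayed argument then belongs to the
     history. *)
  assert (Ex : forall n, (n <= N)%nat ->
    exists T, 0 < T /\ forall i, (1 <= i <= n)%nat -> T <= tau i).
  { induction n as [|n IH]; intros Hn.
    - exists 1; split; [lra|intros i Hi; lia].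
    - destruct (IH ltac:(lia)) as (T & HT & LT).
      exists (Rmin T (tau (S n))); split; [apply Rmin_glb_lt; [lra|apply tau_pos; lia]|].
      intros i Hi; destruct (Nat.eq_dec i (S n)) as [->|Ni]; [apply Rmin_r|].
      eapply Rle_trans; [apply Rmin_l|apply LT; lia]. }
  destruct (Ex N (le_n N)) as (T & HT & LT); clear Ex.
  set (B := inverse_sqrt A 0).
  (* [V i t] is the value of a solution at time t - tau_i, as U(s) = U0(s + tau_1) for s <= 0. *)
  set (V := fun i t => U0 (t - tau i + tau 1%nat)).
  set (Psi := fun t u => sum_n_m (fun i => F i u (V i t)) 1 N).
  assert (Ran : forall i t, (1 <= i <= N)%nat -> 0 <= t <= T -> 0 <= t - tau i + tau 1%nat <= tau 1%nat).
  { intros i t Hi Ht; specialize (LT i Hi); specialize (tau_le i Hi); lra. }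
  destruct U0_holder as [_ [L HL]].
  assert (CV : forall i, (1 <= i <= N)%nat -> continuous_into_V A (fun t => 0 <= t <= T) (V i)).
  { intros i Hi; split.
    - intros t Ht; apply U0_cont, Ran; assumption.
    - intros t Ht; apply filterlim_locally; intros [e He].
      destruct (continuous_into_V_norm A _ U0 _ e U0_cont (Ran i t Hi Ht) He) as (d & Hd & D).
      exists (mkposreal d Hd); intros s Hs Is.
      assert (Bd : norm_V A (minus (V i s) (V i t)) < e).
      { apply D; [apply Ran; assumption|].
        replace (s - tau i + tau 1%nat - (t - tau i + tau 1%nat)) with (s - t) by ring; exact Hs. }
      change (Rabs (norm_V A (minus (V i s) (V i t)) - 0) < e).
      rewrite Rminus_0_r, Rabs_pos_eq; [exact Bd|apply norm_ge_0]. }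
  assert (Psi_lip : forall t0 w0, 0 <= t0 <= T ->
    locally_lip theta T (fun t w => Psi t (B w)) t0 w0).
  { intros t0 w0 Ht0; apply (locally_lip_sum theta T (fun i t w => F i (B w) (V i t))).
    intros i Hi; apply (nonlinearity_locally_lip (F i) beta C0 theta L T h1 h2 (V i)); auto.
    intros s t Hs Ht Nst; eapply Rle_trans; [apply HL; [apply Ran|apply Ran|]; auto; lra|].
    apply Req_le; do 3 f_equal; ring. }
  assert (I1 : 0 <= tau 1%nat <= tau 1%nat) by lra.
  destruct (proj1 (in_V_iff (A := A) _) (proj1 U0_cont (tau 1%nat) I1)) as [w0 Ew0].
  destruct (local_existence (A := A) theta T (fun t w => Psi t (B w)) w0 theta_pos HT
    (Psi_lip 0 w0 ltac:(lra))) as (T0 & w & HT0 & Cw & Ew & Sw); fold B in Ew0, Sw.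
  (* The two branches agree at t = 0, since [B (w 0)] is [B w0], that is [U0 (tau 1)]; continuity
     into V on [0, T0) can thus be read off from [w] alone. *)
  set (U := fun t => match Rle_dec t 0 with left _ => U0 (t + tau 1%nat) | right _ => B (w t) end).
  assert (Uneg : forall t, t <= 0 -> U t = U0 (t + tau 1%nat)).
  { intros t Ht; unfold U; destruct (Rle_dec t 0); [reflexivity|contradiction]. }
  assert (Upos : forall t, 0 <= t -> U t = B (w t)).
  { intros t [Ht|Ht]; unfold U; destruct (Rle_dec t 0) as [L0|L0]; try lra; try reflexivity.
    rewrite <- Ht, Ew, Rplus_0_l; exact Ew0. }
  (* Stated for any function with the prescribed history, so that it serves the constructed solution
     and a competitor alike. For t > 0 the shifted argument is positive, inside the range of the
     history condition. *)
  assert (Del : forall U', (forall t, 0 < t <= tau 1%nat -> U' (t - tau 1%nat) = U0 t) ->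
    forall t, 0 < t < T0 -> sum_n_m (fun i => F i (U' t) (U' (t - tau i))) 1 N = Psi t (U' t)).
  { intros U' HU' t Ht; apply (sum_n_m_ext_loc (G := H)); intros i Hi; f_equal; unfold V.
    specialize (LT i Hi); specialize (tau_le i Hi).
    rewrite <- (HU' (t - tau i + tau 1%nat)) by lra; f_equal; ring. }
  assert (Uhist : forall t, 0 < t <= tau 1%nat -> U (t - tau 1%nat) = U0 t).
  { intros t Ht; rewrite Uneg by lra; f_equal; ring. }
  assert (Loc : forall t, 0 < t < T0 -> locally t (fun s => 0 < s < T0)).
  { intros t Ht; assert (Hr : 0 < Rmin t (T0 - t)) by (apply Rmin_glb_lt; lra).
    exists (mkposreal _ Hr); intros s Hs.
    assert (Hs' : Rabs (s - t) < Rmin t (T0 - t)) by exact Hs; apply Rabs_def2 in Hs'.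
    pose proof (Rmin_l t (T0 - t)); pose proof (Rmin_r t (T0 - t)); lra. }
  assert (SolU : is_solution A N tau F U0 T0 U).
  { split; [|split; [|exact Uhist]].
    - split.
      + intros t [Ht _]; rewrite Upos by exact Ht; apply in_V_iff; exists (w t); reflexivity.
      + intros t [Ht _]; apply filterlim_locally; intros [e He].
        destruct (proj1 (continuous_norm w t) (Cw t) e He) as (d & Hd & D).
        exists (mkposreal d Hd); intros s Hs [Is _].
        rewrite !Upos by assumption; unfold B; rewrite norm_V_minus.
        change (Rabs (norm (minus (w s) (w t)) - 0) < e).
        rewrite Rminus_0_r, Rabs_pos_eq by apply norm_ge_0; apply D; exact Hs.
    - exists (fun t => plus (A (U t)) (sum_n_m (fun i => F i (U t) (U (t - tau i))) 1 N)).
      intros t Ht HtT; assert (Ht' : 0 < t < T0) by (split; [exact Ht|exact HtT]).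
      destruct (Sw t Ht') as (Dw & CAw & CPw & Pw).
      split; [|split; [|split; [rewrite Upos by lra; exact Dw|reflexivity]]].
      + rewrite (Del U Uhist t Ht'), (Upos t) by lra.
        apply (is_derive_ext_loc (fun t => B (w t))); [|exact Pw].
        apply (filter_imp (fun s => 0 < s < T0)); [|apply Loc, Ht'].
        intros s Hs; rewrite Upos by lra; reflexivity.
      + apply (continuous_ext_loc _ (fun t => plus (A (B (w t))) (Psi t (B (w t)))));
          [|apply (continuous_plus (V := H)); assumption].
        apply (filter_imp (fun s => 0 < s < T0)); [|apply Loc, Ht'].
        intros s Hs; rewrite (Del U Uhist s Hs), (Upos s) by lra; reflexivity. }
  exists T0; split; [simpl; lra|exists U; split; [exact SolU|]].
  intros U' SolU' t Ht HtT.
  pose proof (proj2 (proj2 SolU')) as Uhist'.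
  assert (Hist : forall t, - tau 1%nat < t -> t <= 0 -> U' t = U t).
  { intros s Hs Hs0; rewrite Uneg by exact Hs0; rewrite <- Uhist' by lra; f_equal; ring. }
  destruct (Rle_dec t 0) as [Ht0|Ht0]; [apply Hist; assumption|].
  assert (Eqn : forall U', is_solution A N tau F U0 T0 U' -> forall t, 0 < t < T0 ->
    dom A (U' t) /\ is_derive U' t (plus (A (U' t)) (Psi t (U' t)))).
  { intros X [_ [[dX HX] HistX]] s Hs.
    destruct (HX s (proj1 Hs) (proj2 Hs)) as (PX & _ & DX & EX).
    split; [exact DX|]; rewrite EX, (Del X HistX s Hs) in PX; exact PX. }
  apply (uniqueness theta T0 Psi U' U).
  - intros t0 x0 Ht0'; destruct (Psi_lip t0 x0 ltac:(lra)) as (del & K & Hdel & HK & Lip).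
    exists del, K; split; [exact Hdel|split; [exact HK|]].
    intros a b x y Ha Hb; apply Lip; lra.
  - exact (proj1 SolU').
  - exact (proj1 SolU).
  - exact (Eqn U' SolU').
  - exact (Eqn U SolU).
  - apply Hist; lra.
  - split; [lra|exact HtT].
Qed.
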